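(* Let $(a_n)_{n\ge1}$ be complex numbers with $a_1=1$, let $P_N(s)=\sum_{n\le N}a_n n^{-s}$, and let $M_N=\max\{n\le N: a_n\neq 0\}$. Put $$E_N(\sigma)=\sum_{n\le N}|a_n|^2n^{-2\sigma}\qquad(\sigma\in\mathbb R).$$ Suppose there exist $\alpha\in\mathbb R$ and subsets $\mathcal Q_N\subset\{p\text{ prime}: N/2<p\le N\}$ with $\#\mathcal Q_N\to\infty$ as $N\to\infty$ such that: (1) for every $\sigma\in\mathbb R$, $$\frac{1}{2\log N}\log E_N(\sigma)\longrightarrow(\alpha-\sigma)_+\qquad(N\to\infty);$$ (2) for every compact interval $I\subset(-\infty,\alpha)$ there is $K_I\ge1$ such that, for all sufficiently large $N$, all $\sigma\in I$, and all $p,q\in\mathcal Q_N$, $$K_I^{-1}\le\frac{|a_p|p^{-\sigma}}{|a_q|q^{-\sigma}}\le K_I$$ (in particular $a_p\ne0$ for $p\in\mathcal Q_N$), and, with $B_N(\sigma)=\sum_{p\in\mathcal Q_N}|a_p|^2p^{-2\sigma}$, one has $$\frac{1}{2\log N}\log B_N(\sigma)\longrightarrow\alpha-\sigma\qquad(N\to\infty)$$ locally uniformly on $(-\infty,\alpha)$. Then, as $N\to\infty$, $$\frac{J_{P_N}(\sigma)}{\log N}\longrightarrow(\alpha-\sigma)_+$$ locally uniformly for $\sigma\in\mathbb R$, and $$\frac1{\log M_N}J_{P_N}''\longrightarrow\delta_\alpha$$ weakly as probability measures on $\mathbb R$. In particular, the family $\{P_N\}$ exhibits zero-density concentration on the line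 $\operatorname{Re}s=\alpha$.
   Context: $x_+=\max\{x,0\}$, and $\delta_\alpha$ is the Dirac mass at $\alpha$. For a finite Dirichlet sum $P(s)=\sum_{n\le N}a_nn^{-s}$ with $a_1\ne0$, its Jessen function is $$J_P(\sigma)=\lim_{T\to\infty}\frac1{2T}\int_{-T}^{T}\log|P(\sigma+it)|\,dt\qquad(\sigma\in\mathbb R);$$ the limit exists and $J_P$ is finite and convex on $\mathbb R$. $J_P''$ denotes its distributional second derivative, a positive Radon measure on $\mathbb R$ (the Lebesgue--Stieltjes measure of the increasing right derivative of $J_P$). Its total mass is $\log M$, where $M=\max\{n\le N:a_n\ne0\}$, so $J_P''/\log M$ is a probability measure when $M>1$. A family $\{P_N\}$ with $M_N\to\infty$ is said to exhibit zero-density concentration on the line $\operatorname{Re}s=\alpha$ if $\frac{1}{\log M_N}J_{P_N}''\to\delta_\alpha$ weakly as probability measures on $\mathbb R$ (convergence of integrals of all bounded continuous functions). *)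

(* Defs.v *)
From HB Require Import structures.
From mathcomp Require Import all_boot all_order all_algebra finmap.
From mathcomp Require Import all_classical all_reals all_analysis.
From mathcomp Require Import complex.

Set Implicit Arguments.
Unset Strict Implicit.
Unset Printing Implicit Defensive.

Import Order.TTheory GRing.Theory Num.Theory.
Import numFieldNormedType.Exports.

Local Open Scope classical_set_scope.
Local Open Scope ring_scope.
Local Open Scope complex_scope.

Notation cabs := Normc.normc (only parsing).

Section DirichletSums.
Context {R : realType}.
Implicit Types (a : nat -> R[i]) (N n : nat) (s : R[i]) (sigma alpha : R).

(* n ^ (- s) = exp (- s * log n) for n >= 1, by Euler's formula. *)
Definition natpowN n s : R[i] :=
  let: sigma +i* t := s in
  (n%:R `^ (- sigma))%:C * (cos (t * ln n%:R) -i* sin (t * ln n%:R)).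

Definition dirichlet_sum a N s : R[i] :=
  \sum_(1 <= n < N.+1) a n * natpowN n s.

Definition max_index a N : nat := \max_(1 <= n < N.+1 | a n != 0) n.

(* A Dirichlet sum with a_1 <> 0 has finitely many zeros on each vertical
   segment, so the value ln 0 = 0 does not affect the integral. *)
Definition jessen (P : R[i] -> R[i]) sigma : R :=
  lim ((2 * T)^-1 *
       (\int[lebesgue_measure]_(t in `[- T, T]) ln (cabs (P (sigma +i* t))))
         @[T --> +oo]).

Definition right_derivative (f : R -> R) (x : R) : R :=
  lim (h^-1 * (f (x + h) - f x) @[h --> 0^'+]).

(* The Lebesgue-Stieltjes measure of g; the zero measure when g is not
   nondecreasing and right-continuous. *)
Definition stieltjes (g : R -> R) :
    {measure set (measurableTypeR R) -> \bar R} :=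
  match pselect (exists F : cumulative R R, F = g :> (R -> R)) with
  | left F_ => lebesgue_stieltjes_measure (projT1 (cid F_))
  | right _ => mzero
  end.

(* For convex f, the distributional second derivative of f. *)
Definition second_derivative (f : R -> R) := stieltjes (right_derivative f).

Lemma invr_ln_nat_ge0 n : 0 <= (ln (n%:R : R))^-1.
Proof.
case: n => [|n]; first by rewrite ln0 ?invr0.
by rewrite invr_ge0 ln_ge0// ler1n.
Qed.

Definition normalized_jessen_measure a N :
    {measure set (measurableTypeR R) -> \bar R} :=
  mscale (NngNum (invr_ln_nat_ge0 (max_index a N)))
         (second_derivative (jessen (dirichlet_sum a N))).

(* The members of the sequence need only be probability measures from some
   index on. *)
Definition weak_cvg_probability
    (mu : nat -> {measure set (measurableTypeR R) -> \bar R})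
    (nu : {measure set (measurableTypeR R) -> \bar R}) : Prop :=
  [/\ \forall N \near \oo, mu N [set: R] = 1%E,
      nu [set: R] = 1%E &
      forall f : R -> R, continuous f -> bounded_fun f ->
        (\int[mu N]_x (f x)%:E)%E @[N --> \oo] --> (\int[nu]_x (f x)%:E)%E].

(* The family P_N = dirichlet_sum (A N) (d N). *)
Definition zero_density_concentration
    (A : nat -> nat -> R[i]) (d : nat -> nat) alpha : Prop :=
  (max_index (A N) (d N) @[N --> \oo] --> \oo) /\
  weak_cvg_probability (fun N => normalized_jessen_measure (A N) (d N))
                       (\d_(alpha : measurableTypeR R)).

Definition energy a N sigma : R :=
  \sum_(1 <= n < N.+1) cabs (a n) ^+ 2 * n%:R `^ (- (2 * sigma)).

Definition energy_on a (Q : {fset nat}) sigma : R :=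
  \sum_(p <- Q) cabs (a p) ^+ 2 * p%:R `^ (- (2 * sigma)).

End DirichletSums.

(* Main.v *)
(* Twisting P_N by the completely multiplicative character sending one prime p to
   a unimodular number does not change the mean over vertical lines of
   log |P_N|, regularized as (1/2) log (|P_N|^2 + eps).  For the primes p in
   (N/2, N] such a twist multiplies only the p-th term, so J_{P_N}(sigma) is also
   the mean of log |A + sum_p w_p a_p p^(-sigma)| over independent w_p.  Averaging
   one w_p gives at least log |a_p| p^(-sigma), whatever the other terms are.
   Averaging over k blocks of comparable terms, Paley-Zygmund makes one block
   of order B_N^(1/2) except with probability at most (7/8)^k; hence
   J_{P_N}(sigma) >= (1/2) log B_N(sigma) up to a small multiple of log N for
   sigma < alpha.  Concavity of the logarithm gives the upper bound
   J_{P_N} <= (1/2) log E_N, and J_{P_N} is convex, vanishes at +oo and has slope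
   - log M_N at -oo, so it is nonnegative and nonincreasing.  This gives pointwise,
   and by monotonicity locally uniform, convergence of J_{P_N} / log N; the chord
   slopes on both sides of alpha then concentrate the mass of J_{P_N}'' at alpha.
   The regularization is removed by a measure estimate for sublevel sets of
   exponential sums. *)

Require Import Defs.
From HB Require Import structures.
From mathcomp Require Import all_boot all_order all_algebra finmap.
From mathcomp Require Import all_classical all_reals all_analysis.
From mathcomp Require Import measurable_realfun.
From mathcomp Require Import complex ring lra.

Set Implicit Arguments.
Unset Strict Implicit.
Unset Printing Implicit Defensive.

Import Order.TTheory GRing.Theory Num.Theory.
Import numFieldNormedType.Exports.

Local Open Scope classical_set_scope.
Local Open Scope ring_scope.
Local Open Scope complex_scope.

(** No measure on an infinite torus appears: the independent w_p run over the L-th roots of unity,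
    so every expectation is a finite sum. The price is the error [avg_err], of order 1/L for fixed
    [eps]; as the mean along vertical lines does not involve L, the error is removed by letting L
    grow before [eps] tends to 0. Invariance under twists comes from approximation: the values
    |P_N|^2 + eps stay in a compact subset of the positive axis, where log is a uniform limit of
    polynomials, so [log_reg] is a uniform limit of trigonometric polynomials in the character.
    Convexity uses the same invariance. A vertical shift by h is a twist by n^(-ih), so the mean of
    a four-point inequality at s + h, s - h, s + ih, s - ih reduces to a bound -K h^3 from below for
    a second difference of the regularized mean in sigma. The 7/8 is 1 - 1/8, with 1/8 from
    Paley-Zygmund: each block recovers one eighth of what is still missing. With k blocks the loss
    is (7/8)^k / 2 times log N plus a constant depending on k, so k is fixed before N tends to
    infinity. *)

Local Notation Re := complex.Re.
Local Notation Im := complex.Im.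

Local Notation "z ^*" := (conjc z) : ring_scope.
Local Notation "z ^*" := (conjc z) : complex_scope.

(** * The modulus on R[i] and points of the unit circle *)

Section ComplexModulus.
Context {R : realType}.
Implicit Types (z w : R[i]) (x y t : R).

Lemma cabsE z : cabs z = Num.sqrt (Re z ^+ 2 + Im z ^+ 2).
Proof. by case: z. Qed.

Lemma sqr_cabs z : cabs z ^+ 2 = Re z ^+ 2 + Im z ^+ 2.
Proof. by rewrite cabsE sqr_sqrtr// addr_ge0// sqr_ge0. Qed.

Lemma cabs_ge0 z : 0 <= cabs z.
Proof. by rewrite cabsE sqrtr_ge0. Qed.

Lemma cabsD z w : cabs (z + w) <= cabs z + cabs w.
Proof. exact: le_normcD. Qed.

Lemma cabsN z : cabs (- z) = cabs z.
Proof. exact: normcN. Qed.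

Lemma cabsB z w : cabs (z - w) <= cabs z + cabs w.
Proof. by rewrite -(cabsN w) cabsD. Qed.

Lemma cabsBC z w : cabs (z - w) = cabs (w - z).
Proof. by rewrite -cabsN opprB. Qed.

Lemma cabs0 : cabs (0 : R[i]) = 0.
Proof. exact: Normc.normc0. Qed.

Lemma cabs1 : cabs (1 : R[i]) = 1.
Proof. exact: Normc.normc1. Qed.

Lemma cabsM z w : cabs (z * w) = cabs z * cabs w.
Proof. exact: Normc.normcM. Qed.

Lemma cabsX z n : cabs (z ^+ n) = cabs z ^+ n.
Proof. by elim: n => [|n IH]; rewrite ?cabs1// !exprS cabsM IH. Qed.

Lemma cabs_eq0 z : (cabs z == 0) = (z == 0).
Proof.
apply/eqP/eqP => [|->]; [exact: Normc.eq0_normc | exact: cabs0].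
Qed.

Lemma cabs_gt0 z : (0 < cabs z) = (z != 0).
Proof. by rewrite lt_def cabs_ge0 andbT cabs_eq0. Qed.

Lemma cabs_real x : cabs x%:C = `|x|.
Proof. by rewrite cabsE /= expr0n/= addr0 sqrtr_sqr. Qed.

Lemma cabsJ z : cabs z^* = cabs z.
Proof. by rewrite !cabsE; case: z => x y /=; rewrite sqrrN. Qed.

Lemma cabs_le_ReIm z : cabs z <= `|Re z| + `|Im z|.
Proof.
rewrite -(@ler_pXn2r _ 2)// ?nnegrE ?cabs_ge0 ?addr_ge0//.
rewrite sqr_cabs sqrrD !real_normK ?num_real// -addrA lerD2l lerDr mulrn_wge0// mulr_ge0//.
Qed.

Lemma cabs_dist z w : `|cabs z - cabs w| <= cabs (z - w).
Proof.
have H (u v : R[i]) : cabs u - cabs v <= cabs (u - v)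
  by rewrite lerBlDr; have := cabsD (u - v) v; rewrite subrK.
by rewrite ler_norml lerNl opprB H cabsBC H.
Qed.

Lemma cabs_sum I (r : seq I) (P : pred I) (F : I -> R[i]) :
  cabs (\sum_(i <- r | P i) F i) <= \sum_(i <- r | P i) cabs (F i).
Proof.
elim/big_rec2: _ => [|i y z _ H]; first by rewrite cabs0.
by apply: le_trans (cabsD _ _) _; rewrite lerD2l.
Qed.

Lemma ReD z w : Re (z + w) = Re z + Re w. Proof. by case: z; case: w. Qed.

Lemma Re_sum I (r : seq I) (P : pred I) (F : I -> R[i]) :
  Re (\sum_(i <- r | P i) F i) = \sum_(i <- r | P i) Re (F i).
Proof. exact: (big_morph _ ReD). Qed.

Lemma ImD z w : Im (z + w) = Im z + Im w. Proof. by case: z; case: w. Qed.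

Lemma Im_sum I (r : seq I) (P : pred I) (F : I -> R[i]) :
  Im (\sum_(i <- r | P i) F i) = \sum_(i <- r | P i) Im (F i).
Proof. exact: (big_morph _ ImD). Qed.

Lemma sqr_cabsD z w :
  cabs (z + w) ^+ 2 = cabs z ^+ 2 + 2 * Re (z * w^*) + cabs w ^+ 2.
Proof.
rewrite !sqr_cabs; case: z => a b; case: w => c d /=; ring.
Qed.

Lemma mulcJ_cabs z : z * z^* = (cabs z ^+ 2)%:C.
Proof.
rewrite sqr_cabs; case: z => a b; apply/eqP; rewrite eq_complex /=; apply/andP.
by split; apply/eqP; ring.
Qed.

Lemma conjcM z w : (z * w)^* = z^* * w^*.
Proof. exact: (rmorphM (@conjc R)). Qed.

Lemma conjc_sum I (r : seq I) (P : pred I) (F : I -> R[i]) :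
  (\sum_(i <- r | P i) F i)^* = \sum_(i <- r | P i) (F i)^*.
Proof. exact: (rmorph_sum (@conjc R)). Qed.

Definition cis x : R[i] := cos x +i* sin x.

Lemma cisD x y : cis (x + y) = cis x * cis y.
Proof.
apply/eqP; rewrite eq_complex /= cosD sinD; apply/andP; split; apply/eqP => //.
by ring.
Qed.

Lemma cis0 : cis 0 = 1.
Proof. by rewrite /cis cos0 sin0. Qed.

Lemma cisN x : cis (- x) = (cis x)^*.
Proof. by rewrite /cis cosN sinN. Qed.

Lemma cabs_cis x : cabs (cis x) = 1.
Proof. by rewrite cabsE /= cos2Dsin2 sqrtr1. Qed.

End ComplexModulus.

(** * Taylor remainders of sin, cos, cis and exp *)

Section Taylor.
Context {R : realType}.
Implicit Types (x y t X K : R).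

(** By the mean value theorem f x = df c * x with |c| <= |x|, so order n for the derivative becomes
    order n + 1 for the function. Iteration yields all remainders below, without factorials in the
    constants since c is only bounded by x. The range [X] serves for exp, whose constant depends on
    it. *)
Lemma le_pow_of_derive (f df : R -> R) K X n : 0 <= K -> f 0 = 0 ->
  (forall y : R, is_derive y 1 f (df y)) ->
  (forall y, `|y| <= X -> `|df y| <= K * `|y| ^+ n) ->
  forall x, `|x| <= X -> `|f x| <= K * `|x| ^+ n.+1.
Proof.
move=> K0 f0 fd H x xX.
have cf : continuous f.
  by move=> y; apply/differentiable_continuous/derivable1_diffP; have [] := fd y.
have [c cx] : exists2 c, `|c| <= `|x| & f x = df c * x.
  have [x0|x0] := leP 0 x.
    have [c] := @MVT_segment R f df 0 x x0 (fun y _ => fd y)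
      (continuous_subspaceT cf).
    rewrite f0 !subr0 in_itv/= => /andP[c0 cx] ->; exists c => //.
    by rewrite !ger0_norm.
  have [c] := @MVT_segment R f df x 0 (ltW x0) (fun y _ => fd y)
      (continuous_subspaceT cf).
  rewrite f0 !sub0r in_itv/= mulrN => /andP[xc c0] /oppr_inj fx.
  by exists c => //; rewrite (ler0_norm c0) (ler0_norm (ltW x0)) lerN2.
move=> ->; rewrite normrM exprSr mulrA ler_wpM2r//.
apply: le_trans (H _ (le_trans cx xX)) _.
by rewrite ler_wpM2l// lerXn2r// nnegrE.
Qed.

Lemma sin_le_abs x : `|sin x| <= `|x|.
Proof.
rewrite -[leRHS]expr1 -[leRHS]mul1r; apply: (@le_pow_of_derive sin cos 1 `|x|) => //.
- by rewrite sin0.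
- by move=> y _; rewrite expr0 mulr1 ler_norml cos_geN1 cos_le1.
Qed.

Lemma cosB1_le_abs x : `|cos x - 1| <= `|x|.
Proof.
rewrite -[leRHS]expr1 -[leRHS]mul1r.
apply: (@le_pow_of_derive (fun y => cos y - 1) (fun y => - sin y) 1 `|x|) => //.
- by rewrite cos0 subrr.
- move=> y; apply: is_derive_eq; rewrite subr0//.
- by move=> y _; rewrite expr0 mulr1 normrN ler_norml sin_geN1 sin_le1.
Qed.

Lemma cosB1_le_sqr x : `|cos x - 1| <= `|x| ^+ 2.
Proof.
rewrite -[leRHS]mul1r.
apply: (@le_pow_of_derive (fun y => cos y - 1) (fun y => - sin y) 1 `|x|) => //.
- by rewrite cos0 subrr.
- move=> y; apply: is_derive_eq; rewrite subr0//.
- by move=> y _; rewrite expr1 mul1r normrN sin_le_abs.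
Qed.

Lemma sinB_le_sqr x : `|sin x - x| <= `|x| ^+ 2.
Proof.
rewrite -[leRHS]mul1r.
apply: (@le_pow_of_derive (fun y => sin y - y) (fun y => cos y - 1) 1 `|x|) => //.
- by rewrite sin0 subrr.
- by move=> y _; rewrite expr1 mul1r cosB1_le_abs.
Qed.

Lemma sinB_le_cube x : `|sin x - x| <= `|x| ^+ 3.
Proof.
rewrite -[leRHS]mul1r.
apply: (@le_pow_of_derive (fun y => sin y - y) (fun y => cos y - 1) 1 `|x|) => //.
- by rewrite sin0 subrr.
- by move=> y _; rewrite mul1r cosB1_le_sqr.
Qed.

Lemma cosB_le_cube x : `|cos x - 1 + x ^+ 2 / 2| <= `|x| ^+ 3.
Proof.
rewrite -[leRHS]mul1r.
apply: (@le_pow_of_derive (fun y => cos y - 1 + y ^+ 2 / 2)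
   (fun y => y - sin y) 1 `|x|) => //.
- by rewrite cos0 subrr expr0n/= mul0r addr0.
- move=> y; apply: is_derive_eq.
  by rewrite /GRing.scale/=; field.
- by move=> y _; rewrite mul1r distrC sinB_le_sqr.
Qed.

Lemma cis_lip x : cabs (cis x - 1) <= 2 * `|x|.
Proof.
apply: le_trans (cabs_le_ReIm _) _; rewrite /= oppr0 addr0.
by have := cosB1_le_abs x; have := sin_le_abs x; lra.
Qed.

Lemma cis_taylor1 x : cabs (cis x - 1 - 'i%C * x%:C) <= 2 * `|x| ^+ 2.
Proof.
apply: le_trans (cabs_le_ReIm _) _.
rewrite /= !(mul0r, mul1r, mulr0, subr0, oppr0, addr0, sub0r, add0r).
by have := cosB1_le_sqr x; have := sinB_le_sqr x; lra.
Qed.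

Lemma cis_taylor2 x :
  cabs (cis x - 1 - 'i%C * x%:C + (x ^+ 2 / 2)%:C) <= 2 * `|x| ^+ 3.
Proof.
apply: le_trans (cabs_le_ReIm _) _.
rewrite /= !(mul0r, mul1r, mulr0, subr0, oppr0, addr0, sub0r, add0r).
by have := cosB_le_cube x; have := sinB_le_cube x; lra.
Qed.

Lemma expR_taylor0 X x : `|x| <= X -> `|expR x - 1| <= expR X * `|x|.
Proof.
move=> xX; rewrite -[X in _ <= _ * X]expr1.
apply: (@le_pow_of_derive (fun y => expR y - 1) expR (expR X) X) => //.
- by rewrite expR0 subrr.
- by move=> y; apply: is_derive_eq; rewrite subr0.
- move=> y yX; rewrite expr0 mulr1 ger0_norm ?expR_ge0// ler_expR.
  exact: le_trans (ler_norm _) yX.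
Qed.

Lemma expR_taylor1 X x : `|x| <= X -> `|expR x - 1 - x| <= expR X * `|x| ^+ 2.
Proof.
apply: (@le_pow_of_derive (fun y => expR y - 1 - y) (fun y => expR y - 1)) => //.
- by rewrite expR0 subrr subr0.
- by move=> y; apply: is_derive_eq; rewrite subr0.
- by move=> y yX; rewrite expr1 expR_taylor0.
Qed.

Lemma expR_taylor2 X x : `|x| <= X ->
  `|expR x - 1 - x - x ^+ 2 / 2| <= expR X * `|x| ^+ 3.
Proof.
apply: (@le_pow_of_derive (fun y => expR y - 1 - y - y ^+ 2 / 2)
  (fun y => expR y - 1 - y)) => //.
- by rewrite expR0 subrr subr0 expr0n/= mul0r subr0.
- by move=> y; apply: is_derive_eq; by rewrite /GRing.scale/=; field.
- exact: expR_taylor1.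
Qed.

End Taylor.

(** For eps > 0 it is Lipschitz on discs, unlike log |z|, and it is still subharmonic in z, which is
    the source of convexity in sigma. *)
Definition log_reg {R : realType} (eps : R) (z : R[i]) : R :=
  2^-1 * ln (cabs z ^+ 2 + eps).

(** * Averages over roots of unity *)

Section RootAverages.
Context {R : realType}.
Implicit Types (z w x y : R[i]) (s : seq R[i]) (f g h : R[i] -> R).

(** X^n - 1 splits over the closed field R[i] and is separable, and among n distinct n-th roots of
    unity one is primitive. *)
Lemma prim_root_exists n : (0 < n)%N -> exists z : R[i], n.-primitive_root z.
Proof.
pose p : {poly R[i]} := 'X^n - 1; have [r Dp] := closed_field_poly_normal p.
move=> n_gt0; rewrite (monicP _) ?monicXnsubC // scale1r in Dp.
have rn1 : all n.-unity_root r by apply/allP=> z; rewrite -root_prod_XsubC -Dp.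
have sz_r : (n < (size r).+1)%N.
  by rewrite -(size_prod_XsubC r id) -Dp size_XnsubC.
have [|z] := hasP (cyclic.has_prim_root n_gt0 rn1 _ sz_r); last by exists z.
rewrite -separable.separable_prod_XsubC -Dp.
by rewrite cyclotomic.separable_Xn_sub_1 // pnatr_eq0 -lt0n.
Qed.

Variables (L : nat) (zeta : R[i]).
Hypothesis (L_gt2 : (2 < L)%N) (prim_zeta : L.-primitive_root zeta).

Let L_gt0 : (0 < L)%N. Proof. by case: L L_gt2. Qed.

Let L0 : (L%:R : R) != 0. Proof. by rewrite pnatr_eq0 -lt0n. Qed.

(** Replaces the mean over the unit circle. Since L > 2, both zeta and zeta^2 differ from 1, so w
    and w^2 average to 0 and the second and fourth moments below are exactly those of the circle. *)
Definition ravg g : R := L%:R^-1 * \sum_(0 <= j < L) g (zeta ^+ j).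

Lemma cabs_zetaX j : cabs (zeta ^+ j) = 1.
Proof.
rewrite cabsX.
suff -> : cabs zeta = 1 by rewrite expr1n.
apply/eqP; rewrite -(@pexpr_eq1 _ _ L) ?cabs_ge0//.
by rewrite -cabsX (prim_expr_order prim_zeta) cabs1.
Qed.

Lemma eq_ravg g h : (forall w, g w = h w) -> ravg g = ravg h.
Proof. by move=> gh; congr (_ * _); apply: eq_bigr => j _. Qed.

Lemma ravg_cst (c : R) : ravg (fun=> c) = c.
Proof.
by rewrite /ravg sumr_const_nat subn0 -(mulr_natl c) mulrA mulVf// mul1r.
Qed.

Lemma ravgD g h : ravg (fun w => g w + h w) = ravg g + ravg h.
Proof. by rewrite /ravg big_split mulrDr. Qed.

Lemma ravgZ (c : R) g : ravg (fun w => c * g w) = c * ravg g.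
Proof. by rewrite /ravg -mulr_sumr mulrCA. Qed.

Lemma le_ravg g h : (forall w, cabs w = 1 -> g w <= h w) -> ravg g <= ravg h.
Proof.
move=> gh; rewrite /ravg ler_wpM2l ?invr_ge0 ?ler0n//.
by apply: ler_sum => j _; rewrite gh// cabs_zetaX.
Qed.

Lemma exchange_ravg (F : R[i] -> R[i] -> R) :
  ravg (fun w => ravg (fun v => F w v)) = ravg (fun v => ravg (fun w => F w v)).
Proof.
rewrite /ravg -!mulr_sumr; congr (_ * (_ * _)).
by rewrite exchange_big.
Qed.

Lemma ravg_rot i g : ravg (fun w => g (zeta ^+ i * w)) = ravg g.
Proof.
elim: i g => [|i IH] g; first by apply: eq_ravg => w; rewrite expr0 mul1r.
transitivity (ravg (fun w => g (zeta * w))).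
  by rewrite -(IH (fun w => g (zeta * w))); apply: eq_ravg => w; rewrite exprS mulrA.
rewrite /ravg; congr (_ * _); under eq_bigr do rewrite -exprS.
case: L L_gt0 prim_zeta => // n _ pz.
rewrite big_nat_recr// big_nat_recl//= addrC; congr (_ + _).
by rewrite (prim_expr_order pz) expr0.
Qed.

Lemma sum_zetaX : \sum_(0 <= j < L) zeta ^+ j = 0.
Proof.
have z1 : zeta != 1.
  apply/eqP => z1; have := prim_order_dvd prim_zeta 1.
  by rewrite z1 expr1n eqxx dvdn1; case: L L_gt2 => [|[|]].
apply/eqP; have /eqP : (zeta - 1) * \sum_(0 <= j < L) zeta ^+ j = 0.
  by rewrite big_mkord -subrX1 (prim_expr_order prim_zeta) subrr.
by rewrite mulf_eq0 subr_eq0 (negPf z1).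
Qed.

Lemma sum_sqr_zetaX : \sum_(0 <= j < L) (zeta ^+ j) ^+ 2 = 0.
Proof.
have z1 : zeta ^+ 2 != 1.
  apply/eqP => z1; have := prim_order_dvd prim_zeta 2.
  by rewrite z1 eqxx => /(dvdn_leq (isT : 0 < 2)%N); rewrite leqNgt L_gt2.
under eq_bigr do rewrite exprAC.
apply/eqP; have /eqP : (zeta ^+ 2 - 1) * \sum_(0 <= j < L) (zeta ^+ 2) ^+ j = 0.
  by rewrite big_mkord -subrX1 exprAC (prim_expr_order prim_zeta) expr1n subrr.
by rewrite mulf_eq0 subr_eq0 (negPf z1).
Qed.

Lemma ravg_Re (c : R[i]) : ravg (fun w => Re (w * c)) = 0.
Proof.
by rewrite /ravg -Re_sum -mulr_suml sum_zetaX mul0r mulr0.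
Qed.

Lemma ravg_Re2 (c : R[i]) : ravg (fun w => Re (w ^+ 2 * c)) = 0.
Proof.
by rewrite /ravg -Re_sum -mulr_suml sum_sqr_zetaX mul0r mulr0.
Qed.

(** The expectation of f (z + sum_i w_i c_i) for independent uniform roots of unity w_i, the c_i
    being the entries of [s]; the recursion replaces a product space. *)
Fixpoint iter_avg s f z : R :=
  if s is c :: s' then ravg (fun w => iter_avg s' f (z + w * c)) else f z.

Lemma eq_iter_avg s f g z : (forall y, f y = g y) -> iter_avg s f z = iter_avg s g z.
Proof.
move=> fg; elim: s z => [|c s IH] z //=.
by apply: eq_ravg => w.
Qed.

Lemma iter_avg_cat s1 s2 f z :
  iter_avg (s1 ++ s2) f z = iter_avg s1 (iter_avg s2 f) z.
Proof. by elim: s1 z => [|c s IH] z //=; apply: eq_ravg => w. Qed.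

(** The comparison is only asked on the disc that the random sum can reach, because the lower bounds
    for [log_reg] hold with constants depending on a radius. *)
Lemma le_iter_avg s f g z :
  (forall y, cabs y <= cabs z + \sum_(c <- s) cabs c -> f y <= g y) ->
  iter_avg s f z <= iter_avg s g z.
Proof.
elim: s z => [|c s IH] z fg /=; first by apply: fg; rewrite big_nil addr0.
apply: le_ravg => w w1; apply: IH => y yle; apply: fg.
rewrite big_cons addrA; apply: le_trans yle _; rewrite lerD2r.
by apply: le_trans (cabsD _ _) _; rewrite cabsM w1 mul1r.
Qed.

Lemma iter_avg_lin s (a b : R) f g z :
  iter_avg s (fun y => a * f y + b * g y) z =
  a * iter_avg s f z + b * iter_avg s g z.
Proof.
elim: s z => [|c s IH] z //=.
by rewrite -!ravgZ -ravgD; apply: eq_ravg => w; rewrite IH.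
Qed.

Lemma iter_avg_cst s (c : R) z : iter_avg s (fun=> c) z = c.
Proof.
elim: s z => [|x s IH] z //=; rewrite -[RHS]ravg_cst.
by apply: eq_ravg => w; rewrite IH.
Qed.

Lemma iter_avg_ravg s (F : R[i] -> R[i] -> R) z :
  iter_avg s (fun y => ravg (fun w => F w y)) z =
  ravg (fun w => iter_avg s (F w) z).
Proof.
elim: s z => [|c s IH] z //=; rewrite exchange_ravg.
by apply: eq_ravg => w; rewrite IH.
Qed.

Lemma iter_avg_rot s i f z :
  iter_avg s (fun y => f (zeta ^+ i * y)) z = iter_avg s f (zeta ^+ i * z).
Proof.
elim: s z => [|c s IH] z //=.
rewrite -[RHS](ravg_rot i); apply: eq_ravg => w; rewrite IH.
by rewrite mulrDr mulrA.
Qed.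

Lemma iter_avg_shift s f y z :
  iter_avg s f (z + y) = iter_avg s (fun u => f (z + u)) y.
Proof.
by elim: s y => [|c s IH] y //=; apply: eq_ravg => w; rewrite -IH addrA.
Qed.

(** The law of the random sum is invariant under multiplication by a root of unity. A whole block
    with sum y can therefore be treated as one term y with its own random phase. *)
Lemma iter_avg_rotate s f z :
  iter_avg s f z = iter_avg s (fun y => ravg (fun w => f (z + w * y))) 0.
Proof.
rewrite iter_avg_ravg -{1}[z]addr0 iter_avg_shift -[LHS]ravg_cst.
congr (_ * _); apply: eq_bigr => j _.
by rewrite (iter_avg_rot s j (fun y => f (z + y))) mulr0.
Qed.

Lemma Re_mul_conj w z c : Re (z * (w * c)^*) = Re (w * (c * z^*)).
Proof. by case: w => a b; case: z => u v; case: c => p q /=; ring. Qed.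

Lemma ravg_sqr_cabs z c :
  ravg (fun w => cabs (z + w * c) ^+ 2) = cabs z ^+ 2 + cabs c ^+ 2.
Proof.
transitivity (ravg (fun w => (cabs z ^+ 2 + cabs c ^+ 2) + 2 * Re (w * (c * z^*)))).
  congr (_ * _); apply: eq_bigr => j _.
  rewrite sqr_cabsD cabsM cabs_zetaX mul1r addrAC.
  by rewrite Re_mul_conj.
by rewrite ravgD ravg_cst ravgZ ravg_Re mulr0 addr0.
Qed.

Lemma ravg_pow4_cabs z c :
  ravg (fun w => cabs (z + w * c) ^+ 4) =
  cabs z ^+ 4 + 4 * cabs z ^+ 2 * cabs c ^+ 2 + cabs c ^+ 4.
Proof.
pose S := cabs z ^+ 2 + cabs c ^+ 2; pose d := c * z^*.
transitivity (ravg (fun w => (S ^+ 2 + 2 * cabs d ^+ 2) +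
  (4 * S * Re (w * d) + 2 * Re (w ^+ 2 * d ^+ 2)))).
  congr (_ * _); apply: eq_bigr => j _.
  have e : cabs (z + zeta ^+ j * c) ^+ 2 = S + 2 * Re (zeta ^+ j * d).
    rewrite sqr_cabsD cabsM cabs_zetaX mul1r addrAC.
    by rewrite Re_mul_conj.
  rewrite (_ : 4%N = 2 * 2)%N// exprM e {e}; clearbody d S.
  have w1 := sqr_cabs (zeta ^+ j); rewrite cabs_zetaX expr1n in w1.
  move: w1; rewrite sqr_cabs; move: (zeta ^+ j) => [a b] /=; case: d => p q /= w1.
  rewrite !expr2 /=.
  (* The factor a^2 + b^2 = 1 is inserted so that the identity holds for all a and b and [ring] can
     prove it. *)
  have -> : (S * S + 2 * (p * p + q * q) : R) =
    S * S + 2 * (a ^+ 2 + b ^+ 2) * (p * p + q * q) by rewrite -w1 mulr1.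
  ring.
rewrite !ravgD !ravg_cst !ravgZ ravg_Re ravg_Re2 !mulr0 !addr0.
by rewrite /d /S cabsM cabsJ; ring.
Qed.

Lemma iter_avg_sqr s z :
  iter_avg s (fun y => cabs y ^+ 2) z = cabs z ^+ 2 + \sum_(c <- s) cabs c ^+ 2.
Proof.
elim: s z => [|c s IH] z /=; first by rewrite big_nil addr0.
under eq_ravg do rewrite IH.
by rewrite ravgD ravg_cst ravg_sqr_cabs big_cons addrA.
Qed.

Lemma iter_avg_pow4_le s z :
  iter_avg s (fun y => cabs y ^+ 4) z <=
  cabs z ^+ 4 + 4 * cabs z ^+ 2 * (\sum_(c <- s) cabs c ^+ 2)
  + 2 * (\sum_(c <- s) cabs c ^+ 2) ^+ 2.
Proof.
elim: s z => [|c s IH] z /=; first by rewrite big_nil expr0n/= !mulr0 !addr0.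
rewrite big_cons; set B := \sum_(_ <- s) _.
apply: (@le_trans _ _ (ravg (fun w => cabs (z + w * c) ^+ 4 +
   4 * B * cabs (z + w * c) ^+ 2 + 2 * B ^+ 2))).
  apply: le_ravg => w _; apply: le_trans (IH _) _.
  by rewrite -/B mulrAC.
rewrite !ravgD ravg_cst ravgZ ravg_sqr_cabs ravg_pow4_cabs.
have -> : cabs c ^+ 4 = (cabs c ^+ 2) ^+ 2 by rewrite -exprM.
set p := cabs z ^+ 4; set u := cabs z ^+ 2; set v := cabs c ^+ 2.
have v2 : 0 <= v ^+ 2 by exact: sqr_ge0.
by nra.
Qed.

Lemma prod_cabs_zeta (u v : R[i]) :
  \prod_(0 <= j < L) cabs (u - zeta ^+ j * v) = cabs (u ^+ L - v ^+ L).
Proof.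
have -> : \prod_(0 <= j < L) cabs (u - zeta ^+ j * v) =
   cabs (\prod_(0 <= j < L) (u - zeta ^+ j * v)).
  elim/big_rec2: _ => [|j y z _ ->]; first by rewrite cabs1.
  by rewrite cabsM.
(* Both sides are homogeneous: for v != 0 the identity is v^L times the factorization of X^L - 1 at
   u / v. *)
congr cabs; have [->|v0] := eqVneq v 0.
  under eq_bigr do rewrite mulr0 subr0.
  by rewrite expr0n gtn_eqF// subr0 prodr_const_nat subn0.
have := congr1 (fun p : {poly R[i]} => v ^+ L * p.[u / v]) (factor_Xn_sub_1 prim_zeta).
rewrite hornerD hornerXn hornerN hornerC horner_prod mulrBr mulr1 -exprMn.
rewrite mulrCA divff// mulr1 => <-.
rewrite -[L in v ^+ L]subn0 -prodr_const_nat -big_split/=.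
apply: eq_bigr => j _; rewrite hornerXsubC mulrBr mulrCA divff// mulr1.
by rewrite mulrC.
Qed.

End RootAverages.

(** * Averaging the logarithm over one phase *)

Section LogLowerBound.
Context {R : realType}.
Implicit Types (z w x y : R[i]) (s : seq R[i]) (f g h : R[i] -> R).

Lemma ln_prod (I : Type) (r : seq I) (F : I -> R) : (forall i, 0 < F i) ->
  \sum_(i <- r) ln (F i) = ln (\prod_(i <- r) F i).
Proof.
move=> F0; elim: r => [|i r IH]; first by rewrite !big_nil ln1.
by rewrite !big_cons IH lnM ?posrE// prodr_gt0.
Qed.

Lemma ln_sqr (x : R) : 0 < x -> ln (x ^+ 2) = 2 * ln x.
Proof. by move=> x0; rewrite lnXn// mulr_natl. Qed.

Variables (L : nat) (zeta : R[i]).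
Hypothesis (L_gt2 : (2 < L)%N) (prim_zeta : L.-primitive_root zeta).
Variables (eps C : R).
Hypothesis (eps_gt0 : 0 < eps) (C_ge0 : 0 <= C).

Let L_gt0 : (0 < L)%N. Proof. by case: L L_gt2. Qed.

(** A nonpositive correction of order 1/L for fixed [eps] and [C]: the loss from averaging over L
    points instead of the circle. *)
Definition avg_err : R := (2 * L%:R)^-1 * ln (eps / (2 * C ^+ 2 + eps)).

(* [|A + w x|^2 + eps = |U - w V|^2] for all unimodular [w], where
   [|U| + |V| = sqrt ((p + q)^2 + eps)] and [|U| - |V| = sqrt ((p - q)^2 + eps)]
   with [p = |A|] and [q = |x|]; hence the product over the roots of unity. *)
Lemma complete_square (A x : R[i]) : exists U V : R[i],
  [/\ forall w, cabs w = 1 -> cabs (U - w * V) ^+ 2 = cabs (A + w * x) ^+ 2 + eps,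
      cabs x <= cabs U, Num.sqrt eps <= cabs U - cabs V &
      cabs U ^+ 2 <= cabs A ^+ 2 + cabs x ^+ 2 + eps].
Proof.
pose p : R := cabs A; pose q : R := cabs x.
pose a : R := Num.sqrt ((p + q) ^+ 2 + eps); pose b : R := Num.sqrt ((p - q) ^+ 2 + eps).
have p0 : 0 <= p by exact: cabs_ge0.
have q0 : 0 <= q by exact: cabs_ge0.
have a2 : a ^+ 2 = (p + q) ^+ 2 + eps by rewrite sqr_sqrtr// addr_ge0 ?sqr_ge0 ?ltW.
have b2 : b ^+ 2 = (p - q) ^+ 2 + eps by rewrite sqr_sqrtr// addr_ge0 ?sqr_ge0 ?ltW.
have a0 : 0 <= a by exact: sqrtr_ge0.
have b0 : 0 <= b by exact: sqrtr_ge0.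
have sb : Num.sqrt eps <= b by rewrite ler_wsqrtr// lerDr sqr_ge0.
have s0 : 0 < Num.sqrt eps by rewrite sqrtr_gt0.
have ab : b <= a by rewrite ler_wsqrtr// lerD2r; nra.
have apq : p + q <= a.
  by rewrite -(@ler_pXn2r _ 2)// ?nnegrE ?addr_ge0// a2 lerDl ltW.
have bpq : q - p <= b.
  have [|qp] := leP (q - p) 0; first by move=> h; exact: le_trans h _.
  by rewrite -(@ler_pXn2r _ 2)// ?nnegrE ?(ltW qp)// b2; nra.
pose u : R := (a + b) / 2; pose v : R := (a - b) / 2.
have u0 : 0 <= u by rewrite /u; lra.
have v0 : 0 <= v by rewrite /v; lra.
have uv : u * v = p * q.
  rewrite /u /v.
  have : (a + b) / 2 * ((a - b) / 2) = (a ^+ 2 - b ^+ 2) / 4 by field.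
  by rewrite a2 b2 => ->; field.
have u2v2 : u ^+ 2 + v ^+ 2 = p ^+ 2 + q ^+ 2 + eps.
  have -> : u ^+ 2 + v ^+ 2 = (a ^+ 2 + b ^+ 2) / 2 by rewrite /u /v; field.
  by rewrite a2 b2; field.
(* The moduli satisfy u v = p q, so only the phase of U is left to choose: that of A times the
   conjugate of x, which makes the cross terms agree. If p q = 0, both sides vanish and any phase
   works. *)
have [U [Uu UV]] : exists U : R[i], cabs U = u /\ U * v%:C = A * x^*.
  have [pq0|pq0] := eqVneq (p * q) 0.
    exists u%:C; split; first by rewrite cabs_real ger0_norm.
    have /eqP -> : A * x^* == 0 by rewrite -cabs_eq0 cabsM cabsJ -/p -/q pq0.
    by apply/eqP; rewrite -rmorphM/= uv pq0.
  exists ((u / (p * q))%:C * (A * x^*)); split.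
    rewrite cabsM cabs_real (ger0_norm (divr_ge0 u0 (mulr_ge0 p0 q0))).
    by rewrite cabsM cabsJ -/p -/q -mulrA mulVf ?mulr1.
  rewrite mulrAC -rmorphM/= mulrAC uv divff//.
  by rewrite mul1r.
exists U, (- v%:C); split.
- move=> w w1; rewrite mulrN opprK !sqr_cabsD !cabsM w1 !mul1r Uu cabs_real (ger0_norm v0).
  have e : Re (U * (w * v%:C)^*) = Re (A * (w * x)^*).
    have -> : A * (w * x)^* = w^* * (A * x^*) by rewrite conjcM mulrCA.
    by rewrite -UV conjcM conjc_real mulrCA.
  by rewrite e -/p -/q addrAC u2v2; ring.
- by rewrite Uu -/q /u; lra.
- rewrite cabsN Uu cabs_real (ger0_norm v0).
  by have -> : u - v = b by rewrite /u /v; field.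
- rewrite Uu -/p -/q -u2v2 lerDl sqr_ge0//.
Qed.

(** A discrete Jensen formula: after completing the square the average is (1/L) log |U^L - V^L|,
    which is at least log |U| + (1/L) log (1 - |V| / |U|), and |U| >= |x| whatever A is. *)
Lemma ravg_log_reg_ge (A x : R[i]) : x != 0 -> cabs A <= C -> cabs x <= C ->
  ln (cabs x) + avg_err <= ravg L zeta (fun w => log_reg eps (A + w * x)).
Proof.
move=> x0 AC xC.
have [U [V [UV xU sUV U2]]] := complete_square A x.
have s0 : 0 < Num.sqrt eps by rewrite sqrtr_gt0.
have xp : 0 < cabs x by rewrite cabs_gt0.
have Up : 0 < cabs U by exact: lt_le_trans xU.
have V0 := cabs_ge0 V.
have UVL : cabs U ^+ L - cabs V ^+ L > 0.
  by rewrite subr_gt0 ltrXn2r ?nnegrE ?cabs_ge0 -?lt0n//; lra.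
have -> : ravg L zeta (fun w => log_reg eps (A + w * x)) =
   L%:R^-1 * ln (cabs (U ^+ L - V ^+ L)).
  rewrite /ravg; congr (_ * _).
  rewrite -(prod_cabs_zeta L_gt2 prim_zeta).
  have Fp j : 0 < cabs (U - zeta ^+ j * V).
    rewrite lt_def cabs_ge0 andbT -sqrf_eq0 UV ?(cabs_zetaX L_gt2 prim_zeta)//.
    by rewrite gt_eqF// ltr_wpDl// sqr_ge0.
  rewrite -ln_prod//; apply: eq_bigr => j _.
  rewrite /log_reg -UV ?(cabs_zetaX L_gt2 prim_zeta)// ln_sqr// mulrA mulVf// mul1r//.
have h1 : cabs U ^+ L * (1 - cabs V / cabs U) <= cabs (U ^+ L - V ^+ L).
  apply: (@le_trans _ _ (cabs U ^+ L - cabs V ^+ L)).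
    rewrite mulrBr mulr1 lerD2l lerN2.
    have -> : cabs V ^+ L = cabs U ^+ L * (cabs V / cabs U) ^+ L.
      by rewrite -exprMn mulrCA divff ?mulr1// gt_eqF.
    rewrite ler_wpM2l ?exprn_ge0 ?cabs_ge0// ler_iXnr//.
      by rewrite divr_ge0 ?cabs_ge0.
    by rewrite ler_pdivrMr// mul1r; lra.
  rewrite -!cabsX; have := cabsD (U ^+ L - V ^+ L) (V ^+ L).
  by rewrite subrK lerBlDr.
have VU0 : 0 < 1 - cabs V / cabs U by rewrite subr_gt0 ltr_pdivrMr// mul1r; lra.
apply: (@le_trans _ _ (L%:R^-1 * ln (cabs U ^+ L * (1 - cabs V / cabs U)))); last first.
  rewrite ler_wpM2l ?invr_ge0 ?ler0n// ler_ln// posrE ?mulr_gt0 ?exprn_gt0//.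
  by apply: lt_le_trans h1; rewrite mulr_gt0 ?exprn_gt0.
rewrite lnM ?posrE ?exprn_gt0// lnXn// mulrDr mulrnAr -mulrnAl.
rewrite -[L%:R^-1 *+ L]mulr_natr mulVf ?pnatr_eq0 -?lt0n// mul1r lerD// ?ler_ln ?posrE//.
rewrite /avg_err invfM [2^-1 * _]mulrC -mulrA ler_wpM2l ?invr_ge0 ?ler0n//.
have D0 : 0 < 2 * C ^+ 2 + eps by rewrite ltr_wpDl// mulr_ge0// sqr_ge0.
(* Here |U| - |V| >= sqrt eps and |U|^2 <= 2 C^2 + eps; the square explains the factor 2 in front of
   L in [avg_err]. *)
suff h : eps / (2 * C ^+ 2 + eps) <= (1 - cabs V / cabs U) ^+ 2.
  rewrite ler_pdivrMl// -ln_sqr//.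
  by rewrite ler_ln// posrE ?divr_gt0 ?exprn_gt0.
have -> : 1 - cabs V / cabs U = (cabs U - cabs V) / cabs U.
  by rewrite mulrBl divff// gt_eqF.
rewrite expr_div_n; apply: ler_pM; rewrite ?invr_ge0 ?(ltW eps_gt0) ?(ltW D0)//.
- by rewrite -[leLHS](sqr_sqrtr (ltW eps_gt0)) lerXn2r// nnegrE; lra.
- rewrite lef_pV2 ?posrE ?exprn_gt0//; apply: le_trans U2 _.
  have : cabs A ^+ 2 <= C ^+ 2 by rewrite lerXn2r// nnegrE ?cabs_ge0.
  have : cabs x ^+ 2 <= C ^+ 2 by rewrite lerXn2r// nnegrE ?cabs_ge0.
  by lra.
Qed.

End LogLowerBound.

(** * Averaging over blocks of comparable terms *)

Section SmallBall.
Context {R : realType}.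
Implicit Types (z w x y : R[i]) (s : seq R[i]) (f g h : R[i] -> R).

Variables (L : nat) (zeta : R[i]).
Hypothesis (L_gt2 : (2 < L)%N) (prim_zeta : L.-primitive_root zeta).
Variables (eps C : R).
Hypothesis (eps_gt0 : 0 < eps) (C_ge0 : 0 <= C).

Local Notation err := (avg_err L eps C).
Local Notation avg := (iter_avg L zeta).

(** The average over the phase of x commutes with the others, so the one-phase bound applies with
    all other terms frozen. *)
Lemma ravg_iter_avg_log_reg s z x : x != 0 ->
  cabs z + \sum_(c <- s) cabs c <= C -> cabs x <= C ->
  ln (cabs x) + err <= ravg L zeta (fun w => avg s (log_reg eps) (z + w * x)).
Proof.
move=> x0 zC xC.
have -> : ravg L zeta (fun w => avg s (log_reg eps) (z + w * x)) =
    ravg L zeta (fun w => avg s (fun y => log_reg eps (y + w * x)) z).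
  apply: eq_ravg => w; rewrite addrC iter_avg_shift.
  by apply: eq_iter_avg => y; rewrite addrC.
rewrite -iter_avg_ravg -[leLHS](iter_avg_cst zeta L_gt2 s _ z).
apply: (le_iter_avg L_gt2 prim_zeta) => y yle.
by apply: (ravg_log_reg_ge L_gt2 prim_zeta eps_gt0 C_ge0) => //; exact: le_trans zC.
Qed.

(* Paley-Zygmund in the form E q(|S|^2) >= 1/8 for the quadratic polynomial
   q(x) = (x - B/2) (4 B - x) / (7 B / 4)^2, which satisfies q <= 1 everywhere
   and q <= 0 on [0, B/2]; it uses E|S|^2 = B and E|S|^4 <= 2 B^2. *)
Lemma iter_avg_paley_zygmund s (B : R) :
  B = \sum_(c <- s) cabs c ^+ 2 -> 0 < B ->
  8^-1 <= avg s (fun y => (cabs y ^+ 2 - B / 2) * (4 * B - cabs y ^+ 2)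
                           * (16 / 49) / B ^+ 2) 0.
Proof.
move=> BE B0.
pose k : R := 16 / 49 / B ^+ 2.
have k0 : 0 < k by rewrite divr_gt0 ?exprn_gt0// divr_gt0.
have -> : avg s (fun y => (cabs y ^+ 2 - B / 2) * (4 * B - cabs y ^+ 2)
                           * (16 / 49) / B ^+ 2) 0 =
  k * (9 / 2 * B * avg s (fun y => cabs y ^+ 2) 0 - avg s (fun y => cabs y ^+ 4) 0)
   - k * (2 * B ^+ 2).
  transitivity (avg s (fun y => k * (9 / 2 * B * cabs y ^+ 2 + (-1) * cabs y ^+ 4) +
     (- 1) * (k * (2 * B ^+ 2))) 0).
    apply: eq_iter_avg => y; rewrite /k (_ : 4%N = 2 * 2)%N// exprM; field.
    by rewrite gt_eqF.
  rewrite (iter_avg_lin L zeta s k (-1) (fun y => 9 / 2 * B * cabs y ^+ 2 + (-1) * cabs y ^+ 4)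
    (fun=> k * (2 * B ^+ 2))) iter_avg_lin iter_avg_cst//; ring.
rewrite (iter_avg_sqr L_gt2 prim_zeta) cabs0 expr0n/= add0r -BE.
have := iter_avg_pow4_le L_gt2 prim_zeta s 0.
rewrite cabs0 !expr0n/= mulr0 mul0r !add0r -BE => h4.
have kB : k * B ^+ 2 = 16 / 49 by rewrite /k divfK// gt_eqF// exprn_gt0.
have : k * avg s (fun y => cabs y ^+ 4) 0 <= k * (2 * B ^+ 2) by rewrite ler_pM2l.
nra.
Qed.

(** Induction on the number k of blocks of r terms. If the first block has a sum y with |y|^2 >=
    B/2, its phase alone yields ln d + (1/2) ln (r/2); otherwise the remaining blocks yield the
    bound for k. The strict inequality [k * r < size s] keeps one spare term for k = 0. *)
Lemma iter_avg_log_reg_lower (d : R) (k r : nat) s z :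
  0 < d -> (0 < r)%N -> (forall c, c \in s -> d <= cabs c) ->
  (k * r < size s)%N -> cabs z + \sum_(c <- s) cabs c <= C ->
  ln d - 2^-1 * ln 2 + (1 - (7 / 8) ^+ k) * (2^-1 * ln r%:R) + err
    <= avg s (log_reg eps) z.
Proof.
move=> d0 r0.
elim: k s z => [|k IH] s z sd sk zC.
  (* No block is left: the phase of a single spare term gives ln d. *)
  rewrite expr0 subrr mul0r addr0.
  case: s sd sk zC => // c s sd _; rewrite big_cons addrCA => zC.
  have cd : d <= cabs c by apply: sd; rewrite inE eqxx.
  have c0 : 0 < cabs c by exact: lt_le_trans cd.
  have S0 : 0 <= \sum_(j <- s) cabs j by apply: sumr_ge0 => j _; exact: cabs_ge0.
  have z0 := cabs_ge0 z.
  rewrite /=; apply: le_trans (ravg_iter_avg_log_reg (s := s) (z := z) (x := c) _ _ _).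
  - rewrite lerD2r; apply: (@le_trans _ _ (ln d)); last by rewrite ler_ln.
    by rewrite lerBlDr lerDl mulr_ge0// ln_ge0// ler1n.
  - by rewrite -cabs_gt0.
  - by apply: le_trans zC; rewrite lerDr cabs_ge0.
  - by apply: le_trans zC; rewrite lerDl addr_ge0.
set l := ln d - 2^-1 * ln 2; set lr := 2^-1 * ln r%:R.
have lr0 : 0 <= lr by rewrite mulr_ge0// ln_ge0// ler1n.
pose s1 := take r s; pose s2 := drop r s.
have rs : (r <= size s)%N.
  by apply: leq_trans (ltnW sk); rewrite mulSn leq_addr.
have s1s : size s1 = r by rewrite size_takel.
have ss : s = s1 ++ s2 by rewrite cat_take_drop.
have sd1 c : c \in s1 -> d <= cabs c by move=> cs; apply: sd; rewrite ss mem_cat cs.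
have sd2 c : c \in s2 -> d <= cabs c.
  by move=> cs; apply: sd; rewrite ss mem_cat cs orbT.
have sk2 : (k * r < size s2)%N by rewrite size_drop ltn_subRL -mulSn.
move: zC; rewrite {1}ss big_cat/= addrA => zC.
have S20 : 0 <= \sum_(j <- s2) cabs j by apply: sumr_ge0 => j _; exact: cabs_ge0.
have S10 : 0 <= \sum_(j <- s1) cabs j by apply: sumr_ge0 => j _; exact: cabs_ge0.
have z0 := cabs_ge0 z.
pose B := \sum_(c <- s1) cabs c ^+ 2.
have BE : r%:R * d ^+ 2 <= B.
  rewrite /B big_seq -s1s -sum1_size natr_sum mulr_suml big_seq.
  apply: ler_sum => c cs; rewrite mul1r lerXn2r// ?nnegrE ?cabs_ge0 ?(ltW d0)//.
  exact: sd1.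
have rd0 : 0 < r%:R * d ^+ 2 by rewrite mulr_gt0 ?ltr0n// exprn_gt0.
have B0 : 0 < B by exact: lt_le_trans BE.
pose e : R := (7 / 8) ^+ k * lr.
have e0 : 0 <= e by rewrite mulr_ge0 ?exprn_ge0//; lra.
pose wk := l + (1 - (7 / 8) ^+ k) * lr.
have wkE : wk = l + lr - e by rewrite /wk /e; ring.
rewrite ss iter_avg_cat (iter_avg_rotate L_gt2 prim_zeta).
pose q y : R := (cabs y ^+ 2 - B / 2) * (4 * B - cabs y ^+ 2) * (16 / 49) / B ^+ 2.
(* Given the sum y of the first block, the rest averages to at least wk + e q(y) + err: for small y
   because q(y) <= 0, otherwise because q(y) <= 1 and ln |y| >= wk + e. Since q has mean at least
   1/8, the gap e shrinks to 7/8 e. *)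
apply: (@le_trans _ _ (avg s1 (fun y => e * q y + 1 * (wk + err)) 0)).
  rewrite iter_avg_lin iter_avg_cst// mul1r.
  have := iter_avg_paley_zygmund (erefl B) B0; rewrite -/q => hq.
  have : e * 8^-1 <= e * avg s1 q 0 by rewrite ler_wpM2l.
  rewrite wkE exprS -/l -/lr.
  have -> : l + (1 - 7 / 8 * (7 / 8) ^+ k) * lr + err = l + lr - 7/8 * e + err.
    by rewrite /e; ring.
  lra.
apply: (le_iter_avg L_gt2 prim_zeta) => y; rewrite cabs0 add0r mul1r => yS.
have q_le1 : q y <= 1.
  rewrite /q ler_pdivrMr ?exprn_gt0// mul1r.
  have := sqr_ge0 (cabs y ^+ 2 - 9 / 4 * B); nra.
have base : wk + err <= ravg L zeta (fun w => avg s2 (log_reg eps) (z + w * y)).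
  rewrite -[leLHS](ravg_cst zeta L_gt2); apply: (le_ravg L_gt2 prim_zeta) => w w1.
  apply: IH => //; apply: le_trans zC; rewrite lerD2r.
  by apply: le_trans (cabsD _ _) _; rewrite cabsM w1 mul1r lerD2l.
have [yB|yB] := ltP (cabs y ^+ 2) (B / 2).
  apply: le_trans base; rewrite gerDr mulr_ge0_le0//.
  rewrite /q pmulr_lle0 ?invr_gt0 ?exprn_gt0// pmulr_lle0; last by lra.
  by rewrite mulr_le0_ge0//; lra.
have y0 : 0 < cabs y.
  rewrite lt_def cabs_ge0 andbT -sqrf_eq0 gt_eqF//.
  by apply: lt_le_trans yB; rewrite divr_gt0.
have : ln (cabs y) + err <= ravg L zeta (fun w => avg s2 (log_reg eps) (z + w * y)).
  apply: ravg_iter_avg_log_reg.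
  - by rewrite -cabs_gt0.
  - by apply: le_trans zC; rewrite lerD2r lerDl.
  - apply: (le_trans yS); apply: le_trans zC; rewrite -addrA addrCA lerDl.
    by rewrite addr_ge0.
apply: le_trans; rewrite addrA lerD2r wkE.
have ly : l + lr <= ln (cabs y).
  have : ln (r%:R * d ^+ 2 / 2) <= ln (cabs y ^+ 2).
    rewrite ler_ln ?posrE ?exprn_gt0 ?divr_gt0//; apply: le_trans yB.
    by rewrite ler_wpM2r.
  rewrite ln_div ?posrE ?exprn_gt0// lnM ?posrE ?ltr0n ?exprn_gt0// !ln_sqr//.
  by rewrite /l /lr; lra.
have : e * q y <= e * 1 by rewrite ler_wpM2l.
lra.
Qed.

End SmallBall.

(** * Means over symmetric intervals *)

Section TimeMeans.
Context {R : realType}.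
Implicit Types (f g : R -> R) (T m c : R).
Local Notation mu := (@lebesgue_measure R).

Definition locally_integrable_sym f :=
  forall T, mu.-integrable `[- T, T] (EFin \o f).

Lemma continuous_integrable_sym f : continuous f -> locally_integrable_sym f.
Proof.
move=> cf T; apply: continuous_compact_integrable; first exact: segment_compact.
exact: continuous_subspaceT.
Qed.

Definition time_avg f T : R := (2 * T)^-1 * \int[mu]_(t in `[- T, T]) f t.

Definition has_mean f m := time_avg f T @[T --> +oo] --> m.

Lemma locally_integrable_symD f g : locally_integrable_sym f ->
  locally_integrable_sym g -> locally_integrable_sym (fun t => f t + g t).
Proof.
move=> cf cg T.
have -> : EFin \o (fun t => f t + g t) = ((EFin \o f) \+ (EFin \o g))%E by [].
by apply: integrableD.
Qed.

Lemma locally_integrable_symZ c f : locally_integrable_sym f ->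
  locally_integrable_sym (fun t => c * f t).
Proof.
move=> cf T.
have -> : EFin \o (fun t => c * f t) = (fun t => c%:E * (EFin \o f) t)%E by [].
by apply: integrableZl.
Qed.

Lemma time_avgD f g T : locally_integrable_sym f -> locally_integrable_sym g ->
  time_avg (fun t => f t + g t) T = time_avg f T + time_avg g T.
Proof. by move=> cf cg; rewrite /time_avg RintegralD// mulrDr. Qed.

Lemma time_avgB f g T : locally_integrable_sym f -> locally_integrable_sym g ->
  time_avg (fun t => f t - g t) T = time_avg f T - time_avg g T.
Proof. by move=> cf cg; rewrite /time_avg RintegralB// mulrBr. Qed.

Lemma time_avgZ c f T : locally_integrable_sym f ->
  time_avg (fun t => c * f t) T = c * time_avg f T.
Proof. by move=> cf; rewrite /time_avg RintegralZl// mulrCA. Qed.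

Lemma lebesgue_measure_sym T : 0 < T -> fine (mu `[- T, T]) = 2 * T.
Proof.
move=> T0; rewrite lebesgue_measure_itv/= lte_fin gtrN// -EFinD/=; ring.
Qed.

Lemma time_avg_cst c T : 0 < T -> time_avg (fun=> c) T = c.
Proof.
move=> T0; rewrite /time_avg Rintegral_cst// lebesgue_measure_sym//.
by rewrite mulrCA mulVf ?mulr1// mulf_neq0// gt_eqF.
Qed.

Lemma le_time_avg f g T : 0 < T ->
  locally_integrable_sym f -> locally_integrable_sym g ->
  (forall t, f t <= g t) -> time_avg f T <= time_avg g T.
Proof.
move=> T0 cf cg fg; rewrite /time_avg ler_wpM2l ?invr_ge0 ?mulr_ge0 ?(ltW T0)//.
by apply: le_Rintegral => // t _.
Qed.

Lemma locally_integrable_sym_cst c : locally_integrable_sym (fun=> c).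
Proof. by apply: continuous_integrable_sym => x; exact: cvg_cst. Qed.

Lemma time_avg_dist f g T c : 0 < T ->
  locally_integrable_sym f -> locally_integrable_sym g ->
  (forall t, `|f t - g t| <= c) -> `|time_avg f T - time_avg g T| <= c.
Proof.
move=> T0 cf cg fg; have cc := locally_integrable_sym_cst c.
rewrite ler_norml; apply/andP; split.
  rewrite -(time_avg_cst c T0) lerBrDr addrC -lerBrDr opprK -time_avgD//.
  apply: le_time_avg => // [|t]; first exact: locally_integrable_symD.
  by have /ler_normlP[] := fg t; lra.
rewrite -(time_avg_cst c T0) lerBlDr -time_avgD//.
apply: le_time_avg => // [|t]; first exact: locally_integrable_symD.
by have /ler_normlP[] := fg t; lra.
Qed.

Lemma eq_has_mean f g m : f =1 g -> has_mean f m -> has_mean g m.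
Proof. by move=> /funext ->. Qed.

Lemma has_mean_cst c : has_mean (fun=> c) c.
Proof.
apply: cvg_near_cst; near=> T; rewrite time_avg_cst//.
Unshelve. all: by end_near. Qed.

Lemma has_meanD f g m m' : locally_integrable_sym f -> locally_integrable_sym g ->
  has_mean f m -> has_mean g m' -> has_mean (fun t => f t + g t) (m + m').
Proof.
move=> cf cg fm gm; rewrite /has_mean.
by under eq_fun do rewrite time_avgD//; apply: cvgD.
Qed.

Lemma has_meanZ c f m : locally_integrable_sym f ->
  has_mean f m -> has_mean (fun t => c * f t) (c * m).
Proof.
move=> cf fm; rewrite /has_mean.
by under eq_fun do rewrite time_avgZ//; apply: cvgMr.
Qed.

Lemma has_mean_le f g m m' : locally_integrable_sym f -> locally_integrable_sym g ->
  (forall t, f t <= g t) -> has_mean f m -> has_mean g m' -> m <= m'.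
Proof.
move=> cf cg fg fm gm; apply: (ler_cvg_to fm gm); near=> T.
by apply: le_time_avg.
Unshelve. all: by end_near. Qed.

Lemma has_mean_dist f g m m' c : locally_integrable_sym f -> locally_integrable_sym g ->
  (forall t, `|f t - g t| <= c) -> has_mean f m -> has_mean g m' -> `|m - m'| <= c.
Proof.
move=> cf cg fg fm gm.
have h : `|time_avg f T - time_avg g T| @[T --> +oo] --> `|m - m'|.
  by apply: cvg_norm; apply: cvgB.
apply: (cvgr_to_le h); near=> T; exact: time_avg_dist.
Unshelve. all: by end_near. Qed.

(** The Cauchy criterion: m may depend on eta, so it suffices to approximate f by functions whose
    means are known. *)
Lemma has_mean_exists f :
  (forall eta : R, 0 < eta -> exists m, \forall T \near +oo, `|time_avg f T - m| <= eta) ->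
  exists m, has_mean f m.
Proof.
move=> H.
suff : cvg (time_avg f T @[T --> +oo]) by move=> /cvg_ex[m hm]; exists m.
apply: cauchy_cvg; apply: cauchy_exP => e e0.
have [m hm] := H (e / 2) (divr_gt0 e0 (ltr0Sn _ 1)).
exists m; near=> T; rewrite -ball_normE /= distrC.
by apply: (@le_lt_trans _ _ (e / 2)); [near: T | rewrite ltr_pdivrMr// ltr_pMr// ltr1n].
Unshelve. all: by end_near. Qed.

Lemma has_mean_approx f : locally_integrable_sym f ->
  (forall eta : R, 0 < eta -> exists g m, [/\ locally_integrable_sym g,
      has_mean g m & forall t, `|f t - g t| <= eta]) ->
  exists m, has_mean f m.
Proof.
move=> cf H; apply: has_mean_exists => eta eta0.
have [g [m [cg gm fg]]] := H (eta / 2) (divr_gt0 eta0 (ltr0Sn _ 1)).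
exists m; near=> T.
have h : `|time_avg f T - time_avg g T| <= eta / 2 by apply: time_avg_dist.
have h' : `|m - time_avg g T| <= eta / 2.
  by near: T; move/cvgrPdist_le : gm; apply; rewrite divr_gt0.
rewrite distrC in h'.
have := ler_normD (time_avg f T - time_avg g T) (time_avg g T - m).
by rewrite addrA subrK; lra.
Unshelve. all: by end_near. Qed.

Lemma continuous_cosM (l : R) : continuous (fun t => cos (l * t)).
Proof.
move=> t; apply: continuous_comp; last exact: continuous_cos.
by apply: cvgMr; exact: cvg_id.
Qed.

Lemma continuous_sinM (l : R) : continuous (fun t => sin (l * t)).
Proof.
move=> t; apply: continuous_comp; last exact: continuous_sin.
by apply: cvgMr; exact: cvg_id.
Qed.

Lemma Rintegral_sym_FTC (f F : R -> R) T : 0 < T -> continuous f ->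
  (forall x : R, is_derive x 1 F (f x)) ->
  \int[mu]_(t in `[- T, T]) f t = F T - F (- T).
Proof.
move=> T0 cf dF; have TT : - T < T by rewrite gtrN.
rewrite /Rintegral (@continuous_FTC2 _ f F)//.
- exact: continuous_subspaceT.
- have cF : continuous F.
    by move=> y; apply/differentiable_continuous/derivable1_diffP; have [] := dF y.
  split; first by move=> x _; have [] := dF x.
  + by apply: cvg_within_filter; exact: cF.
  + by apply: cvg_within_filter; exact: cF.
- by move=> x _; rewrite derive1E; have [_ ->] := dF x.
Qed.

Lemma cvg_bounded_time_avg (u : R -> R) K :
  (forall T, `|u T| <= K) -> (2 * T)^-1 * u T @[T --> +oo] --> (0 : R).
Proof.
move=> uK; have K0 : 0 <= K by exact: le_trans (uK 0).
apply/cvgrPdist_le => e e0; near=> T.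
have T0 : 0 < T by [].
rewrite sub0r normrN normrM ger0_norm ?invr_ge0 ?mulr_ge0 ?(ltW T0)//.
rewrite mulrC ler_pdivrMr ?mulr_gt0//; apply: le_trans (uK T) _.
have : K / e <= T by near: T; apply: nbhs_pinfty_ge; exact: num_real.
rewrite ler_pdivrMr// => h; rewrite mulrC; nra.
Unshelve. all: by end_near. Qed.

Lemma has_mean_cosM (l : R) : l != 0 -> has_mean (fun t => cos (l * t)) 0.
Proof.
move=> l0; rewrite /has_mean.
apply: cvg_trans (@cvg_bounded_time_avg (fun T => l^-1 * (sin (l * T) - sin (l * - T)))
   (`|l^-1| * 2) _); last first.
  move=> T; rewrite normrM ler_wpM2l//; apply: le_trans (ler_normB _ _) _.
  rewrite (_ : 2 = 1 + 1)// lerD// ler_norml sin_geN1 sin_le1//.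
have dF (x : R) : is_derive x 1 (fun t => l^-1 * sin (l * t)) (cos (l * x)).
  by apply: is_derive_eq; rewrite /GRing.scale/=; field.
apply: near_eq_cvg; near=> T.
have T0 : 0 < T by [].
by rewrite /time_avg (Rintegral_sym_FTC T0 (@continuous_cosM l) dF) mulrBr.
Unshelve. all: by end_near. Qed.

Lemma has_mean_sinM (l : R) : l != 0 -> has_mean (fun t => sin (l * t)) 0.
Proof.
move=> l0; rewrite /has_mean.
apply: cvg_trans (@cvg_bounded_time_avg (fun T => - l^-1 * (cos (l * T) - cos (l * - T)))
   (`|- l^-1| * 2) _); last first.
  move=> T; rewrite normrM ler_wpM2l//; apply: le_trans (ler_normB _ _) _.
  rewrite (_ : 2 = 1 + 1)// lerD// ler_norml cos_geN1 cos_le1//.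
have dF (x : R) : is_derive x 1 (fun t => - l^-1 * cos (l * t)) (sin (l * x)).
  by apply: is_derive_eq; rewrite /GRing.scale/=; field.
apply: near_eq_cvg; near=> T.
have T0 : 0 < T by [].
by rewrite /time_avg (Rintegral_sym_FTC T0 (@continuous_sinM l) dF) mulrBr.
Unshelve. all: by end_near. Qed.

End TimeMeans.

(** * Unimodular characters and trigonometric polynomials in them *)

Section Characters.
Context {R : realType}.
Implicit Types (chi psi : nat -> R[i]) (F G : (nat -> R[i]) -> R[i]).
Implicit Types (t sg : R).

Definition unimodular_char chi : Prop :=
  (forall n, (0 < n)%N -> cabs (chi n) = 1) /\
  (forall m n, (0 < m)%N -> (0 < n)%N -> chi (m * n)%N = chi m * chi n).

Definition mulchar chi psi : nat -> R[i] := fun n => chi n * psi n.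

Definition vertical_char t : nat -> R[i] := fun n => cis (- (t * ln n%:R)).

Definition trivial_char : nat -> R[i] := fun=> 1.

(** For p prime, the completely multiplicative function with value w at p and 1 at every other
    prime. *)
Definition prime_char p (w : R[i]) : nat -> R[i] := fun n => w ^+ logn p n.

Lemma unimodular_mulchar chi psi :
  unimodular_char chi -> unimodular_char psi -> unimodular_char (mulchar chi psi).
Proof.
move=> [c1 c2] [p1 p2]; split=> [n n0|m n m0 n0]; rewrite /mulchar.
  by rewrite cabsM c1// p1// mulr1.
by rewrite c2// p2// mulrACA.
Qed.

Lemma unimodular_vertical_char t : unimodular_char (vertical_char t).
Proof.
split=> [n n0|m n m0 n0]; rewrite /vertical_char; first exact: cabs_cis.
by rewrite natrM lnM ?posrE ?ltr0n// mulrDr opprD cisD.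
Qed.

Lemma unimodular_trivial_char : unimodular_char trivial_char.
Proof. by split=> *; rewrite ?cabs1// mulr1. Qed.

Lemma unimodular_prime_char p (w : R[i]) : cabs w = 1 ->
  unimodular_char (prime_char p w).
Proof.
move=> w1; split=> [n n0|m n m0 n0]; rewrite /prime_char.
  by rewrite cabsX w1 expr1n.
by rewrite lognM// exprD.
Qed.

Lemma mulchar1 chi : mulchar trivial_char chi = chi.
Proof. by apply/funext => n; rewrite /mulchar mul1r. Qed.

Lemma mulcharA chi psi phi :
  mulchar chi (mulchar psi phi) = mulchar (mulchar chi psi) phi.
Proof. by apply/funext => n; rewrite /mulchar mulrA. Qed.

(** A pair (n, m) stands for the positive rational n/m, a frequency of the character group.
    Multiplicativity of chi makes these functions an algebra, and along [vertical_char] the pair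
    oscillates with frequency ln m - ln n, which is 0 only for n = m. *)
Definition trigpoly F : Prop := exists l : seq (R[i] * nat * nat),
  (forall e, e \in l -> (0 < e.1.2)%N /\ (0 < e.2)%N) /\
  forall chi, unimodular_char chi ->
    F chi = \sum_(e <- l) e.1.1 * chi e.1.2 * (chi e.2)^*.

Lemma trigpolyD F G : trigpoly F -> trigpoly G -> trigpoly (fun chi => F chi + G chi).
Proof.
move=> [l [lp lF]] [k [kp kG]]; exists (l ++ k); split.
  by move=> e; rewrite mem_cat => /orP[/lp|/kp].
by move=> chi hchi; rewrite big_cat/= lF// kG.
Qed.

Lemma trigpolyM F G : trigpoly F -> trigpoly G -> trigpoly (fun chi => F chi * G chi).
Proof.
move=> [l [lp lF]] [k [kp kG]].
exists [seq (e.1.1 * f.1.1, (e.1.2 * f.1.2)%N, (e.2 * f.2)%N) | e <- l, f <- k].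
split.
  move=> _ /allpairsP[[e f] [/= /lp[e1 e2] /kp[f1 f2] ->]] /=.
  by rewrite !muln_gt0 e1 e2 f1 f2.
move=> chi hchi; rewrite big_allpairs_dep lF// kG// mulr_suml.
rewrite big_seq [RHS]big_seq; apply: eq_bigr => e /lp[e1 e2].
rewrite mulr_sumr big_seq [RHS]big_seq; apply: eq_bigr => f /kp[f1 f2] /=.
by have [_ cM] := hchi; rewrite !cM// conjcM; ring.
Qed.

Lemma trigpoly_cst (c : R[i]) : trigpoly (fun=> c).
Proof.
exists [:: (c, 1%N, 1%N)]; split; first by move=> e; rewrite inE => /eqP ->.
move=> chi [c1 _]; rewrite big_seq1 /= -mulrA mulcJ_cabs c1// expr1n mulr1//.
Qed.

Lemma trigpolyX F n : trigpoly F -> trigpoly (fun chi => F chi ^+ n).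
Proof.
move=> TF; elim: n => [|n IH]; first exact: trigpoly_cst.
rewrite (_ : (fun _ => _) = (fun chi => F chi * F chi ^+ n)); last first.
  by apply/funext => chi; rewrite exprS.
exact: trigpolyM.
Qed.

Lemma vertical_pairE (b : R[i]) n m chi t :
  Re (b * mulchar chi (vertical_char t) n * (mulchar chi (vertical_char t) m)^*) =
  Re (b * chi n * (chi m)^*) * cos ((ln m%:R - ln n%:R) * t)
  - Im (b * chi n * (chi m)^*) * sin ((ln m%:R - ln n%:R) * t).
Proof.
have -> : b * mulchar chi (vertical_char t) n * (mulchar chi (vertical_char t) m)^* =
  b * chi n * (chi m)^* * cis ((ln m%:R - ln n%:R) * t).
  rewrite /mulchar conjcM /vertical_char -[(cis (- (t * ln m%:R)))^*]cisN opprK.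
  have -> : (ln m%:R - ln n%:R) * t = - (t * ln n%:R) + t * ln m%:R by ring.
  rewrite cisD; ring.
by case: (b * chi n * _) => x y /=.
Qed.

Lemma continuous_sum I (r : seq I) (f : I -> R -> R) :
  (forall i, continuous (f i)) -> continuous (fun t => \sum_(i <- r) f i t).
Proof.
move=> cf; elim: r => [|i r IH] t.
  by under eq_fun do rewrite big_nil; exact: cvg_cst.
by under eq_fun do rewrite big_cons; apply: cvgD; [exact: cf | exact: IH].
Qed.

Lemma continuous_pair (u v l : R) :
  continuous (fun t => u * cos (l * t) - v * sin (l * t)).
Proof.
move=> t; apply: cvgB; apply: cvgMr.
- exact: continuous_cosM.
- exact: continuous_sinM.
Qed.

Lemma trigpoly_continuous F chi : unimodular_char chi -> trigpoly F ->
  continuous (fun t => Re (F (mulchar chi (vertical_char t)))).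
Proof.
move=> uchi [l [lp lF]].
rewrite (_ : (fun _ => _) = (fun t => \sum_(e <- l)
    (Re (e.1.1 * chi e.1.2 * (chi e.2)^*) * cos ((ln e.2%:R - ln e.1.2%:R) * t)
    - Im (e.1.1 * chi e.1.2 * (chi e.2)^*) * sin ((ln e.2%:R - ln e.1.2%:R) * t)))).
  by apply: continuous_sum => e; exact: continuous_pair.
apply/funext => t; rewrite lF; last first.
  exact: unimodular_mulchar (unimodular_vertical_char t).
by rewrite Re_sum; apply: eq_bigr => e _; rewrite vertical_pairE.
Qed.

Lemma locally_integrable_sym_sum I (r : seq I) (f : I -> R -> R) :
  (forall i, locally_integrable_sym (f i)) ->
  locally_integrable_sym (fun t => \sum_(i <- r) f i t).
Proof.
move=> cf; elim: r => [|i r IH].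
  by under eq_fun do rewrite big_nil; exact: locally_integrable_sym_cst.
by under eq_fun do rewrite big_cons; exact: locally_integrable_symD.
Qed.

Lemma has_mean_sum (I : eqType) (r : seq I) (f : I -> R -> R) (m : I -> R) :
  (forall i, locally_integrable_sym (f i)) ->
  (forall i, i \in r -> has_mean (f i) (m i)) ->
  has_mean (fun t => \sum_(i <- r) f i t) (\sum_(i <- r) m i).
Proof.
move=> cf; elim: r => [|i r IH] fm.
  by under eq_fun do rewrite big_nil; rewrite big_nil; exact: has_mean_cst.
under eq_fun do rewrite big_cons; rewrite big_cons; apply: has_meanD => //.
- exact: locally_integrable_sym_sum.
- by apply: fm; rewrite inE eqxx.
- by apply: IH => j jr; apply: fm; rewrite inE jr orbT.
Qed.

Lemma continuous_vertical_pair (b : R[i]) n m chi : continuous (fun t =>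
  Re (b * mulchar chi (vertical_char t) n * (mulchar chi (vertical_char t) m)^*)).
Proof.
under eq_fun do rewrite vertical_pairE.
exact: continuous_pair.
Qed.

Lemma vertical_pair_mean (b : R[i]) n m chi : unimodular_char chi ->
  (0 < n)%N -> (0 < m)%N ->
  has_mean (fun t =>
    Re (b * mulchar chi (vertical_char t) n * (mulchar chi (vertical_char t) m)^*))
    (if n == m then Re b else 0).
Proof.
move=> uchi n0 m0; set u := Re (b * chi n * (chi m)^*); set v := Im (b * chi n * (chi m)^*).
apply: (@eq_has_mean _ (fun t => u * cos ((ln m%:R - ln n%:R) * t)
    - v * sin ((ln m%:R - ln n%:R) * t))).
  by move=> t; rewrite vertical_pairE.
rewrite {}/u {}/v; case: eqVneq => [<-|nm].
  rewrite (_ : (fun _ => _) = (fun=> Re b)); first exact: has_mean_cst.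
  have [c1 _] := uchi; apply/funext => t.
  rewrite -mulrA mulcJ_cabs c1// expr1n mulr1.
  by rewrite addrN mul0r cos0 sin0 mulr0 subr0 mulr1.
have l0 : ln m%:R - ln n%:R != 0 :> R.
  rewrite subr_eq0; apply/eqP => /ln_inj.
  rewrite !posrE !ltr0n => /(_ m0 n0)/eqP; rewrite eqr_nat eq_sym.
  by rewrite (negPf nm).
set u := Re _; set v := Im _.
have -> : 0 = u * 0 + (- v) * 0 :> R by rewrite !mulr0 addr0.
rewrite (_ : (fun _ => _) = (fun t => u * cos ((ln m%:R - ln n%:R) * t) +
   (- v) * sin ((ln m%:R - ln n%:R) * t))); last first.
  by apply/funext => t; rewrite mulNr.
have ic := continuous_integrable_sym (@continuous_cosM R (ln m%:R - ln n%:R)).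
have isi := continuous_integrable_sym (@continuous_sinM R (ln m%:R - ln n%:R)).
apply: has_meanD.
- apply: continuous_integrable_sym => t; apply: cvgMr; exact: continuous_cosM.
- apply: continuous_integrable_sym => t; apply: cvgMr; exact: continuous_sinM.
- by apply: has_meanZ => //; exact: has_mean_cosM.
- by apply: has_meanZ => //; exact: has_mean_sinM.
Qed.

(* Only the pairs (n, n) contribute to the mean, and there chi cancels. *)
Lemma trigpoly_mean F : trigpoly F -> exists m, forall chi, unimodular_char chi ->
  has_mean (fun t => Re (F (mulchar chi (vertical_char t)))) m.
Proof.
move=> [l [lp lF]].
exists (\sum_(e <- l) if e.1.2 == e.2 then Re e.1.1 else 0) => chi uchi.
rewrite (_ : (fun _ => _) = (fun t => \sum_(e <- l)
  Re (e.1.1 * mulchar chi (vertical_char t) e.1.2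
      * (mulchar chi (vertical_char t) e.2)^*))).
  apply: has_mean_sum => [e|[[b n] m] /lp/=[n0 m0]].
    by apply: continuous_integrable_sym; exact: continuous_vertical_pair.
  exact: vertical_pair_mean.
apply/funext => t; rewrite lF ?Re_sum//.
exact: unimodular_mulchar (unimodular_vertical_char t).
Qed.

End Characters.

(** * Dirichlet sums as functions of a character; the logarithmic series *)

Section DirichletCharacterSums.
Context {R : realType}.
Implicit Types (a : nat -> R[i]) (chi psi : nat -> R[i]) (t sg eps : R).

(** The factor n^(-it) is replaced by chi(n), so that twists and vertical shifts become operations
    of the same kind; [vertical_char t] gives back the Dirichlet sum. *)
Definition char_sum a N sg chi : R[i] :=
  \sum_(1 <= n < N.+1) a n * (n%:R `^ (- sg))%:C * chi n.

Lemma dirichlet_sumE a N sg t :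
  dirichlet_sum a N (sg +i* t) = char_sum a N sg (vertical_char t).
Proof.
apply: eq_bigr => n _; rewrite -mulrA; congr (_ * (_ * _)).
by rewrite /vertical_char /cis cosN sinN.
Qed.

Definition abs_sum a N sg : R := \sum_(1 <= n < N.+1) cabs (a n) * n%:R `^ (- sg).

Lemma cabs_term (b : R[i]) n sg (w : R[i]) : cabs w = 1 ->
  cabs (b * (n%:R `^ (- sg))%:C * w) = cabs b * n%:R `^ (- sg).
Proof. by move=> w1; rewrite !cabsM w1 mulr1 cabs_real ger0_norm// powR_ge0. Qed.

Lemma char_sum_le a N sg chi : unimodular_char chi ->
  cabs (char_sum a N sg chi) <= abs_sum a N sg.
Proof.
move=> [c1 _]; apply: le_trans (cabs_sum _ _ _) _.
rewrite big_nat [leRHS]big_nat; apply: ler_sum => n /andP[n0 _].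
by rewrite cabs_term// c1.
Qed.

Lemma trigpoly_char_sum a N sg : trigpoly (char_sum a N sg).
Proof.
exists [seq (a n * (n%:R `^ (- sg))%:C, n, 1%N) | n <- index_iota 1 N.+1]; split.
  by move=> e /mapP[n]; rewrite mem_index_iota => /andP[n0 _] -> /=.
move=> chi [c1 cM]; rewrite big_map; apply: eq_bigr => n _ /=.
have chi1 : chi 1%N = 1.
  have := cM 1%N 1%N isT isT; rewrite muln1 => /eqP.
  rewrite -{1}[chi 1%N]mulr1 => /eqP/mulfI -> //.
  by rewrite -cabs_eq0 c1// oner_eq0.
by rewrite chi1 conjc1 mulr1.
Qed.

Lemma trigpoly_conj_char_sum a N sg : trigpoly (fun chi => (char_sum a N sg chi)^*).
Proof.
exists [seq ((a n * (n%:R `^ (- sg))%:C)^*, 1%N, n) | n <- index_iota 1 N.+1]; split.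
  by move=> e /mapP[n]; rewrite mem_index_iota => /andP[n0 _] -> /=.
move=> chi [c1 cM]; rewrite big_map conjc_sum; apply: eq_bigr => n _ /=.
have chi1 : chi 1%N = 1.
  have := cM 1%N 1%N isT isT; rewrite muln1 => /eqP.
  rewrite -{1}[chi 1%N]mulr1 => /eqP/mulfI -> //.
  by rewrite -cabs_eq0 c1// oner_eq0.
by rewrite chi1 mulr1 -conjcM.
Qed.

Lemma trigpoly_sqr_cabs a N sg :
  trigpoly (fun chi => (cabs (char_sum a N sg chi) ^+ 2)%:C).
Proof.
rewrite (_ : (fun _ => _) =
    (fun chi => char_sum a N sg chi * (char_sum a N sg chi)^*)); last first.
  by apply/funext => chi; rewrite mulcJ_cabs.
exact: trigpolyM (trigpoly_char_sum a N sg) (trigpoly_conj_char_sum a N sg).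
Qed.

Lemma continuous_log_reg a N sg eps chi : 0 < eps -> unimodular_char chi ->
  continuous (fun t => log_reg eps (char_sum a N sg (mulchar chi (vertical_char t)))).
Proof.
move=> e0 uchi t.
have c2 : continuous (fun t => cabs (char_sum a N sg (mulchar chi (vertical_char t))) ^+ 2).
  exact: (trigpoly_continuous uchi (trigpoly_sqr_cabs a N sg)).
apply: cvgMr; apply: (@continuous_comp _ _ _ (fun t =>
    cabs (char_sum a N sg (mulchar chi (vertical_char t))) ^+ 2 + eps) (@ln R)).
  by apply: cvgD; [exact: c2 | exact: cvg_cst].
by apply: continuous_ln; rewrite ltr_wpDl// sqr_ge0.
Qed.

Lemma is_derive_ln_one_minus_series n (x : R) : x < 1 ->
  is_derive x 1 (fun y => ln (1 - y) + \sum_(k < n) y ^+ k.+1 / k.+1%:R)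
    (- (x ^+ n / (1 - x))).
Proof.
move=> x1; have x10 : 0 < 1 - x by rewrite subr_gt0.
elim: n => [|n IH].
  rewrite (_ : (fun _ => _) = (@ln R) \o (fun y => 1 - y)); last first.
    by apply/funext => y; rewrite big_ord0 addr0.
  have h := is_derive1_ln x10.
  have h1 : is_derive x 1 (fun y : R => 1 - y) (-1).
    by apply: is_derive_eq; rewrite /GRing.scale/= add0r mul1r.
  by apply: is_derive_eq; rewrite expr0 mul1r mulrN1.
rewrite (_ : (fun _ => _) = (fun y => ln (1 - y) + \sum_(k < n) y ^+ k.+1 / k.+1%:R)
   + (fun y => y ^+ n.+1 / n.+1%:R)); last first.
  by apply/funext => y; rewrite big_ord_recr/= addrA.
have h2 : is_derive x 1 (fun y : R => y ^+ n.+1 / n.+1%:R) (x ^+ n).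
  rewrite (_ : (fun _ => _) = (@id R) ^+ n.+1 * cst (n.+1%:R^-1) :> (R -> R)); last first.
    by apply/funext => y; rewrite {2}/GRing.mul/= exprfctE.
  have h3 : is_derive x 1 ((@id R) ^+ n.+1) ((n.+1%:R * x ^+ n) *: 1).
    exact: is_deriveX.
  apply: is_derive_eq; rewrite /GRing.scale/= mulr0 add0r mulr1.
  by rewrite mulrA mulVf ?mul1r// pnatr_eq0.
apply: is_derive_eq; rewrite exprS; field.
by rewrite gt_eqF.
Qed.

(** The derivative of the left-hand function telescopes to - y^n / (1 - y), and the mean value
    theorem gives a bound uniform on [0, r]. *)
Lemma ln_one_minus_series (r y : R) n : r < 1 -> 0 <= y <= r ->
  `|ln (1 - y) + \sum_(k < n) y ^+ k.+1 / k.+1%:R| <= r ^+ n / (1 - r).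
Proof.
move=> r1 /andP[y0 yr].
pose g x : R := ln (1 - x) + \sum_(k < n) x ^+ k.+1 / k.+1%:R.
have g0 : g 0 = 0.
  by rewrite /g subr0 ln1 add0r big1// => k _; rewrite expr0n/= mul0r.
have dgE (x : R) : x <= y -> is_derive x 1 g (- (x ^+ n / (1 - x))).
  by move=> xy; apply: is_derive_ln_one_minus_series; lra.
have [||c] := @MVT_segment R g (fun x => - (x ^+ n / (1 - x))) 0 y y0.
- by move=> x; rewrite in_itv/= => /andP[_ xy]; apply: dgE; exact: ltW.
- apply: derivable_within_continuous => x; rewrite in_itv/= => /andP[_ xy].
  by have [] := dgE _ xy.
rewrite in_itv/= g0 !subr0 => /andP[c0 cy]; rewrite -/(g y) => ->.
have c1 : c < 1 by lra.
have h0 : 0 <= c ^+ n / (1 - c) by rewrite divr_ge0 ?exprn_ge0 ?subr_ge0 ?(ltW c1).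
rewrite normrM normrN (ger0_norm h0) (ger0_norm y0).
apply: (@le_trans _ _ (c ^+ n / (1 - c))).
- by rewrite ler_piMr//; lra.
- apply: ler_pM; rewrite ?exprn_ge0 ?invr_ge0 ?subr_ge0 ?(ltW c1)//.
  + by apply: lerXn2r; rewrite ?nnegrE//; lra.
  + by rewrite lef_pV2 ?posrE; lra.
Qed.

End DirichletCharacterSums.

(** * The regularized Jessen function and its invariance under twists *)

Section RegularizedJessen.
Context {R : realType}.
Implicit Types (a : nat -> R[i]) (chi psi : nat -> R[i]) (t sg eps : R).
Implicit Types (f g : (nat -> R[i]) -> R).

Definition real_trigpoly f := trigpoly (fun chi => (f chi)%:C).

Lemma real_trigpolyD f g : real_trigpoly f -> real_trigpoly g ->
  real_trigpoly (fun chi => f chi + g chi).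
Proof.
move=> tf tg; rewrite /real_trigpoly.
rewrite (_ : (fun _ => _) = (fun chi => (f chi)%:C + (g chi)%:C)).
  exact: trigpolyD.
by apply/funext => chi; rewrite rmorphD.
Qed.

Lemma real_trigpolyM f g : real_trigpoly f -> real_trigpoly g ->
  real_trigpoly (fun chi => f chi * g chi).
Proof.
move=> tf tg; rewrite /real_trigpoly.
rewrite (_ : (fun _ => _) = (fun chi => (f chi)%:C * (g chi)%:C)).
  exact: trigpolyM.
by apply/funext => chi; rewrite rmorphM.
Qed.

Lemma real_trigpoly_cst (c : R) : real_trigpoly (fun=> c).
Proof. exact: trigpoly_cst. Qed.

Lemma real_trigpolyX f n : real_trigpoly f -> real_trigpoly (fun chi => f chi ^+ n).
Proof.
move=> tf; rewrite /real_trigpoly.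
rewrite (_ : (fun _ => _) = (fun chi => (f chi)%:C ^+ n)).
  exact: trigpolyX.
by apply/funext => chi; rewrite rmorphXn.
Qed.

Lemma real_trigpoly_sum I (r : seq I) (h : I -> (nat -> R[i]) -> R) :
  (forall i, real_trigpoly (h i)) -> real_trigpoly (fun chi => \sum_(i <- r) h i chi).
Proof.
move=> tf; elim: r => [|i r IH].
  by under eq_fun do rewrite big_nil; exact: real_trigpoly_cst.
by under eq_fun do rewrite big_cons; exact: real_trigpolyD.
Qed.

(** With D = S^2 + eps, the quantity |P|^2 + eps equals D (1 - y) where 0 <= y <= 1 - eps / D < 1.
    The logarithmic series in y thus converges uniformly, and its partial sums are polynomials in
    |P|^2. *)
Lemma log_reg_approx a N sg eps (eta : R) : 0 < eps -> 0 < eta ->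
  exists f, real_trigpoly f /\ forall chi, unimodular_char chi ->
    `|log_reg eps (char_sum a N sg chi) - f chi| <= eta.
Proof.
move=> e0 eta0; pose S := abs_sum a N sg; pose D : R := S ^+ 2 + eps.
have D0 : 0 < D by rewrite ltr_wpDl// sqr_ge0.
pose r : R := 1 - eps / D.
have r1 : r < 1 by rewrite gtrBl divr_gt0.
have r0 : 0 <= r by rewrite subr_ge0 ler_pdivrMr// mul1r lerDr sqr_ge0.
have [n rn] : exists n, r ^+ n / (1 - r) <= eta.
  have : r ^+ n @[n --> \oo] --> (0 : R) by apply: cvg_expr; rewrite ger0_norm.
  move=> /cvgrPdist_le /(_ (eta * (1 - r))) []; first by rewrite mulr_gt0// subr_gt0.
  move=> n _ /(_ n (leqnn n)) /=; rewrite sub0r normrN ger0_norm ?exprn_ge0// => h.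
  by exists n; rewrite ler_pdivrMr// subr_gt0.
pose y chi : R := 1 + - D^-1 * (cabs (char_sum a N sg chi) ^+ 2 + eps).
exists (fun chi => 2^-1 * ln D + (- 2^-1) * \sum_(k <- index_enum 'I_n) y chi ^+ k.+1 * k.+1%:R^-1).
split.
  have ty : real_trigpoly y.
    apply: real_trigpolyD; first exact: real_trigpoly_cst.
    apply: real_trigpolyM; first exact: real_trigpoly_cst.
    by apply: real_trigpolyD; [exact: trigpoly_sqr_cabs | exact: real_trigpoly_cst].
  apply: real_trigpolyD; first exact: real_trigpoly_cst.
  apply: real_trigpolyM; first exact: real_trigpoly_cst.
  apply: real_trigpoly_sum => k.
  by apply: real_trigpolyM; [exact: real_trigpolyX | exact: real_trigpoly_cst].
move=> chi uchi; rewrite /log_reg.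
set x := cabs _ ^+ 2.
have x0 : 0 <= x by exact: sqr_ge0.
have xS : x <= S ^+ 2.
  have h := char_sum_le a N sg uchi.
  by rewrite lerXn2r ?nnegrE ?cabs_ge0//; exact: le_trans (cabs_ge0 _) h.
have yE : 1 - y chi = (x + eps) / D by rewrite /y -/x; field; rewrite gt_eqF.
have -> : ln (x + eps) = ln D + ln (1 - y chi).
  rewrite yE -lnM ?posrE ?divr_gt0//; last by lra.
  by congr ln; field; rewrite gt_eqF.
have yr : 0 <= y chi <= r.
  have : y chi = 1 - (x + eps) / D by lra.
  move=> ->; rewrite /r; apply/andP; split.
    by rewrite subr_ge0 ler_pdivrMr// mul1r lerD2r.
  by rewrite lerD2l lerN2 ler_pM2r ?invr_gt0// lerDr.
have := ln_one_minus_series n r1 yr; set s := \sum_(k < n) _ => h.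
have -> : 2^-1 * (ln D + ln (1 - y chi)) - (2^-1 * ln D + - 2^-1 * s) =
  2^-1 * (ln (1 - y chi) + s) by ring.
rewrite normrM ger0_norm// ; have := normr_ge0 (ln (1 - y chi) + s); lra.
Qed.

Lemma integrable_log_reg a N sg eps chi : 0 < eps -> unimodular_char chi ->
  locally_integrable_sym
    (fun t => log_reg eps (char_sum a N sg (mulchar chi (vertical_char t)))).
Proof.
by move=> e0 uchi; apply: continuous_integrable_sym; exact: continuous_log_reg.
Qed.

(* The approximating trigonometric polynomials have the same mean along every
   twist, hence so does [log_reg] (Bohr equivalence). *)
Lemma log_reg_mean a N sg eps : 0 < eps ->
  exists m, forall chi, unimodular_char chi ->
    has_mean (fun t => log_reg eps (char_sum a N sg (mulchar chi (vertical_char t)))) m.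
Proof.
move=> e0.
have H (eta : R) : 0 < eta -> exists (g : (nat -> R[i]) -> R -> R) (m : R),
    forall chi, unimodular_char chi ->
    [/\ locally_integrable_sym (g chi), has_mean (g chi) m &
    forall t, `|log_reg eps (char_sum a N sg (mulchar chi (vertical_char t))) - g chi t|
       <= eta].
  move=> eta0; have [f [tf fH]] := log_reg_approx a N sg e0 eta0.
  have [m hm] := trigpoly_mean tf.
  exists (fun chi t => f (mulchar chi (vertical_char t))), m => chi uchi; split.
  - exact: continuous_integrable_sym (trigpoly_continuous uchi tf).
  - exact: hm.
  - by move=> t; apply: fH; exact: unimodular_mulchar (unimodular_vertical_char t).
have ex chi : unimodular_char chi -> exists m,
    has_mean (fun t => log_reg eps (char_sum a N sg (mulchar chi (vertical_char t)))) m.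
  move=> uchi; apply: has_mean_approx.
    exact: integrable_log_reg.
  move=> eta /H[g [m gm]]; exists (g chi), m; exact: gm.
have u1 := @unimodular_trivial_char R.
have [m hm] := ex _ u1; exists m => chi uchi; have [m' hm'] := ex _ uchi.
suff -> : m = m' by [].
apply/eqP; rewrite -subr_eq0 -normr_le0; apply/ler_addgt0Pr => e ep.
have [g [k gk]] := H (e / 2) (divr_gt0 ep (ltr0Sn _ 1)).
have [l1 h1 d1] := gk _ u1; have [l2 h2 d2] := gk _ uchi.
have c1 := integrable_log_reg a N sg e0 u1.
have c2 := integrable_log_reg a N sg e0 uchi.
have b1 := has_mean_dist c1 l1 d1 hm h1.
have b2 := has_mean_dist c2 l2 d2 hm' h2.
have := ler_normB (m - k) (m' - k).
by rewrite opprB addrA subrK add0r; lra.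
Qed.

Definition jessen_reg a N sg eps : R :=
  lim (time_avg (fun t => log_reg eps (char_sum a N sg (vertical_char t))) T
    @[T --> +oo]).

Lemma jessen_regP a N sg eps chi : 0 < eps -> unimodular_char chi ->
  has_mean (fun t => log_reg eps (char_sum a N sg (mulchar chi (vertical_char t))))
    (jessen_reg a N sg eps).
Proof.
move=> e0 uchi; have [m hm] := log_reg_mean a N sg e0.
suff -> : jessen_reg a N sg eps = m by exact: hm.
have h := hm _ (@unimodular_trivial_char R).
apply: cvg_lim; first exact: Rhausdorff.
by apply: eq_has_mean h => t; rewrite mulchar1.
Qed.

End RegularizedJessen.

(** * Exponential sums with real frequencies *)

Section Sublevel.
Context {R : realType}.
Implicit Types (l : seq (R[i] * R)) (lam t x eps eta : R).
Local Notation mu := (@lebesgue_measure R).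

Definition exp_sum l t : R[i] := \sum_(e <- l) e.1 * cis (e.2 * t).

Lemma continuous_cabs_exp_sum l : continuous (fun t => cabs (exp_sum l t)).
Proof.
have -> : (fun t => cabs (exp_sum l t)) =
  (fun t => Num.sqrt ((\sum_(e <- l) (Re e.1 * cos (e.2 * t) - Im e.1 * sin (e.2 * t))) ^+ 2
   + (\sum_(e <- l) (Im e.1 * cos (e.2 * t) - (- Re e.1) * sin (e.2 * t))) ^+ 2)).
  apply/funext => t; rewrite cabsE /exp_sum Re_sum Im_sum.
  congr (Num.sqrt (_ ^+ 2 + _ ^+ 2)); apply: eq_bigr => -[[u v] k] _ //=.
  by rewrite mulNr opprK addrC.
have c1 : continuous (fun t => \sum_(e <- l) (Re e.1 * cos (e.2 * t) - Im e.1 * sin (e.2 * t))).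
  by apply: continuous_sum => e; exact: continuous_pair.
have c2 : continuous (fun t => \sum_(e <- l) (Im e.1 * cos (e.2 * t) - (- Re e.1) * sin (e.2 * t))).
  by apply: continuous_sum => e; exact: continuous_pair.
move=> t; apply: (@continuous_comp _ _ _ (fun t =>
    (\sum_(e <- l) (Re e.1 * cos (e.2 * t) - Im e.1 * sin (e.2 * t))) ^+ 2
   + (\sum_(e <- l) (Im e.1 * cos (e.2 * t) - (- Re e.1) * sin (e.2 * t))) ^+ 2)
   Num.sqrt); last exact: sqrt_continuous.
by apply: cvgD; rewrite !expr2; apply: cvgM; [exact: c1|exact: c1|exact: c2|exact: c2].
Qed.

Lemma measurable_sublevel (F : R -> R) c : continuous F ->
  measurable ([set t | F t <= c] : set (measurableTypeR R)).
Proof.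
move=> cF.
have -> : [set t | F t <= c] = F @^-1` `]-oo, c].
  by apply/seteqP; split => t /=; rewrite in_itv.
by rewrite -[X in measurable X]setTI; apply: continuous_measurable_fun.
Qed.

Lemma measure_subdivision (A B : set (measurableTypeR R)) (x h c : R) n :
  measurable A -> measurable B -> 0 <= h -> 0 <= c ->
  (forall i : nat, (i < n)%N ->
    (mu (A `&` `[(x + i%:R * h)%R, (x + i.+1%:R * h)%R[)
      <= mu (B `&` `[(x + i%:R * h)%R, (x + i.+1%:R * h)%R[) + c%:E)%E) ->
  (mu (A `&` `[x, (x + n%:R * h)%R[) <= mu (B `&` `[x, (x + n%:R * h)%R[) + (n%:R * c)%:E)%E.
Proof.
move=> mA mB h0 c0; elim: n => [|n IH] H.
  rewrite !mul0r addr0 set_itvco0 !setI0 !measure0 adde0 //.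
have split_itv : `[x, x + n.+1%:R * h[%classic =
   `[x, x + n%:R * h[ `|` `[x + n%:R * h, x + n.+1%:R * h[ :> set R.
  apply/seteqP; split => t /=; rewrite !in_itv/=.
    by move=> /andP[-> ->]; rewrite andbT; case: ltP; [left|right].
  have e : x + n%:R * h <= x + n.+1%:R * h by rewrite lerD2l ler_wpM2r// ler_nat.
  move=> [/andP[-> /lt_le_trans ->//]|/andP[+ ->]].
  by rewrite andbT; apply: le_trans; rewrite lerDl mulr_ge0.
have dis (D : set (measurableTypeR R)) : measurable D ->
  mu (D `&` `[x, (x + n.+1%:R * h)%R[) =
  (mu (D `&` `[x, (x + n%:R * h)%R[) + mu (D `&` `[(x + n%:R * h)%R, (x + n.+1%:R * h)%R[))%E.
  move=> mD; rewrite split_itv setIUr measureU//; try exact: measurableI.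
  apply/seteqP; split => t //=; rewrite !in_itv/= => -[[_ /andP[_ a]] [_ /andP[b _]]].
  by move: (lt_le_trans a b); rewrite ltxx.
have -> : (n.+1%:R * c)%:E = ((n%:R * c)%:E + c%:E)%E.
  by rewrite -EFinD -natr1 mulrDl mul1r.
rewrite !dis// addeACA.
apply: leeD; first by apply: IH => i ni; apply: H; exact: ltnW.
exact: H.
Qed.

(** Multiplication by exp(-i lam t) keeps the modulus. With [lam] one of the frequencies, that term
    becomes constant and drops out of the derivative. *)
Definition modulate l lam := [seq (e.1, e.2 - lam) | e <- l].

Definition deriv_terms l := [seq (e.1 * ('i%C * e.2%:C), e.2) | e <- l].

(** Bounds both the second-order Taylor remainder and the Lipschitz constant of the derivative; the
    2 is that of [cis_taylor1] and [cis_lip]. *)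
Definition curvature l : R := \sum_(e <- l) 2 * cabs e.1 * e.2 ^+ 2.

Lemma cabs_modulate l lam t : cabs (exp_sum (modulate l lam) t) = cabs (exp_sum l t).
Proof.
have -> : exp_sum (modulate l lam) t = cis (- (lam * t)) * exp_sum l t.
  rewrite /exp_sum big_map mulr_sumr; apply: eq_bigr => e _ /=.
  by rewrite mulrBl cisD; ring.
by rewrite cabsM cabs_cis mul1r.
Qed.

Lemma exp_sum_taylor l t h :
  cabs (exp_sum l (t + h) - exp_sum l t - h%:C * exp_sum (deriv_terms l) t)
    <= curvature l * h ^+ 2.
Proof.
rewrite /exp_sum big_map mulr_sumr -!sumrB mulr_suml.
apply: le_trans (cabs_sum _ _ _) _; apply: ler_sum => e _ /=.
have -> : e.1 * cis (e.2 * (t + h)) - e.1 * cis (e.2 * t) -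
   h%:C * (e.1 * ('i%C * e.2%:C) * cis (e.2 * t)) =
   e.1 * cis (e.2 * t) * (cis (e.2 * h) - 1 - 'i%C * (e.2 * h)%:C).
  rewrite mulrDr cisD rmorphM/=; ring.
rewrite !cabsM cabs_cis mulr1.
apply: le_trans (ler_wpM2l (cabs_ge0 _) (cis_taylor1 _)) _.
by rewrite real_normK ?num_real// exprMn; lra.
Qed.

Lemma deriv_terms_lip l t h :
  cabs (exp_sum (deriv_terms l) (t + h) - exp_sum (deriv_terms l) t)
    <= curvature l * `|h|.
Proof.
rewrite /exp_sum !big_map -sumrB mulr_suml.
apply: le_trans (cabs_sum _ _ _) _; apply: ler_sum => e _ /=.
have -> : e.1 * ('i%C * e.2%:C) * cis (e.2 * (t + h)) -
    e.1 * ('i%C * e.2%:C) * cis (e.2 * t) =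
    e.1 * ('i%C * e.2%:C) * cis (e.2 * t) * (cis (e.2 * h) - 1).
  by rewrite mulrDr cisD; ring.
rewrite !cabsM cabs_cis mulr1 cabs_real.
have -> : cabs ('i%C : R[i]) = 1 by rewrite cabsE /= expr0n/= expr1n add0r sqrtr1.
rewrite mul1r; apply: le_trans (ler_wpM2l _ (cis_lip _)) _.
  by rewrite mulr_ge0// cabs_ge0.
have -> : e.2 ^+ 2 = `|e.2| * `|e.2| by rewrite -expr2 real_normK ?num_real.
by rewrite normrM; lra.
Qed.

End Sublevel.

(** * Measure of the sublevel sets of exponential sums *)

Section SublevelEstimate.
Context {R : realType}.
Implicit Types (l : seq (R[i] * R)) (t x eps eta : R).
Local Notation mu := (@lebesgue_measure R).

Lemma curvature_ge0 l : 0 <= curvature l.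
Proof.
apply: sumr_ge0 => e _; apply: mulr_ge0; last exact: sqr_ge0.
by rewrite mulr_ge0 ?cabs_ge0.
Qed.

Lemma mu_co (x h : R) : 0 <= h -> mu `[x, (x + h)%R[ = h%:E.
Proof.
rewrite le_eqVlt => /orP[/eqP <-|h0]; first by rewrite addr0 set_itvco0 measure0.
by rewrite lebesgue_measure_itv/= lte_fin ltrDl h0 -EFinB addrC addKr.
Qed.

Lemma mu_sub_diam (A : set (measurableTypeR R)) (d : R) : measurable A -> 0 <= d ->
  (forall s t, A s -> A t -> s <= t -> t - s <= d) -> (mu A <= (2 * d)%:E)%E.
Proof.
move=> mA d0 H; have [->|/set0P[s As]] := eqVneq A set0.
  by rewrite measure0 lee_fin mulr_ge0.
have : (mu A <= mu `[(s - d)%R, (s + d)%R])%E.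
  apply: le_measure; rewrite ?inE// => t At /=; rewrite in_itv/=.
  by have [st|/ltW ts] := leP s t; [have := H _ _ As At st|have := H _ _ At As ts]; lra.
move=> /le_trans; apply; rewrite lebesgue_measure_itv/= lte_fin.
case: ifP => _; last by rewrite lee_fin mulr_ge0.
by rewrite -EFinB lee_fin; lra.
Qed.

(* On an interval of length [h] with [C h <= eta / 2], either [|g| < 2 eta]
   throughout or [|g| >= eta] throughout; in the second case [f] moves with
   speed at least [eta / 2]. *)
Lemma sublevel_short_interval (f g : R -> R[i]) (C eps eta x h : R) :
  0 < eta -> 0 <= eps -> 0 <= h -> 0 <= C -> 2 * (C * h) <= eta ->
  (forall t s, cabs (f (t + s) - f t - s%:C * g t) <= C * s ^+ 2) ->
  (forall t s, cabs (g (t + s) - g t) <= C * `|s|) ->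
  measurable ([set t | cabs (f t) <= eps] : set (measurableTypeR R)) ->
  measurable ([set t | cabs (g t) <= 2 * eta] : set (measurableTypeR R)) ->
  (mu ([set t | (cabs (f t) <= eps)%R] `&` `[x, (x + h)%R[)
   <= mu ([set t | (cabs (g t) <= 2 * eta)%R] `&` `[x, (x + h)%R[)
      + (8 * eps / eta)%:E)%E.
Proof.
move=> eta0 eps0 h0 C0 Ch fH gH mf mg.
have c0 : 0 <= 8 * eps / eta by rewrite divr_ge0 ?mulr_ge0// ltW.
have [[t0 [gt0 t0I]]|H] :=
    pselect (exists t0, (cabs (g t0) < eta) /\ (t0 \in `[x, (x + h)%R[)).
  apply: (@le_trans _ _ (mu ([set t | (cabs (g t) <= 2 * eta)%R] `&` `[x, (x + h)%R[))).
    apply: le_measure; rewrite ?inE; try exact: measurableI.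
    move=> t [_ tI]; split => //=.
    have := gH t0 (t - t0); rewrite subrKC.
    have tt : `|t - t0| <= h.
      move: t0I tI; rewrite /= !in_itv/= => /andP[a b] /andP[c d].
      by rewrite ler_norml; apply/andP; split; lra.
    have : C * `|t - t0| <= C * h by rewrite ler_wpM2l.
    have := cabsD (g t0) (g t - g t0); rewrite subrKC => h1 h2 h3.
    by have := le_trans h1 (lerD (ltW gt0) (le_trans h3 h2)); lra.
  by rewrite leeDl.
have {}H t : t \in `[x, (x + h)%R[ -> eta <= cabs (g t).
  by move=> tI; rewrite leNgt; apply/negP => gt; apply: H; exists t.
(* For s <= t in the set, (t - s) eta <= 2 eps + C (t - s)^2 <= 2 eps + (t - s) eta / 2, hence t - s
   <= 4 eps / eta; [mu_sub_diam] doubles this. *)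
have -> : 8 * eps / eta = 2 * (4 * eps / eta) by ring.
apply: (@le_trans _ _ ((2 * (4 * eps / eta))%:E)); last by rewrite leeDr.
apply: mu_sub_diam; first exact: measurableI.
  by rewrite divr_ge0 ?mulr_ge0// ltW.
move=> s t [/= fs sI] [/= ft tI] st.
have gs := H _ sI.
have := fH s (t - s); rewrite subrKC.
set r := _ - _ - _ => rb.
have ts : 0 <= t - s by rewrite subr_ge0.
have e : (t - s)%:C * g s = (f t - f s) - r by rewrite /r; ring.
have : cabs ((t - s)%:C * g s) <= 2 * eps + C * (t - s) ^+ 2.
  rewrite e; apply: le_trans (cabsB _ _) _; apply: lerD => //.
  by apply: le_trans (cabsB _ _) _; lra.
rewrite cabsM cabs_real ger0_norm// => h1.
have tsh : t - s <= h.
  by move: sI tI; rewrite /= !in_itv/= => /andP[a b] /andP[c d]; lra.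
rewrite ler_pdivlMr//.
have h2 : (t - s) * eta <= (t - s) * cabs (g s) by rewrite ler_wpM2l.
have h3 : C * (t - s) ^+ 2 <= (t - s) * (C * h).
  by rewrite expr2 mulrCA ler_wpM2l// ler_wpM2l.
have h4 : (t - s) * (2 * (C * h)) <= (t - s) * eta by rewrite ler_wpM2l.
lra.
Qed.

(** The interval is cut into n equal pieces with n just above 2 C / eta, so that the short-interval
    bound applies to each. As eta <= 1, n is at most (2 C + 2) / eta, and every piece costs 8 eps /
    eta. *)
Lemma sublevel_unit_interval (f g : R -> R[i]) (C eps eta x : R) :
  0 < eta <= 1 -> 0 <= eps -> 0 <= C ->
  (forall t s, cabs (f (t + s) - f t - s%:C * g t) <= C * s ^+ 2) ->
  (forall t s, cabs (g (t + s) - g t) <= C * `|s|) ->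
  (forall e, measurable ([set t | cabs (f t) <= e] : set (measurableTypeR R))) ->
  (forall e, measurable ([set t | cabs (g t) <= e] : set (measurableTypeR R))) ->
  (mu ([set t | (cabs (f t) <= eps)%R] `&` `[x, (x + 1)%R[)
   <= mu ([set t | (cabs (g t) <= 2 * eta)%R] `&` `[x, (x + 1)%R[)
      + ((2 * C + 2) * 8 * eps / eta ^+ 2)%:E)%E.
Proof.
move=> /andP[eta0 eta1] eps0 C0 fH gH mf mg.
pose n := (Num.truncn (2 * C / eta)).+1.
have n1 : 2 * C / eta < n%:R.
  by rewrite /n; apply: truncnS_gt.
have nle : n%:R <= (2 * C + 2) / eta.
  have h1 : n%:R <= 2 * C / eta + 1.
    rewrite /n -natr1 lerD2r truncn_le//.
    by rewrite divr_ge0 ?mulr_ge0// ltW.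
  apply: (le_trans h1); rewrite [leRHS]mulrDl lerD2l ler_pdivlMr//; lra.
have n0 : 0 < n%:R :> R by rewrite ltr0n.
pose h : R := n%:R^-1.
have h0 : 0 <= h by rewrite invr_ge0 ltW.
have Ch : 2 * (C * h) <= eta.
  by rewrite mulrA /h ler_pdivrMr// [eta * _]mulrC -ler_pdivrMr//; exact: ltW.
have nh : x + 1 = x + n%:R * h by rewrite /h divff// gt_eqF.
rewrite nh; apply: le_trans (@measure_subdivision R
  [set t | (cabs (f t) <= eps)%R] [set t | (cabs (g t) <= 2 * eta)%R]
   x h (8 * eps / eta) n _ _ h0 _ _) _ => //.
- by rewrite divr_ge0 ?mulr_ge0// ltW.
- move=> i _.
  have -> : x + i.+1%:R * h = x + i%:R * h + h by rewrite -natr1; ring.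
  exact: (@sublevel_short_interval f g C).
- apply: leeD => //; rewrite lee_fin.
  have -> : (2 * C + 2) * 8 * eps / eta ^+ 2 = (2 * C + 2) / eta * (8 * eps / eta).
    by rewrite expr2 invfM; ring.
  by rewrite ler_wpM2r// divr_ge0 ?mulr_ge0// ltW.
Qed.

(** Induction on the number of terms: once one frequency is moved to 0, the derivative has one term
    fewer, and its coefficients stay nonzero because the frequencies are distinct. A sum can be
    small only where its derivative is small or on short stretches. *)
Lemma exp_sum_sublevel l : l != [::] -> uniq [seq e.2 | e <- l] ->
  (forall e, e \in l -> e.1 != 0) ->
  exists (C : R) (p : nat), [/\ 0 <= C, (0 < p)%N &
    forall eta x, 0 < eta <= 1 ->
      (mu ([set t | (cabs (exp_sum l t) <= eta ^+ p)%R] `&` `[x, (x + 1)%R[)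
        <= (C * eta)%:E)%E].
Proof.
have [n] := ubnP (size l); elim: n l => // n IH [//|[b k] l] sl _ /= /andP[kl ul] l0.
have b0 : b != 0 by apply: (l0 (b, k)); rewrite inE eqxx.
have [l_nil|l_nil] := eqVneq l [::].
  (* A single term has constant modulus |b|: the sublevel set is empty if eta < |b|, and otherwise
     eta / |b| is at least the length 1. *)
  exists (cabs b)^-1, 1%N; split => //; first by rewrite invr_ge0 cabs_ge0.
  move=> eta x /andP[eta0 eta1].
  have fE t : cabs (exp_sum [:: (b, k)] t) = cabs b.
    by rewrite /exp_sum big_seq1 cabsM cabs_cis mulr1.
  have bp : 0 < cabs b by rewrite cabs_gt0.
  rewrite l_nil expr1; have [be|be] := leP (cabs b) eta.
    apply: (@le_trans _ _ (mu `[x, (x + 1)%R[)).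
      by apply: measureIr => //; apply: measurable_sublevel; exact: continuous_cabs_exp_sum.
    by rewrite mu_co// lee_fin ler_pdivlMl// mulr1.
  rewrite (_ : _ `&` _ = set0) ?measure0 ?lee_fin ?mulr_ge0 ?invr_ge0 ?cabs_ge0 ?(ltW eta0)//.
  apply/seteqP; split => t //= [h _]; by move: h; rewrite fE leNgt be.
pose m := modulate ((b, k) :: l) k; pose l1 := deriv_terms (modulate l k).
have gE t : exp_sum (deriv_terms m) t = exp_sum l1 t.
  by rewrite /exp_sum /m /= big_cons /= subrr !mulr0 mul0r add0r.
have [||||C [p [C0 p0 H]]] := IH l1.
- by rewrite !size_map.
- by rewrite -size_eq0 !size_map size_eq0.
- rewrite -!map_comp (eq_map (_ : _ =1 (fun y => y - k) \o snd)) //.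
  by rewrite map_comp map_inj_uniq//; exact: addIr.
- move=> _ /mapP[_ /mapP[e el ->] ->] /=.
  rewrite !mulf_eq0 negb_or (l0 e) ?inE ?el ?orbT//= negb_or.
  apply/andP; split; first by rewrite eq_complex/= oner_eq0 andbF.
  rewrite (_ : (_ == 0) = (e.2 - k == 0)); last first.
    by apply/eqP/eqP => [[]|->].
  by rewrite subr_eq0; apply: contraNneq kl => <-; exact: map_f.
pose M := curvature m; have M0 : 0 <= M := curvature_ge0 m.
(* The derivative is compared with eta^p and the sum itself with eta^(2p+1): then eta^(2p+1) /
   (eta^p / 2)^2 = 4 eta, and the factor 8 of the unit-interval bound makes 32. *)
exists (C + (2 * M + 2) * 32), (2 * p + 1)%N; split.
- by rewrite addr_ge0// mulr_ge0// addr_ge0// mulr_ge0.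
- by rewrite addn1.
move=> eta x /andP[eta0 eta1].
have ep0 : 0 < eta ^+ p by rewrite exprn_gt0.
have ep1 : eta ^+ p <= 1 by rewrite exprn_ile1// ltW.
have -> : [set t | (cabs (exp_sum ((b, k) :: l) t) <= eta ^+ (2 * p + 1))%R] =
    [set t | (cabs (exp_sum m t) <= eta ^+ (2 * p + 1))%R].
  by apply/seteqP; split => t /=; rewrite cabs_modulate.
apply: le_trans (@sublevel_unit_interval (exp_sum m) (exp_sum (deriv_terms m)) M
  (eta ^+ (2 * p + 1)) (eta ^+ p / 2) x _ _ M0 _ _ _ _) _.
- by rewrite divr_gt0//=; lra.
- by rewrite exprn_ge0// ltW.
- by move=> t s; exact: exp_sum_taylor.
- by move=> t s; exact: deriv_terms_lip.
- move=> e; apply: measurable_sublevel; exact: continuous_cabs_exp_sum.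
- move=> e; apply: measurable_sublevel; exact: continuous_cabs_exp_sum.
rewrite [(C + _) * eta]mulrDl EFinD; apply: leeD.
  rewrite mulrCA divff// mulr1.
  have -> : [set t | (cabs (exp_sum (deriv_terms m) t) <= eta ^+ p)%R] =
    [set t | (cabs (exp_sum l1 t) <= eta ^+ p)%R].
    by apply/seteqP; split => t /=; rewrite gE.
  by apply: H; rewrite eta0.
rewrite lee_fin exprD expr1 mulnC exprM.
have -> : (2 * M + 2) * 8 * ((eta ^+ p) ^+ 2 * eta) / (eta ^+ p / 2) ^+ 2 =
  (2 * M + 2) * 32 * eta; last by [].
by field; rewrite gt_eqF.
Qed.

End SublevelEstimate.

(** * Integrals of the logarithm near its singularities *)

Section LogIntegrability.
Context {R : realType}.
Implicit Types (t x y eps eta : R).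
Local Notation mu := (@lebesgue_measure R).

Lemma mu_symmetric_le (A : set (measurableTypeR R)) (c T : R) : measurable A ->
  1 <= T -> 0 <= c -> (forall x, (mu (A `&` `[x, (x + 1)%R[) <= c%:E)%E) ->
  (mu (A `&` `[(- T)%R, T]) <= (4 * T * c)%:E)%E.
Proof.
move=> mA T1 c0 H; pose n := (Num.truncn (2 * T)).+1.
have n1 : 2 * T < n%:R by apply: truncnS_gt.
have nle : n%:R <= 4 * T.
  have : n%:R <= 2 * T + 1 by rewrite /n -natr1 lerD2r truncn_le//; lra.
  by move=> h; lra.
apply: (@le_trans _ _ (mu (A `&` `[(- T)%R, (- T + n%:R * 1)%R[))).
  apply: le_measure; rewrite ?inE; try exact: measurableI.
  apply: setIS => t /=; rewrite !in_itv/= => /andP[-> tT] /=; lra.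
apply: le_trans (@measure_subdivision R A set0 (- T) 1 c n mA measurable0 ler01 c0 _) _.
  move=> i _; rewrite set0I measure0 add0e.
  by have -> : - T + i.+1%:R * 1 = - T + i%:R * 1 + 1 by rewrite -natr1; ring.
by rewrite set0I measure0 add0e lee_fin ler_wpM2r.
Qed.

Variables (F : R -> R) (C : R) (p : nat).
Hypotheses (F_cont : continuous F) (F_ge0 : forall t, 0 <= F t).
Hypotheses (C_ge0 : 0 <= C) (p_gt0 : (0 < p)%N).
Hypothesis F_sublevel : forall eta x, 0 < eta <= 1 ->
  (mu ([set t | (F t <= eta ^+ p)%R] `&` `[x, (x + 1)%R[) <= (C * eta)%:E)%E.

(** On unit intervals the set where F <= thr j has measure at most C 2^(-j), while - ln (thr j) = j
    kappa grows only linearly. *)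
Let thr j : R := (2^-1 ^+ j) ^+ p.

Let kappa : R := p%:R * ln 2.

Let ln2_gt0 : 0 < ln 2 :> R. Proof. by rewrite ln_gt0// ltr1n. Qed.

Let kappa_ge : ln 2 <= kappa.
Proof. by rewrite /kappa ler_peMl ?(ltW ln2_gt0)// ler1n. Qed.

Let thr_gt0 j : 0 < thr j. Proof. by rewrite !exprn_gt0// invr_gt0. Qed.

Let ln_thr j : ln (thr j) = - (j%:R * kappa).
Proof.
have e n : ln (2^-1 ^+ n) = n%:R * ln 2^-1 :> R by rewrite lnXn ?invr_gt0// mulr_natl.
by rewrite /thr -exprM e lnV ?posrE// natrM /kappa; ring.
Qed.

(** A geometric majorant of (j + 2) kappa with ratio below 2: against measures of order 2^(-j) it
    leaves a series of ratio 3/4. *)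
Let weight j : R := 2 * kappa * (3 / 2) ^+ j.

Let weight_ge j : (j%:R + 2) * kappa <= weight j.
Proof.
rewrite /weight mulrAC ler_wpM2r//; first by have := ln2_gt0; have := kappa_ge; lra.
elim: j => [|j IH]; first by rewrite expr0; lra.
rewrite exprS -natr1; have : 0 <= j%:R :> R by []; nra.
Qed.

Let weight_ge0 j : 0 <= weight j.
Proof.
rewrite /weight mulr_ge0 ?exprn_ge0 ?mulr_ge0//.
by have := ln2_gt0; have := kappa_ge; lra.
Qed.

(** Where F > thr J, the difference is (1/2) ln (1 + eps / F^2) <= delta. Where 0 < F <= thr J, F
    lies between thr j.+1 and thr j for some j >= J, and both logarithms are O(j kappa). *)
Lemma log_reg_dist_pointwise eps delta J t : 0 < eps -> eps <= 1 -> 0 <= delta ->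
  eps <= delta * thr J ^+ 2 ->
  `|2^-1 * ln (F t ^+ 2 + eps) - ln (F t)| <= delta \/
  exists j, [/\ (J <= j)%N, F t <= thr j &
    `|2^-1 * ln (F t ^+ 2 + eps) - ln (F t)| <= weight j].
Proof.
move=> e0 e1 d0 eJ; set y := F t; have y0 : 0 <= y := F_ge0 t.
have [yJ|yJ] := ltP (thr J) y.
  left; have yp : 0 < y by exact: lt_trans yJ.
  have y2 : 0 < y ^+ 2 by rewrite exprn_gt0.
  have -> : 2^-1 * ln (y ^+ 2 + eps) - ln y = 2^-1 * ln (1 + eps / y ^+ 2).
    have -> : y ^+ 2 + eps = y ^+ 2 * (1 + eps / y ^+ 2) by field; rewrite gt_eqF.
    rewrite lnM ?posrE//; last by rewrite ltr_pwDl// divr_ge0 ?ltW.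
    by rewrite ln_sqr//; field.
  have q0 : 0 <= eps / y ^+ 2 by rewrite divr_ge0 ?ltW.
  have qd : eps / y ^+ 2 <= delta.
    rewrite ler_pdivrMr//; apply: (le_trans eJ); rewrite ler_wpM2l//.
    by rewrite lerXn2r ?nnegrE ?(ltW yJ)// ltW.
  have l0 : 0 <= ln (1 + eps / y ^+ 2) by rewrite ln_ge0// lerDl.
  have l1 : ln (1 + eps / y ^+ 2) <= eps / y ^+ 2 by apply: le_ln1Dx; lra.
  by rewrite ger0_norm ?mulr_ge0//; lra.
right; have k0 : 0 < kappa by exact: lt_le_trans kappa_ge.
(* At a zero of F the convention ln 0 = 0 leaves |ln eps| / 2, and F lies below every level, so j
   may be taken large enough. *)
have [->|yn0] := eqVneq y 0.
  rewrite expr0n/= add0r (ln0 (lexx 0)) subr0.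
  pose j := (J + Num.truncn (`|2^-1 * ln eps| / kappa)).+1.
  exists j; split; first by rewrite /j -addnS leq_addr.
    exact: ltW.
  apply: le_trans (weight_ge j).
  have : `|2^-1 * ln eps| / kappa < j%:R.
    by apply: (lt_le_trans (truncnS_gt _)); rewrite ler_nat /j ltnS leq_addl.
  by rewrite ltr_pdivrMr//; nra.
have yp : 0 < y by rewrite lt_def yn0.
have [i [Ji yi iy]] : exists i, [/\ (J <= i)%N, y <= thr i & thr i.+1 < y].
  have ex : exists i, thr i < y.
    exists (Num.truncn (- ln y / kappa)).+1; rewrite -ltr_ln ?posrE// ln_thr.
    have := truncnS_gt (- ln y / kappa); rewrite ltr_pdivrMr//.
    by lra.
  case: (ex_minnP ex) => m my mmin.
  have Jm : (J < m)%N.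
    rewrite ltnNge; apply/negP => mJ.
    have : thr J <= thr m.
      rewrite /thr lerXn2r ?nnegrE ?exprn_ge0 ?invr_ge0//.
      by rewrite ler_wiXn2l ?invr_ge0// invf_le1// ler1n.
    by move=> h; have := lt_le_trans my (le_trans yJ h); rewrite ltxx.
  case: m my mmin Jm => // m my mmin Jm; exists m; split => //.
  by rewrite leNgt; apply/negP => /mmin; rewrite ltnn.
exists i; split => //; apply: le_trans (weight_ge i).
have ly : - ln y <= i.+1%:R * kappa.
  by rewrite lerNl -ln_thr ler_ln ?posrE// ltW.
have y1 : y <= 1.
  apply: (le_trans yi); rewrite /thr -exprM exprn_ile1 ?invr_ge0//.
  by rewrite invf_le1// ler1n.
have h1 : 2 * ln y <= ln (y ^+ 2 + eps).
  by rewrite -ln_sqr// ler_ln ?posrE ?exprn_gt0 ?ltr_wpDl ?sqr_ge0//; lra.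
have h2 : ln (y ^+ 2 + eps) <= ln 2.
  rewrite ler_ln ?posrE ?ltr_wpDl ?sqr_ge0//.
  have : y ^+ 2 <= 1 by rewrite exprn_ile1.
  by lra.
rewrite ger0_norm; last by lra.
rewrite -natr1 in ly; have := kappa_ge; nra.
Qed.

Lemma measurable_log_dist eps : 0 < eps ->
  measurable_fun setT (fun t => 2^-1 * ln (F t ^+ 2 + eps) - ln (F t)).
Proof.
move=> e0; apply: measurable_funB; last first.
  apply: (measurableT_comp (@measurable_ln R)).
  exact: continuous_measurable_fun.
apply: continuous_measurable_fun => t; apply: cvgMr.
apply: (@continuous_comp _ _ _ (fun t => F t ^+ 2 + eps) (@ln R)).
  by apply: cvgD; [rewrite expr2; apply: cvgM; exact: F_cont | exact: cvg_cst].
by apply: continuous_ln; rewrite ltr_wpDl// sqr_ge0.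
Qed.

(** Level J + n contributes its weight times 4 T C 2^(-(J+n)), that is 8 kappa T C (3/4)^(J+n); the
    geometric sum is at most 4, whence the 32. *)
Lemma integral_log_dist eps delta J T : 0 < eps -> eps <= 1 -> 0 <= delta ->
  eps <= delta * thr J ^+ 2 -> 1 <= T ->
  (\int[mu]_(t in `[(- T)%R, T]) `|2^-1 * ln (F t ^+ 2 + eps) - ln (F t)|%:E
   <= (2 * T * delta + 32 * kappa * T * C * (3 / 4) ^+ J)%:E)%E.
Proof.
move=> e0 e1 d0 eJ T1.
pose A n : set (measurableTypeR R) := [set t | F t <= thr (J + n)%N].
have mA n : measurable (A n) by exact: measurable_sublevel.
have mT : measurable (`[- T, T]%classic : set (measurableTypeR R)).
  exact: measurable_itv.
pose h n t : \bar R := ((weight (J + n)%N)%:E * (\1_(A n) t)%:E)%E.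
have h0 n t : (0 <= h n t)%E.
  by rewrite /h mule_ge0// lee_fin//.
have mi n : measurable_fun (`[- T, T]%classic : set (measurableTypeR R))
    (fun t => (\1_(A n) t)%:E).
  by apply/measurable_EFinP; exact: measurable_indic.
have mh n : measurable_fun (`[- T, T]%classic : set (measurableTypeR R)) (h n).
  by apply: emeasurable_funM => //; exact: measurable_cst.
have ih n : (\int[mu]_(t in `[(- T)%R, T]) h n t <=
    (8 * kappa * T * C * (3 / 4) ^+ J * (3 / 4) ^+ n)%:E)%E.
  have i0 t : (0 <= (\1_(A n) t)%:E :> \bar R)%E by rewrite lee_fin.
  have w0 : (0 <= (weight (J + n)%N)%:E)%E by rewrite lee_fin.
  rewrite /h ge0_integralZl// integral_indic//.
  have := @mu_symmetric_le (A n) (C * 2^-1 ^+ (J + n)) T (mA n) T1.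
  rewrite mulr_ge0 ?exprn_ge0 ?invr_ge0// => /(_ isT) hm.
  have : (mu (A n `&` `[(- T)%R, T]) <= (4 * T * (C * 2^-1 ^+ (J + n)))%:E)%E.
    apply: hm => x; apply: F_sublevel; rewrite exprn_gt0 ?invr_gt0//=.
    by rewrite exprn_ile1 ?invr_ge0// invf_le1// ler1n.
  move=> /(lee_wpmul2l _) hle.
  apply: le_trans (hle (weight (J + n)%N)%:E _) _; first by rewrite lee_fin.
  rewrite -EFinM lee_fin /weight !exprD.
  have e k : (3 / 4) ^+ k = (3 / 2) ^+ k * 2^-1 ^+ k :> R.
    by rewrite -exprMn; congr (_ ^+ k); field.
  by rewrite !e le_eqVlt; apply/orP; left; apply/eqP; ring.
pose U t : \bar R := (delta%:E + \sum_(0 <= n <oo) h n t)%E.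
have s0 t : (0 <= \sum_(0 <= n <oo) h n t)%E by apply: nneseries_ge0.
have ms : measurable_fun (`[- T, T]%classic : set (measurableTypeR R))
    (fun t => \sum_(0 <= n <oo) h n t)%E.
  by apply: (@ge0_emeasurable_sum _ _ _ _ h xpredT) => [k x _ _|k _]; [exact: h0 | exact: mh].
apply: (@le_trans _ _ (\int[mu]_(t in `[(- T)%R, T]) U t)%E).
  apply: ge0_le_integral => //.
  - apply/measurable_EFinP; apply: measurableT_comp; first exact: normr_measurable.
    by apply: (measurable_funS measurableT) => //; exact: measurable_log_dist.
  - by apply: emeasurable_funD => //; exact: measurable_cst.
  move=> t _; rewrite /U.
  have [hd|[j [Jj Fj hw]]] := log_reg_dist_pointwise t e0 e1 d0 eJ.
    by apply: (@le_trans _ _ delta%:E); [rewrite lee_fin | rewrite leeDl].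
  apply: (@le_trans _ _ (h (j - J)%N t)).
    rewrite /h /A subnKC// indicE mem_set//= mule1 lee_fin//.
  apply: (@le_trans _ _ (\sum_(0 <= n < (j - J).+1) h n t)%E).
    by rewrite big_nat_recr//= leeDr// sume_ge0.
  apply: (@le_trans _ _ (\sum_(0 <= n <oo) h n t)%E).
    by apply: nneseries_lim_ge => n _ _.
  by rewrite leeDr// lee_fin.
rewrite /U ge0_integralD//.
rewrite integral_cst// integral_nneseries//.
rewrite EFinD; apply: leeD.
  apply: (@le_trans _ _ (delta%:E * mu `[(- T)%R, T])%E); first by [].
  rewrite lebesgue_measure_itv/= lte_fin ifT; last by lra.
  by rewrite -EFinD -EFinM lee_fin; lra.
apply: lime_le.
  by apply: is_cvg_nneseries => n _ _; apply: integral_ge0 => t _.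
near=> m; apply: le_trans (lee_sum _ (fun n _ => ih n)) _.
rewrite sumEFin lee_fin -mulr_sumr.
have gs : \sum_(0 <= n < m) (3 / 4) ^+ n <= 4 :> R.
  have := subrX1 (3 / 4 : R) m; rewrite big_mkord => e.
  have : 0 <= (3 / 4) ^+ m :> R by rewrite exprn_ge0.
  by lra.
have B0 : 0 <= 8 * kappa * T * C * (3 / 4) ^+ J.
  by rewrite !mulr_ge0 ?exprn_ge0//; [have := ln2_gt0; have := kappa_ge; lra | lra].
have := ler_wpM2l B0 gs; lra.
Unshelve. all: by end_near. Qed.

End LogIntegrability.

(** * Existence of the Jessen function as a limit of its regularizations *)

Section JessenFunction.
Context {R : realType}.
Implicit Types (t x y eps eta : R) (a : nat -> R[i]).
Local Notation mu := (@lebesgue_measure R).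

(** The bound e0 on eps is uniform in T >= 1. This allows the limits T -> +oo and eps -> 0 to be
    exchanged, so the unregularized mean exists as well. *)
Lemma log_time_avg (F : R -> R) (C : R) (p : nat) : continuous F ->
  (forall t, 0 <= F t) -> 0 <= C -> (0 < p)%N ->
  (forall eta x, 0 < eta <= 1 ->
    (mu ([set t | (F t <= eta ^+ p)%R] `&` `[x, (x + 1)%R[) <= (C * eta)%:E)%E) ->
  locally_integrable_sym (fun t => ln (F t)) /\
  forall eta, 0 < eta -> exists e0, 0 < e0 /\ forall eps T, 0 < eps <= e0 -> 1 <= T ->
    `|time_avg (fun t => 2^-1 * ln (F t ^+ 2 + eps)) T - time_avg (fun t => ln (F t)) T|
      <= eta.
Proof.
move=> cF F0 C0 p0 HF.
pose k : R := p%:R * ln 2.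
have k0 : 0 <= k by rewrite mulr_ge0 ?ln_ge0// ler1n.
pose D eps t : R := 2^-1 * ln (F t ^+ 2 + eps) - ln (F t).
have key eta : 0 < eta -> exists e0, 0 < e0 /\ forall eps T, 0 < eps <= e0 -> 1 <= T ->
    (\int[mu]_(t in `[(- T)%R, T]) `|D eps t|%:E <= (2 * T * eta)%:E)%E.
  move=> eta0.
  (* J is fixed first to make the small values of F negligible; the bound on eps then depends on
     J. *)
  have [J hJ] : exists J, 16 * k * C * (3 / 4) ^+ J <= eta / 2.
    have : (3 / 4) ^+ n @[n --> \oo] --> (0 : R).
      by apply: cvg_expr; rewrite ger0_norm; lra.
    pose B := 16 * k * C + 1.
    have B0 : 0 < B by rewrite ltr_wpDl// mulr_ge0// mulr_ge0.
    move=> /cvgrPdist_le /(_ (eta / 2 / B)) []; first by rewrite !divr_gt0.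
    move=> n _ /(_ n (leqnn n)) /=; rewrite sub0r normrN ger0_norm ?exprn_ge0// => h.
    exists n; apply: (@le_trans _ _ (B * (3 / 4) ^+ n)).
      by rewrite ler_wpM2r ?exprn_ge0// /B lerDl.
    by rewrite mulrC -ler_pdivlMr.
  have t0 : 0 < (2^-1 ^+ J) ^+ p :> R by rewrite !exprn_gt0// invr_gt0.
  pose e0 : R := Num.min 1 (eta / 2 * ((2^-1 ^+ J) ^+ p) ^+ 2).
  exists e0; split.
    by rewrite lt_min ltr01/= mulr_gt0 ?divr_gt0// exprn_gt0.
  move=> eps T /andP[ep]; rewrite le_min => /andP[ep1 epJ] T1.
  have d0 : 0 <= eta / 2 by rewrite divr_ge0// ltW.
  apply: (le_trans (integral_log_dist cF F0 C0 p0 HF ep ep1 d0 epJ T1)).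
  rewrite lee_fin -/k.
  have T2 : 0 <= 2 * T by lra.
  by have := ler_wpM2l T2 hJ; lra.
have lr eps : 0 < eps -> locally_integrable_sym (fun t => 2^-1 * ln (F t ^+ 2 + eps)).
  move=> e0; apply: continuous_integrable_sym => t; apply: cvgMr.
  apply: (@continuous_comp _ _ _ (fun t => F t ^+ 2 + eps) (@ln R)).
    by apply: cvgD; [rewrite expr2; apply: cvgM; exact: cF | exact: cvg_cst].
  by apply: continuous_ln; rewrite ltr_wpDl// sqr_ge0.
have li : locally_integrable_sym (fun t => ln (F t)).
  have [e0 [e00 He]] := key 1 ltr01.
  (* The estimate is for T >= 1; shorter intervals inherit integrability. *)
  move=> T; pose S : R := Num.max T 1.
  have S1 : 1 <= S by rewrite le_max lexx orbT.
  have TS : T <= S by rewrite le_max lexx.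
  apply: (@integrableS _ _ _ mu `[- S, S]%classic) => //.
    by move=> t /=; rewrite !in_itv/= => /andP[h1 h2]; apply/andP; split; lra.
  have e0e : 0 < e0 <= e0 by rewrite e00 lexx.
  have iD : mu.-integrable `[- S, S] (EFin \o D e0).
    apply/integrableP; split.
      apply/measurable_EFinP; apply: (measurable_funS measurableT) => //.
      exact: (measurable_log_dist cF e00).
    by apply: (le_lt_trans (He _ _ e0e S1)); rewrite ltry.
  have -> : EFin \o (fun t => ln (F t)) =
     ((EFin \o (fun t => (2^-1 * ln (F t ^+ 2 + e0))%R)) \- (EFin \o D e0))%E.
    by apply/funext => t; rewrite /= -EFinB /D; congr EFin; ring.
  by apply: integrableB => //; exact: lr.
split => // eta eta0; have [e0 [e00 He]] := key eta eta0.
exists e0; split => // eps T /andP[ep epe0] T1.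
have hl := lr _ ep; rewrite -time_avgB// /time_avg.
have T0 : 0 < T by lra.
rewrite normrM ger0_norm ?invr_ge0 ?mulr_ge0 ?(ltW T0)//.
rewrite mulrC ler_pdivrMr ?mulr_gt0//.
have iD : mu.-integrable `[- T, T] (EFin \o D eps).
  have -> : EFin \o D eps =
     ((EFin \o (fun t => (2^-1 * ln (F t ^+ 2 + eps))%R)) \- (EFin \o (fun t => ln (F t))))%E.
    by apply/funext => t; rewrite /= -EFinB.
  by apply: integrableB.
rewrite -lee_fin [X in (_ <= X)%E](_ : _ = (2 * T * eta)%:E); last by rewrite mulrC.
rewrite EFin_normr_Rintegral//.
have eT : 0 < eps <= e0 by rewrite ep.
apply: le_trans (He _ _ eT T1); apply: le_abse_integral => //.
by have /integrableP[] := iD.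
Qed.

Lemma vertical_sum_sublevel a N (sg : R) : a 1%N = 1 -> (0 < N)%N ->
  exists (C : R) (p : nat), [/\ 0 <= C, (0 < p)%N &
    forall eta x, 0 < eta <= 1 ->
      (mu ([set t | (cabs (char_sum a N sg (vertical_char t)) <= eta ^+ p)%R]
         `&` `[x, (x + 1)%R[) <= (C * eta)%:E)%E].
Proof.
move=> a1 N0.
(* Zero coefficients are removed as [exp_sum_sublevel] asks; n = 1 survives since a_1 = 1, so the
   list is not empty. *)
pose s := [seq n <- index_iota 1 N.+1 | a n != 0].
pose l : seq (R[i] * R) :=
  [seq (a n * (n%:R `^ (- sg))%:C, - ln n%:R) | n <- s].
have sE t : char_sum a N sg (vertical_char t) = exp_sum l t.
  rewrite /exp_sum big_map big_filter [LHS](bigID (fun n => a n != 0))/=.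
  rewrite [X in _ + X]big1 ?addr0; last by move=> n /negPn/eqP ->; rewrite !mul0r.
  apply: eq_bigr => n _ /=; congr (_ * cis _); rewrite mulrC; ring.
have s1 : 1%N \in s by rewrite mem_filter a1 oner_eq0 mem_index_iota.
have sp n : n \in s -> (0 < n)%N.
  by rewrite mem_filter mem_index_iota => /and3P[].
have [|||C [p [C0 p0 H]]] := @exp_sum_sublevel R l.
- by rewrite -size_eq0 size_map size_eq0; apply: contraTneq s1 => ->.
- rewrite -map_comp map_inj_in_uniq ?filter_uniq ?iota_uniq//.
  move=> m n /sp m0 /sp n0 /= /oppr_inj/ln_inj; rewrite !posrE !ltr0n.
  by move=> /(_ m0 n0)/eqP; rewrite eqr_nat => /eqP.
- move=> _ /mapP[n ns ->] /=; rewrite -cabs_gt0 cabsM cabs_real.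
  rewrite mulr_gt0 ?normr_gt0//.
    by rewrite cabs_gt0; move: ns; rewrite mem_filter => /andP[].
  by rewrite gt_eqF// powR_gt0// ltr0n sp.
exists C, p; split => // eta x etaP; apply: le_trans (H eta x etaP).
by rewrite le_eqVlt; apply/orP; left; apply/eqP; congr (mu (_ `&` _));
  apply/seteqP; split => t /=; rewrite sE.
Qed.

Lemma continuous_cabs_vertical a N (sg : R) :
  continuous (fun t => cabs (char_sum a N sg (vertical_char t))).
Proof.
have h : continuous (fun t => cabs (char_sum a N sg (vertical_char t)) ^+ 2).
  have := trigpoly_continuous (@unimodular_trivial_char R) (trigpoly_sqr_cabs a N sg).
  by under [X in continuous X -> _]eq_fun do rewrite mulchar1.
have -> : (fun t => cabs (char_sum a N sg (vertical_char t))) =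
   Num.sqrt \o (fun t => cabs (char_sum a N sg (vertical_char t)) ^+ 2).
  by apply/funext => t /=; rewrite sqrtr_sqr ger0_norm// cabs_ge0.
by move=> t; apply: continuous_comp; [exact: h | exact: sqrt_continuous].
Qed.

Variables (a : nat -> R[i]) (N : nat).
Hypotheses (a1 : a 1%N = 1) (N_gt0 : (0 < N)%N).

Local Notation J := (jessen (dirichlet_sum a N)).

Lemma jessenP (sg : R) :
  [/\ locally_integrable_sym (fun t => ln (cabs (char_sum a N sg (vertical_char t)))),
      has_mean (fun t => ln (cabs (char_sum a N sg (vertical_char t)))) (J sg) &
      forall eta, 0 < eta -> exists e0, 0 < e0 /\
        forall eps, 0 < eps <= e0 -> `|jessen_reg a N sg eps - J sg| <= eta].
Proof.
have [C [p [C0 p0 H]]] := vertical_sum_sublevel sg a1 N_gt0.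
have [li key] := log_time_avg (@continuous_cabs_vertical a N sg)
  (fun t => cabs_ge0 _) C0 p0 H.
set f := fun t => ln (cabs (char_sum a N sg (vertical_char t))).
have reg eps : 0 < eps -> has_mean (fun t => 2^-1 * ln
    (cabs (char_sum a N sg (vertical_char t)) ^+ 2 + eps)) (jessen_reg a N sg eps).
  move=> e0; have h := @jessen_regP R a N sg eps _ e0 (@unimodular_trivial_char R).
  by apply: eq_has_mean h => t; rewrite mulchar1.
have [m fm] : exists m, has_mean f m.
  apply: has_mean_exists => eta eta0.
  have [e0 [e00 He]] := key (eta / 2) (divr_gt0 eta0 (ltr0Sn _ 1)).
  exists (jessen_reg a N sg e0); near=> T.
  have h1 := He e0 T; rewrite e00 lexx in h1.
  have T1 : 1 <= T by near: T; apply: nbhs_pinfty_ge; exact: num_real.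
  have {}h1 := h1 isT T1.
  have h2 : `|jessen_reg a N sg e0 - time_avg (fun t => 2^-1 * ln
    (cabs (char_sum a N sg (vertical_char t)) ^+ 2 + e0)) T| <= eta / 2.
    by near: T; have /cvgrPdist_le := reg _ e00; apply; rewrite divr_gt0.
  move: h1 h2; set u := time_avg _ T; set v := time_avg _ T; set w := jessen_reg _ _ _ _.
  move=> /ler_normlP[h1 h2] /ler_normlP[h3 h4].
  by rewrite ler_norml; apply/andP; split; lra.
have JE : J sg = m.
  rewrite /jessen; apply: cvg_lim; first exact: Rhausdorff.
  apply: cvg_trans fm; apply: near_eq_cvg; near=> T.
  rewrite /time_avg; congr (_ * _); apply: eq_Rintegral => t _.
  by rewrite /f dirichlet_sumE.
split => //; first by rewrite JE.
move=> eta eta0; have [e0 [e00 He]] := key eta eta0.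
exists e0; split => // eps epse; have ep : 0 < eps by case/andP: epse.
rewrite JE.
have h : `|time_avg (fun t => 2^-1 * ln
    (cabs (char_sum a N sg (vertical_char t)) ^+ 2 + eps)) T - time_avg f T|
   @[T --> +oo] --> `|jessen_reg a N sg eps - m|.
  by apply: cvg_norm; apply: cvgB => //; exact: reg.
by apply: (cvgr_to_le h); near=> T; apply: He.
Unshelve. all: by end_near. Qed.

End JessenFunction.

(** * Mean square and the upper bound *)

Section UpperBound.
Context {R : realType}.
Implicit Types (t x y eps eta sg : R) (a : nat -> R[i]).

Lemma powR_double n sg : (0 < n)%N -> n%:R `^ (- (2 * sg)) = (n%:R `^ (- sg)) ^+ 2 :> R.
Proof.
move=> n0; rewrite expr2 -powRD; last by rewrite pnatr_eq0 -lt0n n0 implybT.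
by congr (_ `^ _); ring.
Qed.

(** Parseval: the square is expanded over pairs (n, m), and only the diagonal has a nonzero mean. *)
Lemma char_sum_sqr_mean a N sg chi : unimodular_char chi ->
  has_mean (fun t => cabs (char_sum a N sg (mulchar chi (vertical_char t))) ^+ 2)
    (energy a N sg).
Proof.
move=> uchi; pose b n : R[i] := a n * (n%:R `^ (- sg))%:C.
pose s := index_iota 1 N.+1.
apply: (@eq_has_mean _ (fun t => \sum_(e <- [seq (n, m) | n <- s, m <- s])
  Re (b e.1 * (b e.2)^* * mulchar chi (vertical_char t) e.1
      * (mulchar chi (vertical_char t) e.2)^*))).
  move=> t; set psi := mulchar _ _.
  have -> : cabs (char_sum a N sg psi) ^+ 2 =
      Re (char_sum a N sg psi * (char_sum a N sg psi)^*) by rewrite mulcJ_cabs.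
  rewrite big_allpairs_dep /char_sum mulr_suml Re_sum; apply: eq_bigr => n _.
  rewrite conjc_sum mulr_sumr Re_sum; apply: eq_bigr => m _ /=.
  rewrite -/(b n) -/(b m) [(b m * _)^*]conjcM.
  by move: (b n) (b m)^* (psi n) (psi m)^* => u v w x; congr Re; ring.
have -> : energy a N sg = \sum_(e <- [seq (n, m) | n <- s, m <- s])
    (if e.1 == e.2 then Re (b e.1 * (b e.2)^*) else 0).
  rewrite big_allpairs_dep /energy big_seq [RHS]big_seq; apply: eq_bigr => n ns /=.
  rewrite -big_mkcond/= (eq_bigl (pred1 n)) => [|m]; last by rewrite /= eq_sym.
  rewrite -big_filter filter_pred1_uniq ?iota_uniq// big_seq1 mulcJ_cabs /=.
  rewrite cabsM exprMn cabs_real real_normK ?num_real// powR_double//.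
  by move: ns; rewrite mem_index_iota => /andP[].
apply: has_mean_sum => [e|e].
  by apply: continuous_integrable_sym; exact: continuous_vertical_pair.
by move=> /allpairsP[[n m] [/=]]; rewrite !mem_index_iota => /andP[n0 _] /andP[m0 _] -> /=;
  exact: vertical_pair_mean.
Qed.

Lemma energy_ge1 a N sg : a 1%N = 1 -> (0 < N)%N -> 1 <= energy a N sg.
Proof.
move=> a1 N0; rewrite /energy big_ltn// a1 cabs1 expr1n powR1 mulr1 lerDl.
by apply: sumr_ge0 => n _; rewrite mulr_ge0 ?sqr_ge0 ?powR_ge0.
Qed.

Lemma ln_tangent (x c : R) : 0 < x -> 0 < c -> ln x <= ln c + (x - c) / c.
Proof.
move=> x0 c0; have -> : x = c * (1 + (x - c) / c) by field; rewrite gt_eqF.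
have h : 0 < 1 + (x - c) / c.
  by have -> : 1 + (x - c) / c = x / c; [field; rewrite gt_eqF | rewrite divr_gt0].
rewrite lnM ?posrE// lerD2l.
have -> : (c * (1 + (x - c) / c) - c) / c = (x - c) / c by field; rewrite gt_eqF.
by apply: le_ln1Dx; lra.
Qed.

(** Jensen's inequality through the tangent of ln at c = E_N + eps: the majorant is affine in |P|^2,
    so its mean is known, and this choice of c cancels the linear part up to ln c. *)
Lemma jessen_reg_le_energy a N sg eps : 0 < eps -> a 1%N = 1 -> (0 < N)%N ->
  jessen_reg a N sg eps <= 2^-1 * ln (energy a N sg + eps).
Proof.
move=> e0 a1 N0; pose c := energy a N sg + eps.
have E1 := energy_ge1 sg a1 N0.
have c0 : 0 < c by rewrite /c; lra.
pose psi t := mulchar (@trivial_char R) (vertical_char t).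
have u1 := @unimodular_trivial_char R.
have c2 : continuous (fun t => cabs (char_sum a N sg (psi t)) ^+ 2).
  exact: (trigpoly_continuous u1 (trigpoly_sqr_cabs a N sg)).
have h2 : has_mean (fun t => (2^-1 * ln c - 2^-1 * (energy a N sg / c)) +
   (2 * c)^-1 * cabs (char_sum a N sg (psi t)) ^+ 2)
   ((2^-1 * ln c - 2^-1 * (energy a N sg / c)) + (2 * c)^-1 * energy a N sg).
  apply: has_meanD.
  - exact: locally_integrable_sym_cst.
  - by apply: continuous_integrable_sym => t; apply: cvgMr; exact: c2.
  - exact: has_mean_cst.
  - apply: has_meanZ; first exact: continuous_integrable_sym.
    exact: char_sum_sqr_mean.
have -> : 2^-1 * ln c = (2^-1 * ln c - 2^-1 * (energy a N sg / c)) + (2 * c)^-1 * energy a N sg.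
  by field; rewrite gt_eqF.
apply: (has_mean_le _ _ _ (@jessen_regP R a N sg eps _ e0 u1) h2).
- exact: integrable_log_reg.
- by apply: continuous_integrable_sym => t; apply: cvgD; [exact: cvg_cst | apply: cvgMr; exact: c2].
move=> t; rewrite /log_reg -/(psi t); set x := cabs _ ^+ 2.
have x0 : 0 <= x by exact: sqr_ge0.
have := @ln_tangent (x + eps) c _ c0; rewrite ltr_wpDl// => /(_ isT) h.
have -> : 2^-1 * ln c - 2^-1 * (energy a N sg / c) + (2 * c)^-1 * x =
  2^-1 * (ln c + (x + eps - c) / c) by rewrite /c; field; rewrite -/c gt_eqF.
by rewrite ler_wpM2l.
Qed.

Lemma jessen_le_energy a N sg : a 1%N = 1 -> (0 < N)%N ->
  jessen (dirichlet_sum a N) sg <= 2^-1 * ln (energy a N sg).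
Proof.
move=> a1 N0; apply/ler_addgt0Pr => e e0.
have [_ _ H] := jessenP a1 N0 sg.
have [e1 [e10 He1]] := H (e / 2) (divr_gt0 e0 (ltr0Sn _ 1)).
have E1 := energy_ge1 sg a1 N0.
pose d := Num.min e1 e; have d0 : 0 < d by rewrite lt_min e10.
have := He1 d; rewrite d0 ge_min lexx => /(_ isT)/ler_normlP[h1 _].
have := jessen_reg_le_energy sg d0 a1 N0.
have : ln (energy a N sg + d) <=
  ln (energy a N sg) + (energy a N sg + d - energy a N sg) / energy a N sg.
  by apply: ln_tangent; lra.
rewrite addrAC subrr add0r.
have : d / energy a N sg <= e.
  rewrite ler_pdivrMr; last by lra.
  have : d <= e by rewrite ge_min lexx orbT.
  by nra.
lra.
Qed.

End UpperBound.

(** * A four-point inequality for the regularized logarithm *)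

Section FourPoint.
Context {R : realType}.
Implicit Types (z w p q r : R[i]) (h eps B : R).

(* Cauchy-Schwarz, with equality at z = p. *)
Lemma log_reg_ge_linear eps p z : 0 < eps -> z * p^* + eps%:C != 0 ->
  ln (cabs (z * p^* + eps%:C)) - 2^-1 * ln (cabs p ^+ 2 + eps) <= log_reg eps z.
Proof.
move=> e0 n0; have c0 : 0 < cabs (z * p^* + eps%:C) by rewrite cabs_gt0.
have p0 : 0 < cabs p ^+ 2 + eps by rewrite ltr_wpDl// sqr_ge0.
have z0 : 0 < cabs z ^+ 2 + eps by rewrite ltr_wpDl// sqr_ge0.
have h : cabs (z * p^* + eps%:C) ^+ 2 <= (cabs z ^+ 2 + eps) * (cabs p ^+ 2 + eps).
  rewrite !sqr_cabs; case: z {c0 n0 z0} => a b; case: p {p0} => c d /=.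
  have := sqr_ge0 (a - c); have := sqr_ge0 (b - d).
  have := mulr_ge0 (ltW e0) (addr_ge0 (sqr_ge0 (a - c)) (sqr_ge0 (b - d))).
  by nra.
have : ln (cabs (z * p^* + eps%:C) ^+ 2) <= ln ((cabs z ^+ 2 + eps) * (cabs p ^+ 2 + eps)).
  by rewrite ler_ln ?posrE ?mulr_gt0 ?exprn_gt0.
rewrite ln_sqr// lnM ?posrE// /log_reg; lra.
Qed.

Lemma prod4_perturb (z1 z2 z3 z4 e1 e2 e3 e4 : R[i]) (Z e : R) : 0 <= Z -> 0 <= e -> e <= Z ->
  cabs z1 <= Z -> cabs z2 <= Z -> cabs z3 <= Z -> cabs z4 <= Z ->
  cabs e1 <= e -> cabs e2 <= e -> cabs e3 <= e -> cabs e4 <= e ->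
  cabs ((z1 + e1) * (z2 + e2) * ((z3 + e3) * (z4 + e4)) - z1 * z2 * (z3 * z4))
    <= 27 * Z ^+ 3 * e.
Proof.
move=> Z0 e0 eZ Z1 Z2 Z3 Z4 h1 h2 h3 h4.
(* Used on each pair, with result 3 Z e, and then on the product of the pairs: 3 times 3 Z^2 times 3
   Z e is 27 Z^3 e. The bound 3 Z^2 for the pairs, instead of Z^2, ensures b <= A there. *)
have two (u v f g : R[i]) (A b : R) : 0 <= A -> cabs u <= A -> cabs v <= A ->
   0 <= b -> b <= A -> cabs f <= b -> cabs g <= b ->
   cabs ((u + f) * (v + g) - u * v) <= 3 * A * b.
  move=> A0 uA vA b0 bA fb gb.
  have -> : (u + f) * (v + g) - u * v = u * g + (f * v + f * g) by ring.
  apply: le_trans (cabsD _ _) _; have := cabsD (f * v) (f * g).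
  rewrite !cabsM => h.
  have := ler_pM (cabs_ge0 u) (cabs_ge0 g) uA gb.
  have := ler_pM (cabs_ge0 f) (cabs_ge0 v) fb vA.
  have := ler_pM (cabs_ge0 f) (cabs_ge0 g) fb gb.
  have : b * b <= A * b by rewrite ler_wpM2r.
  nra.
have a1 : cabs (z1 * z2) <= 3 * Z ^+ 2.
  rewrite cabsM; have := ler_pM (cabs_ge0 _) (cabs_ge0 _) Z1 Z2.
  by have := sqr_ge0 Z; rewrite expr2; lra.
have a2 : cabs (z3 * z4) <= 3 * Z ^+ 2.
  rewrite cabsM; have := ler_pM (cabs_ge0 _) (cabs_ge0 _) Z3 Z4.
  by have := sqr_ge0 Z; rewrite expr2; lra.
have b1 := two _ _ _ _ _ _ Z0 Z1 Z2 e0 eZ h1 h2.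
have b2 := two _ _ _ _ _ _ Z0 Z3 Z4 e0 eZ h3 h4.
set f := (z1 + e1) * (z2 + e2) - z1 * z2 in b1.
set g := (z3 + e3) * (z4 + e4) - z3 * z4 in b2.
have -> : (z1 + e1) * (z2 + e2) * ((z3 + e3) * (z4 + e4)) =
   (z1 * z2 + f) * (z3 * z4 + g) by rewrite /f /g; ring.
have -> : 27 * Z ^+ 3 * e = 3 * (3 * Z ^+ 2) * (3 * Z * e) by ring.
apply: two => //.
- by rewrite mulr_ge0 ?sqr_ge0.
- by rewrite mulr_ge0// mulr_ge0.
- have : Z * e <= Z * Z by rewrite ler_wpM2l.
  by rewrite expr2; lra.
Qed.

Lemma cabs_i_mul z : cabs ('i%C * z) = cabs z.
Proof. by case: z => x y; rewrite !cabsE /= !mul0r !mul1r sub0r add0r sqrrN addrC. Qed.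

Lemma i_sqr : 'i%C * 'i%C = -1 :> R[i].
Proof. by rewrite -expr2 sqr_i. Qed.

(* The product of G over the four points s + i^k h differs from G(s)^4 by
   O(h^3), because the h^2 terms cancel. *)
Lemma four_point_log_reg eps B : 0 < eps -> 0 <= B -> exists K h0, [/\ 0 <= K, 0 < h0 &
  forall p q r e1 e2 e3 e4 h, 0 <= h <= h0 ->
    cabs p <= B -> cabs q <= B -> cabs r <= B ->
    cabs e1 <= B * h ^+ 3 -> cabs e2 <= B * h ^+ 3 ->
    cabs e3 <= B * h ^+ 3 -> cabs e4 <= B * h ^+ 3 ->
    4 * log_reg eps p - K * h ^+ 3 <=
      log_reg eps (p + h%:C * q + (h ^+ 2)%:C * r + e1) +
      log_reg eps (p - h%:C * q + (h ^+ 2)%:C * r + e2) +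
      log_reg eps (p + 'i%C * h%:C * q - (h ^+ 2)%:C * r + e3) +
      log_reg eps (p - 'i%C * h%:C * q - (h ^+ 2)%:C * r + e4)].
Proof.
move=> eps0 B0; pose Z : R := 3 * B ^+ 2 + eps.
have BB0 : 0 <= B ^+ 2 by exact: sqr_ge0.
have Z0 : 0 < Z by rewrite /Z; lra.
(* The first part comes from perturbing the four factors by at most B^2 h^3; the second is a
   generous bound, 2 + 1 + 9 <= 16, for the coefficient of h^4 in the unperturbed product. *)
pose D : R := 27 * Z ^+ 3 * B ^+ 2 + Z ^+ 4 * 16.
have D0 : 0 < D.
  have z3 : 0 <= Z ^+ 3 by rewrite exprn_ge0// ltW.
  have z4 : 0 < Z ^+ 4 by rewrite exprn_gt0.
  by rewrite ltr_wpDl ?(mulr_gt0 z4)// (mulr_ge0 (mulr_ge0 _ z3)).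
(* Makes D h^3 <= eps^4 / 2 <= X^4 / 2, so the product of the four factors stays away from 0 and its
   logarithm is controlled. *)
pose h0 : R := Num.min 1 (eps ^+ 4 / (2 * D)).
exists (2 * D / eps ^+ 4), h0; split.
- by rewrite divr_ge0 ?mulr_ge0 ?exprn_ge0// ltW.
- by rewrite lt_min ltr01 divr_gt0 ?exprn_gt0// mulr_gt0.
move=> p q r e1 e2 e3 e4 h /andP[hge0]; rewrite le_min => /andP[h1 hD] pB qB rB E1 E2 E3 E4.
have h3 : 0 <= h ^+ 3 by rewrite exprn_ge0.
have h31 : h ^+ 3 <= h by rewrite ler_iXnr.
have h21 : h ^+ 2 <= 1 by rewrite exprn_ile1.
have h43 : h ^+ 4 <= h ^+ 3 by rewrite exprSr ler_piMr.
pose X : R := cabs p ^+ 2 + eps.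
have Xe : eps <= X by rewrite /X lerDr sqr_ge0.
have X0 : 0 < X by exact: lt_le_trans Xe.
have p2 : cabs p ^+ 2 <= B ^+ 2 by rewrite lerXn2r ?nnegrE ?cabs_ge0.
have XZ : X <= Z by rewrite /X /Z; lra.
pose al := q * p^*; pose be := r * p^*.
have pq (u : R[i]) : cabs u <= B -> cabs (u * p^*) <= B ^+ 2.
  by move=> uB; rewrite cabsM cabsJ expr2 ler_pM ?cabs_ge0.
have alB := pq _ qB; have beB := pq _ rB.
pose H := h%:C : R[i]; pose XX := X%:C : R[i].
have XXE : XX = p * p^* + eps%:C by rewrite mulcJ_cabs /XX /X rmorphD.
pose z1 := XX + H * al + H ^+ 2 * be; pose z2 := XX - H * al + H ^+ 2 * be.
pose z3 := XX + 'i%C * H * al - H ^+ 2 * be; pose z4 := XX - 'i%C * H * al - H ^+ 2 * be.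
have H2 : (h ^+ 2)%:C = H ^+ 2 by rewrite rmorphXn.
have XXc : cabs XX = X by rewrite cabs_real ger0_norm// ltW.
have Hc : cabs H = h by rewrite cabs_real ger0_norm.
have Hal : cabs (H * al) <= B ^+ 2.
  by rewrite cabsM Hc; apply: le_trans alB; rewrite ler_piMl ?cabs_ge0.
have Hbe : cabs (H ^+ 2 * be) <= B ^+ 2.
  by rewrite cabsM cabsX Hc; apply: le_trans beB; rewrite ler_piMl ?cabs_ge0.
have Zb (s t : R[i]) : cabs s <= B ^+ 2 -> cabs t <= B ^+ 2 -> cabs (XX + s + t) <= Z.
  move=> sB tB; apply: le_trans (cabsD _ _) _.
  by have := cabsD XX s; rewrite XXc /Z /X; lra.
have Z1 : cabs z1 <= Z by apply: Zb.
have Z2 : cabs z2 <= Z by apply: Zb => //; rewrite cabsN.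
have Hial : cabs ('i%C * H * al) <= B ^+ 2 by rewrite -mulrA cabs_i_mul.
have Z3 : cabs z3 <= Z by apply: Zb; rewrite ?cabsN.
have Z4 : cabs z4 <= Z by apply: Zb; rewrite ?cabsN.
have Eb e : cabs e <= B * h ^+ 3 -> cabs (e * p^*) <= B ^+ 2 * h ^+ 3.
  move=> eB; rewrite cabsM cabsJ expr2 mulrAC ler_pM ?cabs_ge0//.
have ee0 : 0 <= B ^+ 2 * h ^+ 3 by rewrite mulr_ge0.
have eeZ : B ^+ 2 * h ^+ 3 <= Z.
  have : B ^+ 2 * h ^+ 3 <= B ^+ 2 by rewrite ler_piMr//; lra.
  by rewrite /Z; lra.
have pert := prod4_perturb (ltW Z0) ee0 eeZ Z1 Z2 Z3 Z4 (Eb _ E1) (Eb _ E2) (Eb _ E3) (Eb _ E4).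
set G1 := z1 + e1 * p^* in pert; set G2 := z2 + e2 * p^* in pert.
set G3 := z3 + e3 * p^* in pert; set G4 := z4 + e4 * p^* in pert.
(* z1 z2 = u + v and z3 z4 = u - v with u = XX^2 + H^4 be^2 and v = H^2 (2 XX be - al^2), so the
   product is u^2 - v^2. *)
have prodE : z1 * z2 * (z3 * z4) =
   XX ^+ 4 + H ^+ 4 * (2 * XX ^+ 2 * be ^+ 2 + H ^+ 4 * be ^+ 4 - (2 * XX * be - al ^+ 2) ^+ 2).
  have -> : z3 * z4 = (XX - H ^+ 2 * be) ^+ 2 - ('i%C * 'i%C) * (H * al) ^+ 2.
    by rewrite /z3 /z4; ring.
  by rewrite i_sqr /z1 /z2; ring.
have rest : cabs (2 * XX ^+ 2 * be ^+ 2 + H ^+ 4 * be ^+ 4 - (2 * XX * be - al ^+ 2) ^+ 2)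
   <= Z ^+ 4 * 16.
  have BZ : B ^+ 2 <= Z by rewrite /Z; lra.
  have beZ : cabs be <= Z by exact: le_trans BZ.
  have alZ : cabs al <= Z by exact: le_trans BZ.
  have ZZ0 := ltW Z0.
  have c2 : cabs (2 : R[i]) = 2.
    by rewrite (_ : 2 = (2 : R)%:C) ?cabs_real ?ger0_norm// rmorph_nat.
  have t1 : cabs (2 * XX ^+ 2 * be ^+ 2) <= 2 * Z ^+ 4.
    rewrite cabsM [cabs (2 * _)]cabsM !cabsX c2 XXc -mulrA ler_wpM2l// (_ : 4%N = (2 + 2)%N)// exprD.
    by rewrite ler_pM ?exprn_ge0 ?cabs_ge0 ?(ltW X0)// lerXn2r ?nnegrE ?cabs_ge0 ?(ltW X0).
  have t2 : cabs (H ^+ 4 * be ^+ 4) <= Z ^+ 4.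
    rewrite cabsM !cabsX Hc; apply: (@le_trans _ _ (cabs be ^+ 4)).
      by rewrite ler_piMl ?exprn_ge0 ?cabs_ge0// exprn_ile1.
    by rewrite lerXn2r ?nnegrE ?cabs_ge0.
  have t3 : cabs (2 * XX * be - al ^+ 2) <= 3 * Z ^+ 2.
    apply: le_trans (cabsB _ _) _; rewrite cabsX (cabsM _ be) (cabsM 2) c2 XXc.
    have := ler_pM (ltW X0) (cabs_ge0 be) XZ beZ.
    have : cabs al ^+ 2 <= Z ^+ 2 by rewrite lerXn2r ?nnegrE ?cabs_ge0.
    by rewrite !expr2; lra.
  have t4 : cabs ((2 * XX * be - al ^+ 2) ^+ 2) <= 9 * Z ^+ 4.
    rewrite cabsX; have -> : 9 * Z ^+ 4 = (3 * Z ^+ 2) ^+ 2 by ring.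
    by rewrite lerXn2r ?nnegrE ?cabs_ge0 ?mulr_ge0 ?exprn_ge0.
  apply: le_trans (cabsB _ _) _.
  have := cabsD (2 * XX ^+ 2 * be ^+ 2) (H ^+ 4 * be ^+ 4).
  have Z4p : 0 <= Z ^+ 4 by rewrite exprn_ge0.
  by lra.
have dist : cabs (G1 * G2 * (G3 * G4) - XX ^+ 4) <= D * h ^+ 3.
  have -> : G1 * G2 * (G3 * G4) - XX ^+ 4 = (G1 * G2 * (G3 * G4) - z1 * z2 * (z3 * z4)) +
    H ^+ 4 * (2 * XX ^+ 2 * be ^+ 2 + H ^+ 4 * be ^+ 4 - (2 * XX * be - al ^+ 2) ^+ 2).
    by rewrite prodE; ring.
  apply: le_trans (cabsD _ _) _.
  rewrite /D [leRHS]mulrDl; apply: lerD.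
    by apply: le_trans pert _; rewrite mulrA.
  rewrite cabsM cabsX Hc [leLHS]mulrC; apply: ler_pM => //; rewrite ?cabs_ge0 ?exprn_ge0//.
have Dh : D * h ^+ 3 <= eps ^+ 4 / 2.
  apply: (@le_trans _ _ (D * h)); first by rewrite ler_wpM2l// ltW.
  by move: hD; rewrite ler_pdivlMr ?mulr_gt0//; lra.
have ep4 : 0 < eps ^+ 4 by rewrite exprn_gt0.
have X4 : eps ^+ 4 <= X ^+ 4 by rewrite lerXn2r ?nnegrE ?(ltW eps0) ?(ltW X0).
have Gprod : X ^+ 4 - D * h ^+ 3 <= cabs G1 * cabs G2 * (cabs G3 * cabs G4).
  rewrite -!cabsM lerBlDr.
  have := cabsB (G1 * G2 * (G3 * G4)) (G1 * G2 * (G3 * G4) - XX ^+ 4).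
  rewrite opprB addrC subrK cabsX XXc; lra.
have Gpos : 0 < cabs G1 * cabs G2 * (cabs G3 * cabs G4).
  by apply: lt_le_trans Gprod; lra.
have [g1 g2 g3 g4] : [/\ 0 < cabs G1, 0 < cabs G2, 0 < cabs G3 & 0 < cabs G4].
  move: Gpos; rewrite !lt_def !mulr_ge0 ?cabs_ge0// !andbT !mulf_eq0 !negb_or.
  by move=> /andP[/andP[-> ->] /andP[-> ->]].
have l1 := @log_reg_ge_linear eps p (p + h%:C * q + (h ^+ 2)%:C * r + e1) eps0.
have l2 := @log_reg_ge_linear eps p (p - h%:C * q + (h ^+ 2)%:C * r + e2) eps0.
have l3 := @log_reg_ge_linear eps p (p + 'i%C * h%:C * q - (h ^+ 2)%:C * r + e3) eps0.
have l4 := @log_reg_ge_linear eps p (p - 'i%C * h%:C * q - (h ^+ 2)%:C * r + e4) eps0.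
have G1E : (p + h%:C * q + (h ^+ 2)%:C * r + e1) * p^* + eps%:C = G1.
  by rewrite /G1 /z1 XXE /al /be H2 -/H; ring.
have G2E : (p - h%:C * q + (h ^+ 2)%:C * r + e2) * p^* + eps%:C = G2.
  by rewrite /G2 /z2 XXE /al /be H2 -/H; ring.
have G3E : (p + 'i%C * h%:C * q - (h ^+ 2)%:C * r + e3) * p^* + eps%:C = G3.
  by rewrite /G3 /z3 XXE /al /be H2 -/H; ring.
have G4E : (p - 'i%C * h%:C * q - (h ^+ 2)%:C * r + e4) * p^* + eps%:C = G4.
  by rewrite /G4 /z4 XXE /al /be H2 -/H; ring.
rewrite G1E -cabs_gt0 in l1; rewrite G2E -cabs_gt0 in l2.
rewrite G3E -cabs_gt0 in l3; rewrite G4E -cabs_gt0 in l4.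
have {}l1 := l1 g1; have {}l2 := l2 g2; have {}l3 := l3 g3; have {}l4 := l4 g4.
have lsum : ln (cabs G1) + ln (cabs G2) + (ln (cabs G3) + ln (cabs G4)) =
   ln (cabs G1 * cabs G2 * (cabs G3 * cabs G4)).
  by rewrite -!lnM ?posrE ?mulr_gt0.
have XDpos : 0 < X ^+ 4 - D * h ^+ 3 by lra.
have lnG : ln (X ^+ 4 - D * h ^+ 3) <= ln (cabs G1 * cabs G2 * (cabs G3 * cabs G4)).
  by rewrite ler_ln ?posrE.
have lnX4 : ln (X ^+ 4) = 4 * ln X.
  by rewrite (_ : 4%N = (2 * 2)%N)// exprM !ln_sqr ?exprn_gt0//; ring.
have X40 : 0 < X ^+ 4 by rewrite exprn_gt0.
have tang := ln_tangent X40 XDpos.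
have bound : (X ^+ 4 - (X ^+ 4 - D * h ^+ 3)) / (X ^+ 4 - D * h ^+ 3) <= 2 * D / eps ^+ 4 * h ^+ 3.
  have -> : X ^+ 4 - (X ^+ 4 - D * h ^+ 3) = D * h ^+ 3 by ring.
  have -> : 2 * D / eps ^+ 4 * h ^+ 3 = D * h ^+ 3 / (eps ^+ 4 / 2).
    by field; rewrite gt_eqF.
  rewrite ler_wpM2l ?mulr_ge0 ?(ltW D0)// lef_pV2 ?posrE//; lra.
have -> : log_reg eps p = 2^-1 * ln X by [].
rewrite lnX4 in tang; rewrite -/X in l1 l2 l3 l4.
lra.
Qed.

End FourPoint.

(** * Convexity of the Jessen function *)

Section Convexity.
Context {R : realType}.
Implicit Types (g : R -> R) (x y z h eps sg : R) (a : nat -> R[i]).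

Definition convex_on_line g := forall x y l : R, 0 <= l <= 1 ->
  g (l * x + (1 - l) * y) <= l * g x + (1 - l) * g y.

(* Otherwise, g minus its chord plus a small parabola would have an interior
   maximum. *)
Lemma convex_of_second_difference g : continuous g ->
  (forall B : R, exists K h0, [/\ 0 <= K, 0 < h0 & forall x h, `|x| <= B -> 0 <= h <= h0 ->
     2 * g x - K * h ^+ 3 <= g (x + h) + g (x - h)]) ->
  convex_on_line g.
Proof.
move=> cg Hg.
have main x y z : x < y -> x < z < y -> g z <= g x + (g y - g x) / (y - x) * (z - x).
  move=> xy /andP[xz zy]; rewrite leNgt; apply/negP => zL.
  pose s := (g y - g x) / (y - x).
  have sE : s * (y - x) = g y - g x by rewrite /s divfK// gt_eqF// subr_gt0.
  (* The parabola takes away half of the excess of g over its chord at z, so f z > 0 while f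
     vanishes at x and y: the maximum is interior. *)
  pose d := (g z - (g x + s * (z - x))) / (2 * ((z - x) * (y - z))).
  have zxy : 0 < (z - x) * (y - z) by rewrite mulr_gt0 ?subr_gt0.
  have d0 : 0 < d by rewrite divr_gt0 ?subr_gt0// mulr_gt0.
  have dE : d * (2 * ((z - x) * (y - z))) = g z - (g x + s * (z - x)).
    by rewrite /d divfK// gt_eqF// mulr_gt0.
  pose f u := g u + (- (g x + s * (u - x)) + d * ((u - x) * (u - y))).
  have cf : continuous f.
    move=> u; apply: cvgD; first exact: cg.
    apply: cvgD.
      apply: cvgN; apply: cvgD; first exact: cvg_cst.
      by apply: cvgMr; apply: cvgB; [exact: cvg_id | exact: cvg_cst].
    by apply: cvgMr; apply: cvgM; apply: cvgB; (exact: cvg_id || exact: cvg_cst).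
  have [c cI cmax] := EVT_max (ltW xy) (continuous_subspaceT cf).
  move: cI; rewrite in_itv/= => /andP[xc cy].
  have fz : 0 < f z.
    have : f z = (g z - (g x + s * (z - x))) - d * ((z - x) * (y - z)) by rewrite /f; ring.
    by move=> ->; rewrite -/s in zL; lra.
  have fc : 0 < f c by apply: lt_le_trans (cmax z _); rewrite ?in_itv/= ?(ltW xz) ?(ltW zy).
  have fx : f x = 0 by rewrite /f; ring.
  have fy : f y = 0 by rewrite /f sE; ring.
  have {}xc : x < c by rewrite lt_neqAle xc andbT; apply: contraTneq fc => <-; rewrite fx ltxx.
  have {}cy : c < y by rewrite lt_neqAle cy andbT; apply: contraTneq fc => ->; rewrite fy ltxx.
  have [K [h0 [K0 h00 HK]]] := Hg (`|x| + `|y|).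
  pose h := Num.min (Num.min h0 (d / (K + 1))) (Num.min (c - x) (y - c)).
  have K1 : 0 < K + 1 by lra.
  have hpos : 0 < h by rewrite !lt_min h00 !subr_gt0 xc cy divr_gt0.
  have : h <= h by [].
  rewrite {2}/h !le_min => /andP[/andP[hh0 hd] /andP[hx hy]].
  have cB : `|c| <= `|x| + `|y|.
    have := ler_norm y; have := ler_norm (- x); rewrite normrN.
    have := normr_ge0 x; have := normr_ge0 y.
    by rewrite ler_norml => *; apply/andP; split; lra.
  have h0h : 0 <= h <= h0 by rewrite hh0 ltW.
  have := HK c h cB h0h.
  have m1 : f (c + h) <= f c by apply: cmax; rewrite in_itv/=; apply/andP; split; lra.
  have m2 : f (c - h) <= f c by apply: cmax; rewrite in_itv/=; apply/andP; split; lra.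
  (* Maximality makes this nonpositive, whereas the hypothesis on g bounds it below by 2 d h^2 - K
     h^3 >= d h^2 > 0. *)
  have e : f (c + h) + f (c - h) - 2 * f c =
      g (c + h) + g (c - h) - 2 * g c + 2 * d * h ^+ 2 by rewrite /f; ring.
  have Kh : K * h <= d.
    by move: hd; rewrite ler_pdivlMr//; nra.
  have h2 : 0 < h ^+ 2 by rewrite exprn_gt0.
  have : K * h ^+ 3 <= d * h ^+ 2 by rewrite exprS mulrA ler_wpM2r// ltW.
  have := mulr_gt0 d0 h2; lra.
move=> x y l /andP[l0 l1].
have [->|l0'] := eqVneq l 0; first by rewrite !mul0r subr0 !mul1r !add0r.
have [->|l1'] := eqVneq l 1; first by rewrite subrr !mul0r !mul1r !addr0.
have {}l0 : 0 < l by rewrite lt_def l0'.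
have {}l1 : l < 1 by rewrite lt_neqAle l1'.
have [xy|yx|->] := ltgtP x y; last by rewrite -!mulrDl subrKC !mul1r.
- have := main x y (l * x + (1 - l) * y) xy.
  have n0 : y - x != 0 by rewrite gt_eqF// subr_gt0.
  have -> : g x + (g y - g x) / (y - x) * (l * x + (1 - l) * y - x) = l * g x + (1 - l) * g y.
    by field.
  by apply; apply/andP; split; nra.
- have := main y x (l * x + (1 - l) * y) yx.
  have n0 : x - y != 0 by rewrite gt_eqF// subr_gt0.
  have -> : g y + (g x - g y) / (x - y) * (l * x + (1 - l) * y - y) = l * g x + (1 - l) * g y.
    by field.
  by apply; apply/andP; split; nra.
Qed.

(** The gradient has norm |z| / (|z|^2 + eps) <= S / eps; the tangent inequality for ln gives the
    bound without differentiating. *)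
Lemma log_reg_lip eps (z w : R[i]) (S : R) : 0 < eps -> cabs z <= S -> cabs w <= S ->
  `|log_reg eps z - log_reg eps w| <= S / eps * cabs (z - w).
Proof.
have half (u v : R[i]) : 0 < eps -> cabs u <= S -> cabs v <= S ->
    log_reg eps u - log_reg eps v <= S / eps * cabs (u - v).
  move=> e0 uS vS.
  have u2 := sqr_ge0 (cabs u); have v2 := sqr_ge0 (cabs v).
  have u0 := cabs_ge0 u; have v0 := cabs_ge0 v.
  have := @ln_tangent R (cabs u ^+ 2 + eps) (cabs v ^+ 2 + eps).
  rewrite !ltr_wpDl// => /(_ isT isT) h.
  have h2 : (cabs u ^+ 2 + eps - (cabs v ^+ 2 + eps)) / (cabs v ^+ 2 + eps) <=
      2 * (S / eps * cabs (u - v)).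
    rewrite ler_pdivrMr ?ltr_wpDl//.
    have d := cabs_dist u v; have d0 := cabs_ge0 (u - v).
    have : 2 * (S / eps * cabs (u - v)) * eps = 2 * S * cabs (u - v).
      by field; rewrite gt_eqF.
    have S0 : 0 <= S by exact: le_trans uS.
    have : 0 <= 2 * (S / eps * cabs (u - v)) * cabs v ^+ 2.
      by rewrite mulr_ge0// mulr_ge0// mulr_ge0// divr_ge0// ltW.
    have : cabs u ^+ 2 + eps - (cabs v ^+ 2 + eps) = (cabs u + cabs v) * (cabs u - cabs v).
      by ring.
    have := ler_norm (cabs u - cabs v).
    have := ler_wpM2r d0 (lerD uS vS).
    have : (cabs u + cabs v) * (cabs u - cabs v) <= (cabs u + cabs v) * cabs (u - v).
      rewrite ler_wpM2l ?addr_ge0//; exact: le_trans (ler_norm _) d.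
    by rewrite mulrDr; lra.
  by rewrite /log_reg; lra.
move=> e0 zS wS; rewrite ler_norml; apply/andP; split; last exact: half.
by rewrite lerNl opprB cabsBC; exact: half.
Qed.

Lemma powR_expR n sg : (0 < n)%N -> n%:R `^ sg = expR (sg * ln n%:R) :> R.
Proof. by move=> n0; rewrite /powR gt_eqF// ltr0n. Qed.

Lemma continuous_powR_exponent n : (0 < n)%N -> continuous (fun sg : R => n%:R `^ (- sg)).
Proof.
move=> n0 sg; under eq_fun do rewrite powR_expR//.
apply: continuous_comp; last exact: continuous_expR.
by apply: cvgMl; apply: cvgN; exact: cvg_id.
Qed.

Lemma continuous_sum_nat (m n : nat) (f : nat -> R -> R) :
  (forall i, (m <= i < n)%N -> continuous (f i)) ->
  continuous (fun t => \sum_(m <= i < n) f i t).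
Proof.
move=> cf; under eq_fun do rewrite big_nat_cond big_mkcond/=.
apply: continuous_sum => i.
by case: (boolP (m <= i < n)%N) => [/cf//|_] /= t; exact: cvg_cst.
Qed.

Lemma continuous_jessen_reg a N eps : 0 < eps ->
  continuous (fun sg => jessen_reg a N sg eps).
Proof.
move=> e0 sg; pose D sg' := \sum_(1 <= n < N.+1) cabs (a n) *
   `|n%:R `^ (- sg) - n%:R `^ (- sg')|.
pose Phi sg' := (abs_sum a N sg + abs_sum a N sg') / eps * D sg'.
have S0 s : 0 <= abs_sum a N s.
  by apply: sumr_ge0 => n _; rewrite mulr_ge0 ?cabs_ge0 ?powR_ge0.
have bound sg' : `|jessen_reg a N sg eps - jessen_reg a N sg' eps| <= Phi sg'.
  have u1 := @unimodular_trivial_char R.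
  apply: (has_mean_dist _ _ _ (@jessen_regP R a N sg eps _ e0 u1)
    (@jessen_regP R a N sg' eps _ e0 u1)); try exact: integrable_log_reg.
  move=> t; have ut := unimodular_mulchar u1 (unimodular_vertical_char t).
  set chi := mulchar _ _ in ut *.
  have b1 : cabs (char_sum a N sg chi) <= abs_sum a N sg + abs_sum a N sg'.
    by apply: le_trans (char_sum_le _ _ _ ut) _; rewrite lerDl.
  have b2 : cabs (char_sum a N sg' chi) <= abs_sum a N sg + abs_sum a N sg'.
    by apply: le_trans (char_sum_le _ _ _ ut) _; rewrite lerDr.
  apply: le_trans (log_reg_lip e0 b1 b2) _; rewrite ler_wpM2l//.
    by rewrite divr_ge0 ?addr_ge0// ltW.
  rewrite /char_sum -sumrB; apply: le_trans (cabs_sum _ _ _) _.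
  rewrite big_nat [leRHS]big_nat; apply: ler_sum => n /andP[n0 _].
  have -> : a n * (n%:R `^ (- sg))%:C * chi n - a n * (n%:R `^ (- sg'))%:C * chi n =
    a n * (n%:R `^ (- sg) - n%:R `^ (- sg'))%:C * chi n by rewrite rmorphB/=; ring.
  by rewrite (cabsM _ (chi n)) (ut.1 n n0) mulr1 cabsM cabs_real.
have cPhi : Phi sg' @[sg' --> sg] --> Phi sg.
  apply: cvgM; first (apply: cvgMl; apply: cvgD; first exact: cvg_cst).
    apply: (@continuous_sum_nat _ _ (fun n s => cabs (a n) * n%:R `^ (- s))).
    move=> n /andP[n0 _] s; apply: cvgMr; exact: continuous_powR_exponent.
  apply: (@continuous_sum_nat _ _ (fun n s => cabs (a n) * `|n%:R `^ (- sg) - n%:R `^ (- s)|)).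
  move=> n /andP[n0 _] s; apply: cvgMr; apply: cvg_norm; apply: cvgB; first exact: cvg_cst.
  exact: continuous_powR_exponent.
have Phi0 : Phi sg = 0.
  by rewrite /Phi /D big1 ?mulr0// => n _; rewrite subrr normr0 mulr0.
rewrite Phi0 in cPhi; apply/cvgrPdist_le => e ep; near=> s.
apply: le_trans (bound s) _; apply: le_trans (ler_norm _) _.
rewrite -normrN -sub0r; near: s; move/cvgrPdist_le : cPhi; exact.
Unshelve. all: by end_near. Qed.

(** The shifts multiply the n-th term by exp(-h ln n), exp(h ln n), cis(-h ln n) and cis(h ln n).
    With p, q, r equal to P, P' and P''/2, second-order Taylor expansion puts the four values in the
    form required by [four_point_log_reg]. *)
Lemma four_point_char_sum a N eps (B : R) : 0 < eps ->
  exists K h0, [/\ 0 <= K, 0 < h0 & forall sg h chi, `|sg| <= B -> 0 <= h <= h0 ->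
     unimodular_char chi ->
     4 * log_reg eps (char_sum a N sg chi) - K * h ^+ 3 <=
     log_reg eps (char_sum a N (sg + h) chi) + log_reg eps (char_sum a N (sg - h) chi) +
     log_reg eps (char_sum a N sg (mulchar (vertical_char h) chi)) +
     log_reg eps (char_sum a N sg (mulchar (vertical_char (- h)) chi))].
Proof.
move=> e0.
pose l (n : nat) : R := ln n%:R.
(* One constant for p, q, r and all remainders: n^B dominates n^(-sigma), the cube dominates 1, l,
   l^2 and l^3, and n + 2 dominates the Taylor constants, n = exp(l n) for exp and 2 for cis. *)
pose A : R := \sum_(1 <= n < N.+1) cabs (a n) * n%:R `^ B * ((n%:R + 2) * (1 + l n) ^+ 3).
have ln0 n : (0 < n)%N -> 0 <= l n by move=> n0; rewrite /l ln_ge0// ler1n.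
have A0 : 0 <= A.
  rewrite /A big_nat; apply: sumr_ge0 => n /andP[n0 _].
  have := ln0 _ n0 => h.
  by rewrite mulr_ge0// ?mulr_ge0 ?cabs_ge0 ?powR_ge0 ?exprn_ge0 ?addr_ge0.
have [K [h0 [K0 h00 HK]]] := four_point_log_reg e0 A0.
exists K, (Num.min 1 h0); split => //; first by rewrite lt_min ltr01.
move=> sg h chi sgB /andP[hge0]; rewrite le_min => /andP[h1 hh0] uchi.
pose b n : R[i] := a n * (n%:R `^ (- sg))%:C * chi n.
have bn n : (0 < n)%N -> cabs (b n) <= cabs (a n) * n%:R `^ B.
  move=> n0; rewrite cabs_term ?(uchi.1 n n0)// ler_wpM2l ?cabs_ge0//.
  rewrite !powR_expR// ler_expR ler_wpM2r//; first exact: ln0.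
  by apply: le_trans sgB; rewrite -normrN ler_norm.
have sumb (c : nat -> R[i]) (k : R) : 0 <= k ->
   (forall n, (0 < n)%N -> cabs (c n) <= (n%:R + 2) * (1 + l n) ^+ 3 * k) ->
   cabs (\sum_(1 <= n < N.+1) b n * c n) <= A * k.
  move=> k0 ck; apply: le_trans (cabs_sum _ _ _) _.
  rewrite /A mulr_suml big_nat [leRHS]big_nat; apply: ler_sum => n /andP[n0 _].
  rewrite cabsM -[leRHS]mulrA; apply: ler_pM; rewrite ?cabs_ge0//; first exact: bn.
  exact: ck.
pose p := \sum_(1 <= n < N.+1) b n * 1.
pose q := \sum_(1 <= n < N.+1) b n * (- l n)%:C.
pose r := \sum_(1 <= n < N.+1) b n * (l n ^+ 2 / 2)%:C.
have weight_ge n (x : R) : (0 < n)%N -> 0 <= x -> x <= (n%:R + 2) * (1 + l n) ^+ 3 ->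
  cabs x%:C <= (n%:R + 2) * (1 + l n) ^+ 3 * 1.
  by move=> n0 x0 xn; rewrite cabs_real ger0_norm// mulr1.
have cube (x : R) : 0 <= x -> [/\ 1 <= (1 + x) ^+ 3, x <= (1 + x) ^+ 3,
   x ^+ 2 <= (1 + x) ^+ 3 & x ^+ 3 <= (1 + x) ^+ 3].
  move=> x0; have x2 := exprn_ge0 2 x0; have x3 := exprn_ge0 3 x0.
  have -> : (1 + x) ^+ 3 = 1 + 3 * x + 3 * x ^+ 2 + x ^+ 3 by ring.
  by split; lra.
have n2 n : (0 < n)%N -> 3 <= n%:R + 2 :> R.
  by move=> n0; rewrite (_ : 3 = 1 + 2)// lerD2r ler1n.
have pA : cabs p <= A.
  rewrite -[A]mulr1; apply: sumb => // n n0.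
  have [c1 _ _ _] := cube _ (ln0 _ n0).
  by rewrite cabs1 mulr1; have := n2 _ n0; nra.
have qA : cabs q <= A.
  rewrite -[A]mulr1; apply: sumb => // n n0.
  have [c1 c2 _ _] := cube _ (ln0 _ n0).
  rewrite cabs_real normrN ger0_norm ?ln0// mulr1.
  by have := n2 _ n0; have := ln0 _ n0; nra.
have rA : cabs r <= A.
  rewrite -[A]mulr1; apply: sumb => // n n0.
  have [c1 _ c3 _] := cube _ (ln0 _ n0).
  rewrite cabs_real ger0_norm ?divr_ge0 ?sqr_ge0// mulr1.
  by have := n2 _ n0; have := sqr_ge0 (l n); nra.
have h30 : 0 <= h ^+ 3 by rewrite exprn_ge0.
have hl n : (0 < n)%N -> `|h * l n| = h * l n.
  by move=> n0; rewrite ger0_norm// mulr_ge0// ln0.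
have hln n : (0 < n)%N -> `|h * l n| <= l n.
  by move=> n0; rewrite hl// ler_piMl// ln0.
have expln n : (0 < n)%N -> expR (l n) = n%:R by move=> n0; rewrite lnK// posrE ltr0n.
pose d1 n : R[i] := (expR (- (h * l n)) - 1 - (- (h * l n)) - (- (h * l n)) ^+ 2 / 2)%:C.
pose d2 n : R[i] := (expR (h * l n) - 1 - (h * l n) - (h * l n) ^+ 2 / 2)%:C.
pose d3 n : R[i] := cis (- (h * l n)) - 1 - 'i%C * (- (h * l n))%:C + ((- (h * l n)) ^+ 2 / 2)%:C.
pose d4 n : R[i] := cis (h * l n) - 1 - 'i%C * (h * l n)%:C + ((h * l n) ^+ 2 / 2)%:C.
have l3 n : (0 < n)%N -> 0 <= (l n) ^+ 3 by move=> n0; rewrite exprn_ge0 ?ln0.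
have dexp (x : R) n : (0 < n)%N -> `|x| = h * l n ->
   `|expR x - 1 - x - x ^+ 2 / 2| <= (n%:R + 2) * (1 + l n) ^+ 3 * h ^+ 3.
  move=> n0 xE; have xl : `|x| <= l n by rewrite xE -hl// hln.
  apply: le_trans (expR_taylor2 xl) _; rewrite expln// xE exprMn mulrCA mulrC.
  rewrite ler_wpM2r//; have [_ _ _ c4] := cube _ (ln0 _ n0).
  by have := n2 _ n0; have := l3 _ n0; nra.
have dcis (x : R) n : (0 < n)%N -> `|x| = h * l n ->
   cabs (cis x - 1 - 'i%C * x%:C + (x ^+ 2 / 2)%:C) <= (n%:R + 2) * (1 + l n) ^+ 3 * h ^+ 3.
  move=> n0 xE.
  apply: le_trans (cis_taylor2 _) _; rewrite xE exprMn mulrCA mulrC.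
  rewrite ler_wpM2r//; have [_ _ _ c4] := cube _ (ln0 _ n0).
  by have := n2 _ n0; have := l3 _ n0; nra.
have E1 : cabs (\sum_(1 <= n < N.+1) b n * d1 n) <= A * h ^+ 3.
  by apply: sumb => // n n0; rewrite cabs_real; apply: dexp; rewrite ?normrN ?hl.
have E2 : cabs (\sum_(1 <= n < N.+1) b n * d2 n) <= A * h ^+ 3.
  by apply: sumb => // n n0; rewrite cabs_real; apply: dexp; rewrite ?hl.
have E3 : cabs (\sum_(1 <= n < N.+1) b n * d3 n) <= A * h ^+ 3.
  by apply: sumb => // n n0; apply: dcis; rewrite ?normrN ?hl.
have E4 : cabs (\sum_(1 <= n < N.+1) b n * d4 n) <= A * h ^+ 3.
  by apply: sumb => // n n0; apply: dcis; rewrite ?hl.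
have h0h : 0 <= h <= h0 by rewrite hge0.
have := HK p q r _ _ _ _ h h0h pA qA rA E1 E2 E3 E4.
have -> : p = char_sum a N sg chi by apply: eq_bigr => n _; rewrite mulr1.
have P1 : p + h%:C * q + (h ^+ 2)%:C * r + \sum_(1 <= n < N.+1) b n * d1 n =
    char_sum a N (sg + h) chi.
  rewrite /p /q /r !mulr_sumr -!big_split/=; apply: eq_big_nat => n /andP[n0 _].
  rewrite /d1 /b !powR_expR// -/(l n) opprD [(- sg - h) * _]mulrDl expRD mulNr mulNr.
  rewrite !(rmorphB, rmorphD, rmorphN, rmorphM, rmorphXn)/=; ring.
have P2 : p - h%:C * q + (h ^+ 2)%:C * r + \sum_(1 <= n < N.+1) b n * d2 n =
    char_sum a N (sg - h) chi.
  rewrite /p /q /r !mulr_sumr -sumrN -!big_split/=; apply: eq_big_nat => n /andP[n0 _].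
  rewrite /d2 /b !powR_expR// -/(l n) opprB [(h - sg) * _]mulrDl expRD.
  rewrite !(rmorphB, rmorphD, rmorphN, rmorphM, rmorphXn)/=; ring.
have P3 : p + 'i%C * h%:C * q - (h ^+ 2)%:C * r + \sum_(1 <= n < N.+1) b n * d3 n =
    char_sum a N sg (mulchar (vertical_char h) chi).
  rewrite /p /q /r !mulr_sumr -sumrN -!big_split/=; apply: eq_big_nat => n /andP[n0 _].
  rewrite /d3 /b /mulchar /vertical_char -/(l n).
  rewrite !(rmorphB, rmorphD, rmorphN, rmorphM, rmorphXn)/=; ring.
have P4 : p - 'i%C * h%:C * q - (h ^+ 2)%:C * r + \sum_(1 <= n < N.+1) b n * d4 n =
    char_sum a N sg (mulchar (vertical_char (- h)) chi).
  rewrite /p /q /r !mulr_sumr -!sumrN -!big_split/=; apply: eq_big_nat => n /andP[n0 _].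
  rewrite /d4 /b /mulchar /vertical_char -/(l n) mulNr opprK.
  rewrite !(rmorphB, rmorphD, rmorphN, rmorphM, rmorphXn)/=; ring.
have pE : char_sum a N sg chi = p by apply: eq_bigr => n _; rewrite mulr1.
by rewrite pE P1 P2 P3 P4.
Qed.

(** The two vertical shifts are twists and keep the mean, so they cancel two of the four copies of
    the central value. *)
Lemma jessen_reg_second_difference a N eps (B : R) : 0 < eps ->
  exists K h0, [/\ 0 <= K, 0 < h0 & forall sg h, `|sg| <= B -> 0 <= h <= h0 ->
     2 * jessen_reg a N sg eps - K * h ^+ 3 <=
     jessen_reg a N (sg + h) eps + jessen_reg a N (sg - h) eps].
Proof.
move=> e0; have [K [h0 [K0 h00 HK]]] := four_point_char_sum a N B e0.
exists K, h0; split => // sg h sgB hh0.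
have u1 := @unimodular_trivial_char R.
have uh := @unimodular_vertical_char R h.
have uNh := @unimodular_vertical_char R (- h).
have m0 := @jessen_regP R a N sg eps _ e0 u1.
have m1 := @jessen_regP R a N (sg + h) eps _ e0 u1.
have m2 := @jessen_regP R a N (sg - h) eps _ e0 u1.
have m3 := @jessen_regP R a N sg eps _ e0 uh.
have m4 := @jessen_regP R a N sg eps _ e0 uNh.
have i0 := @integrable_log_reg R a N sg eps _ e0 u1.
have i1 := @integrable_log_reg R a N (sg + h) eps _ e0 u1.
have i2 := @integrable_log_reg R a N (sg - h) eps _ e0 u1.
have i3 := @integrable_log_reg R a N sg eps _ e0 uh.
have i4 := @integrable_log_reg R a N sg eps _ e0 uNh.
have i5 : locally_integrable_sym (fun t => 4 * log_reg eps
    (char_sum a N sg (mulchar (@trivial_char R) (vertical_char t)))).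
  by apply: continuous_integrable_sym => t; apply: cvgMr; exact: continuous_log_reg.
have i6 := @locally_integrable_sym_cst R (- (K * h ^+ 3)).
have ml := has_meanD i5 i6 (has_meanZ (c := 4) i0 m0) (@has_mean_cst R (- (K * h ^+ 3))).
have i12 := locally_integrable_symD i1 i2.
have i123 := locally_integrable_symD i12 i3.
have mr := has_meanD i123 i4 (has_meanD i12 i3 (has_meanD i1 i2 m1 m2) m3) m4.
have : 4 * jessen_reg a N sg eps + - (K * h ^+ 3) <=
    jessen_reg a N (sg + h) eps + jessen_reg a N (sg - h) eps +
    jessen_reg a N sg eps + jessen_reg a N sg eps.
  apply: (has_mean_le (locally_integrable_symD i5 i6) (locally_integrable_symD i123 i4) _ ml mr).
  by move=> t; rewrite !mulchar1; apply: HK => //; exact: unimodular_vertical_char.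
move: (jessen_reg a N sg eps) (jessen_reg a N (sg + h) eps)
  (jessen_reg a N (sg - h) eps) => u v w; clear; lra.
Qed.

Lemma convex_on_line_lim (gs : R -> R -> R) g :
  (forall eps, 0 < eps -> convex_on_line (gs eps)) ->
  (forall x eta, 0 < eta -> exists e0, 0 < e0 /\
     forall eps, 0 < eps <= e0 -> `|gs eps x - g x| <= eta) ->
  convex_on_line g.
Proof.
move=> cgs lg x y l l01; apply/ler_addgt0Pr => e e0.
have e4 : 0 < e / 2 by rewrite divr_gt0.
have [u [u0 hu]] := lg x _ e4; have [v [v0 hv]] := lg y _ e4.
have [w [w0 hw]] := lg (l * x + (1 - l) * y) _ e4.
pose d := Num.min u (Num.min v w).
have d0 : 0 < d by rewrite !lt_min u0 v0.
have := hu d; rewrite d0 ge_min lexx => /(_ isT)/ler_normlP[_ h1].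
have := hv d; rewrite d0 !ge_min lexx orbT => /(_ isT)/ler_normlP[_ h2].
have := hw d; rewrite d0 !ge_min lexx !orbT => /(_ isT)/ler_normlP[h3 _].
have := cgs d d0 x y l l01.
case/andP: l01 => l0 l1.
have l1' : 0 <= 1 - l by rewrite subr_ge0.
have := ler_wpM2l l0 h1; have := ler_wpM2l l1' h2; lra.
Qed.

Lemma jessen_convex a N : a 1%N = 1 -> (0 < N)%N ->
  convex_on_line (jessen (dirichlet_sum a N)).
Proof.
move=> a1 N0.
apply: (@convex_on_line_lim (fun eps sg => jessen_reg a N sg eps)).
  move=> eps e0; apply: convex_of_second_difference; first exact: continuous_jessen_reg.
  by move=> B; exact: jessen_reg_second_difference.
by move=> x eta eta0; have [_ _] := jessenP a1 N0 x; apply.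
Qed.

End Convexity.

(** * Slopes of convex functions on the line *)

Section ConvexFunctions.
Context {R : realType}.
Implicit Types (g : R -> R) (x y z : R).

Lemma convex_slopes g x y z : convex_on_line g -> x < y -> y < z ->
  (g y - g x) * (z - y) <= (g z - g y) * (y - x).
Proof.
move=> cg xy yz; have zx : 0 < z - x by lra.
have l01 : 0 <= (z - y) / (z - x) <= 1.
  by rewrite divr_ge0 ?ler_pdivrMr//=; lra.
have := cg x z _ l01.
have -> : (z - y) / (z - x) * x + (1 - (z - y) / (z - x)) * z = y.
  by field; rewrite gt_eqF.
have -> : (z - y) / (z - x) * g x + (1 - (z - y) / (z - x)) * g z =
   ((z - y) * g x + (y - x) * g z) / (z - x) by field; rewrite gt_eqF.
rewrite ler_pdivlMr//; lra.
Qed.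

(** A positive slope between x and y would persist to the right; z is taken so far out that the
    chord through x and y exceeds [K] there. *)
Lemma convex_bounded_right_le g (K : R) x0 : convex_on_line g ->
  (forall x, x0 <= x -> g x <= K) -> forall x y, x <= y -> g y <= g x.
Proof.
move=> cg gK x y; rewrite le_eqVlt => /orP[/eqP -> //|xy].
rewrite leNgt; apply/negP => gxy.
pose A := Num.max (K - g y) 0.
pose z := Num.max x0 (y + 1 + A * (y - x) / (g y - g x)).
have z0 : x0 <= z by rewrite le_max lexx.
have : y + 1 + A * (y - x) / (g y - g x) <= z by rewrite le_max lexx orbT.
have A0 : 0 <= A by rewrite le_max lexx orbT.
have AK : K - g y <= A by rewrite le_max lexx.
have d0 : 0 < g y - g x by rewrite subr_gt0.
have q0 : 0 <= A * (y - x) / (g y - g x).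
  by rewrite divr_ge0 ?mulr_ge0 ?subr_ge0 ?(ltW xy)// ltW.
move=> zy; have yz : y < z by lra.
have h : A * (y - x) <= (z - y - 1) * (g y - g x) by rewrite -ler_pdivrMr//; lra.
have := convex_slopes cg xy yz; have := gK z z0 => gz.
have : (g z - g y) * (y - x) <= A * (y - x).
  by rewrite ler_wpM2r ?subr_ge0 ?(ltW xy)//; lra.
lra.
Qed.

Lemma convex_on_line_linear g (c : R) : convex_on_line g ->
  convex_on_line (fun x => g x + c * x).
Proof. by move=> cg x y l l01; have := cg x y l l01; nra. Qed.

Lemma convex_on_line_opp g : convex_on_line g -> convex_on_line (fun x => g (- x)).
Proof.
move=> cg x y l l01; have := cg (- x) (- y) l l01.
by have -> : l * - x + (1 - l) * - y = - (l * x + (1 - l) * y) by ring.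
Qed.

(** Reduced to the previous case by adding c x and reflecting x to - x. *)
Lemma convex_bounded_left_ge g (K c : R) x0 : convex_on_line g ->
  (forall x, x <= x0 -> g x + c * x <= K) ->
  forall x y, x <= y -> - c * (y - x) <= g y - g x.
Proof.
move=> cg gK x y xy.
have h := convex_on_line_opp (convex_on_line_linear c cg).
have := @convex_bounded_right_le _ K (- x0) h _ (- y) (- x).
rewrite !opprK lerN2 xy => /(_ _ isT) h2.
have : g x + c * x <= g y + c * y by apply: h2 => u ux; apply: gK; rewrite lerNl.
lra.
Qed.

End ConvexFunctions.

(** * Behaviour of the Jessen function at both ends *)

Section Asymptotics.
Context {R : realType}.
Variables (a : nat -> R[i]) (N : nat).
Hypotheses (a1 : a 1%N = 1) (N_gt0 : (0 < N)%N).
Implicit Types (x y z sg eta : R).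

Local Notation J := (jessen (dirichlet_sum a N)).
Local Notation M := (max_index a N).
Local Notation P sg t := (char_sum a N sg (vertical_char t)).

Lemma max_index_le n : (0 < n <= N)%N -> a n != 0 -> (n <= M)%N.
Proof.
move=> n0 an; apply: (@leq_bigmax_seq _ _ (fun n => a n != 0) id) => //.
by rewrite mem_index_iota ltnS.
Qed.

Lemma max_indexP : (0 < M <= N)%N /\ a M != 0.
Proof.
have M0 : (0 < M)%N by apply: max_index_le; rewrite ?N_gt0// a1 oner_eq0.
have : M = 0%N \/ ((0 < M <= N)%N /\ a M != 0).
  rewrite /max_index big_seq_cond.
  elim/big_ind : _ => [|x y hx hy|i].
  - by left.
  - by rewrite /maxn; case: ifP.
  - by rewrite mem_index_iota ltnS => /andP[i0 ai]; right.
by case=> // h; rewrite h in M0.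
Qed.

Definition coef_sum : R := \sum_(1 <= n < N.+1) cabs (a n).

Lemma coef_sum_ge1 : 1 <= coef_sum.
Proof.
rewrite /coef_sum big_ltn// a1 cabs1 lerDl; apply: sumr_ge0 => n _; exact: cabs_ge0.
Qed.

Lemma cabs_vertical_char n t : cabs (@vertical_char R t n) = 1.
Proof. exact: cabs_cis. Qed.

Lemma jessen_bound_ge sg (c : R) :
  (forall t, c <= ln (cabs (P sg t))) -> c <= J sg.
Proof.
move=> h; have [li hm _] := jessenP a1 N_gt0 sg.
have ic := @locally_integrable_sym_cst R c.
exact: (has_mean_le ic li h (@has_mean_cst R c) hm).
Qed.

Lemma jessen_bound_le sg (c : R) :
  (forall t, ln (cabs (P sg t)) <= c) -> J sg <= c.
Proof.
move=> h; have [li hm _] := jessenP a1 N_gt0 sg.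
have ic := @locally_integrable_sym_cst R c.
exact: (has_mean_le li ic h hm (@has_mean_cst R c)).
Qed.

Lemma expRN_le (x : R) : 0 < x -> expR (- x) <= x^-1.
Proof.
move=> x0; rewrite expRN lef_pV2 ?posrE ?expR_gt0//.
by have := expR_ge1Dx x; lra.
Qed.

(** The terms with n >= 2 add up to at most [coef_sum] times 2^(-sigma), so P tends to a_1 = 1
    uniformly in t. *)
Lemma jessen_pinfty eta : 0 < eta -> exists s0, forall sg, s0 <= sg -> `|J sg| <= eta.
Proof.
move=> eta0; pose d := Num.min (eta / 2) 2^-1.
have d0 : 0 < d by rewrite lt_min divr_gt0//= invr_gt0.
have S1 := coef_sum_ge1.
have l2 : 0 < ln 2 :> R by rewrite ln_gt0// ltr1n.
have S0 : 0 < coef_sum by lra.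
exists (coef_sum / (d * ln 2)) => sg sgs.
have sg0 : 0 < sg by apply: lt_le_trans sgs; rewrite divr_gt0// mulr_gt0.
have dist t : cabs (P sg t - 1) <= d.
  have -> : P sg t - 1 = \sum_(2 <= n < N.+1) a n * (n%:R `^ (- sg))%:C * vertical_char t n.
    rewrite /char_sum big_ltn// a1 powR1 /vertical_char ln1 mulr0 oppr0 cis0 !mulr1.
    by rewrite addrAC subrr add0r.
  apply: le_trans (cabs_sum _ _ _) _.
  apply: (@le_trans _ _ (coef_sum * expR (- (sg * ln 2)))).
    rewrite /coef_sum mulr_suml [leRHS]big_ltn//.
    apply: (@le_trans _ _ (\sum_(2 <= n < N.+1) cabs (a n) * expR (- (sg * ln 2)))); last first.
      by rewrite lerDr mulr_ge0 ?cabs_ge0 ?expR_ge0.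
    rewrite big_nat [leRHS]big_nat; apply: ler_sum => n /andP[n2 _].
    have n0 : (0 < n)%N by exact: leq_trans n2.
    rewrite cabs_term ?cabs_vertical_char// ler_wpM2l ?cabs_ge0//.
    rewrite powR_expR// ler_expR mulNr lerN2 ler_wpM2l ?(ltW sg0)//.
    by rewrite ler_ln ?posrE ?ltr0n// ler_nat.
  apply: (@le_trans _ _ (coef_sum * (sg * ln 2)^-1)).
    by rewrite ler_wpM2l ?(ltW S0)// expRN_le// mulr_gt0.
  rewrite ler_pdivrMr ?mulr_gt0//.
  by move: sgs; rewrite ler_pdivrMr ?mulr_gt0//; lra.
have dh : d <= 2^-1 by rewrite ge_min lexx orbT.
have de : d <= eta / 2 by rewrite ge_min lexx.
have pt t : - eta <= ln (cabs (P sg t)) <= eta.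
  have := dist t; set p := P sg t => pd.
  have p1 : cabs p <= 1 + d.
    by have := cabsD (p - 1) 1; rewrite subrK cabs1; lra.
  have p2 : 1 - d <= cabs p.
    by have := cabsB p (p - 1); rewrite subKr cabs1; lra.
  have p0 : 0 < cabs p by lra.
  apply/andP; split.
    have := ln_tangent (@ltr01 R) p0; rewrite ln1.
    have : (1 - cabs p) / cabs p <= 2 * d by rewrite ler_pdivrMr//; nra.
    lra.
  have := ln_tangent p0 (@ltr01 R); rewrite ln1 divr1; lra.
rewrite ler_norml; apply/andP; split.
  by apply: jessen_bound_ge => t; case/andP: (pt t).
by apply: jessen_bound_le => t; case/andP: (pt t).
Qed.

(** For very negative sigma the term of index M dominates: |P| lies between |a_M| / 2 and [coef_sum]
    times M^(-sigma), for all t. A bounded error is needed, since it must vanish against a slope. *)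
Lemma jessen_ninfty : exists K s0, forall sg, sg <= s0 -> `|J sg + ln M%:R * sg| <= K.
Proof.
have [/andP[M0 MN] aM] := max_indexP.
have S1 := coef_sum_ge1; have S0 : 0 < coef_sum by lra.
have lnM0 : 0 <= ln M%:R :> R by rewrite ln_ge0// ler1n.
have am : 0 < cabs (a M) by rewrite cabs_gt0.
have [rho [rho0 hrho]] : exists rho : R, 0 < rho /\
    forall n, (0 < n < M)%N -> ln n%:R <= ln M%:R - rho.
  (* For M = 1 there is no smaller index and any gap will do; otherwise the gap is ln M - ln (M -
     1). *)
  have [M1|M1] := leqP M 1.
    exists 1; split => // n /andP[n0 nM].
    by move: (leq_trans nM M1); rewrite ltnS leqn0 => /eqP n00; rewrite n00 in n0.
  have M10 : (0 < M.-1)%N by rewrite -ltnS prednK.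
  exists (ln M%:R - ln M.-1%:R); split.
    by rewrite subr_gt0 ltr_ln ?posrE ?ltr0n// ltr_nat prednK.
  move=> n /andP[n0 nM]; rewrite subKr ler_ln ?posrE ?ltr0n// ler_nat.
  by rewrite -ltnS prednK.
pose tau0 := 2 * coef_sum / (cabs (a M) * rho).
have tau00 : 0 < tau0 by rewrite divr_gt0 ?mulr_gt0.
pose K1 := `|ln (cabs (a M) / 2)|.
exists (K1 + ln coef_sum), (- tau0) => sg sgt.
have sg0 : sg < 0 by lra.
have l1 : 0 <= ln coef_sum by rewrite ln_ge0.
have K10 : 0 <= K1 by exact: normr_ge0.
have term n : (0 < n <= M)%N -> n%:R `^ (- sg) <= expR (- sg * ln M%:R).
  move=> /andP[n0 nM]; rewrite powR_expR// ler_expR ler_wpM2l//; first by lra.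
  by rewrite ler_ln ?posrE ?ltr0n// ler_nat.
have up t : ln (cabs (P sg t)) <= ln coef_sum - ln M%:R * sg.
  (* At a zero of P the convention ln 0 = 0 requires the right-hand side to be nonnegative, which
     holds as sg < 0. *)
  have := cabs_ge0 (P sg t); rewrite le_eqVlt => /orP[/eqP <-|p0].
    by rewrite (ln0 (lexx 0)) subr_ge0; apply: le_trans l1; nra.
  have : cabs (P sg t) <= coef_sum * expR (- sg * ln M%:R).
    apply: le_trans (cabs_sum _ _ _) _; rewrite /coef_sum mulr_suml.
    rewrite big_nat [leRHS]big_nat; apply: ler_sum => n /andP[n0 nN].
    rewrite cabs_term ?cabs_vertical_char//.
    have [->|an] := eqVneq (a n) 0; first by rewrite cabs0 !mul0r.
    rewrite ler_wpM2l ?cabs_ge0// term// n0 max_index_le// n0; exact: nN.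
  move=> h; have : ln (cabs (P sg t)) <= ln (coef_sum * expR (- sg * ln M%:R)).
    by rewrite ler_ln ?posrE ?mulr_gt0 ?expR_gt0.
  by rewrite lnM ?posrE ?expR_gt0// expRK; lra.
have low t : ln (cabs (a M) / 2) - ln M%:R * sg <= ln (cabs (P sg t)).
  have E0 := expR_gt0 (- sg * ln M%:R).
  have : cabs (a M) / 2 * expR (- sg * ln M%:R) <= cabs (P sg t).
    have PE : P sg t = a M * (M%:R `^ (- sg))%:C * vertical_char t M +
        \sum_(1 <= n < N.+1 | n != M) a n * (n%:R `^ (- sg))%:C * vertical_char t n.
      rewrite /char_sum (bigD1_seq M) ?iota_uniq//= mem_index_iota ltnS M0//.
    have head : cabs (a M * (M%:R `^ (- sg))%:C * vertical_char t M) =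
        cabs (a M) * expR (- sg * ln M%:R).
      by rewrite cabs_term ?cabs_vertical_char// powR_expR.
    have tail : cabs (\sum_(1 <= n < N.+1 | n != M)
        a n * (n%:R `^ (- sg))%:C * vertical_char t n) <=
        coef_sum * (expR (- sg * ln M%:R) * expR (- (- sg * rho))).
      apply: le_trans (cabs_sum _ _ _) _.
      apply: (@le_trans _ _ (\sum_(1 <= n < N.+1 | n != M)
         cabs (a n) * (expR (- sg * ln M%:R) * expR (- (- sg * rho))))); last first.
        rewrite -mulr_suml ler_wpM2r ?mulr_ge0 ?expR_ge0//.
        rewrite /coef_sum [leRHS](bigID (fun n => n != M))/= lerDl.
        by apply: sumr_ge0 => n _; exact: cabs_ge0.
      rewrite big_nat_cond [leRHS]big_nat_cond; apply: ler_sum => n /andP[/andP[n0 nN] nM].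
      rewrite cabs_term ?cabs_vertical_char//.
      have [->|an] := eqVneq (a n) 0; first by rewrite cabs0 !mul0r.
      rewrite ler_wpM2l ?cabs_ge0// powR_expR// -expRD ler_expR.
      have nM' : (0 < n < M)%N by rewrite n0 ltn_neqAle nM max_index_le// n0; exact: nN.
      have sgn : 0 <= - sg by lra.
      have := ler_wpM2l sgn (hrho n nM'); lra.
    have dec : coef_sum * expR (- (- sg * rho)) <= cabs (a M) / 2.
      have sr : 0 < - sg * rho by rewrite mulr_gt0//; lra.
      apply: (@le_trans _ _ (coef_sum * (- sg * rho)^-1)).
        by rewrite ler_wpM2l ?(ltW S0)// expRN_le.
      rewrite ler_pdivrMr//.
      have : tau0 <= - sg by lra.
      rewrite /tau0 ler_pdivrMr ?mulr_gt0//; lra.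
    have := cabsB (P sg t) (\sum_(1 <= n < N.+1 | n != M)
        a n * (n%:R `^ (- sg))%:C * vertical_char t n).
    rewrite {1}PE addrK head => h.
    have := ler_wpM2r (ltW E0) dec.
    lra.
  move=> h; have e0 : 0 < cabs (a M) / 2 * expR (- sg * ln M%:R).
    by rewrite mulr_gt0// divr_gt0.
  have : ln (cabs (a M) / 2 * expR (- sg * ln M%:R)) <= ln (cabs (P sg t)).
    by rewrite ler_ln ?posrE//; exact: lt_le_trans h.
  rewrite lnM ?posrE ?divr_gt0 ?expR_gt0// expRK; lra.
have jl := jessen_bound_ge low; have ju := jessen_bound_le up.
have := ler_norm (- ln (cabs (a M) / 2)); rewrite normrN -/K1 => k.
rewrite ler_norml; apply/andP; move: (J sg) jl ju => j jl ju; split; lra.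
Qed.

Lemma jessen_nonincreasing x y : x <= y -> J y <= J x.
Proof.
have [s0 h] := jessen_pinfty ltr01.
apply: (@convex_bounded_right_le _ _ 1 s0); first exact: jessen_convex.
by move=> u /h; exact: le_trans (ler_norm _).
Qed.

Lemma jessen_ge0 x : 0 <= J x.
Proof.
apply/ler_addgt0Pr => e e0; have [s0 h] := jessen_pinfty e0.
have := h (Num.max s0 x); rewrite le_max lexx => /(_ isT)/ler_normlP[h1 _].
have : J (Num.max s0 x) <= J x by apply: jessen_nonincreasing; rewrite le_max lexx orbT.
by move: (J x) (J (Num.max s0 x)) h1 => u v; lra.
Qed.

Lemma jessen_slope_ge x y : x <= y -> - ln M%:R * (y - x) <= J y - J x.
Proof.
have [K [s0 h]] := jessen_ninfty.
apply: (@convex_bounded_left_ge _ _ K _ s0); first exact: jessen_convex.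
by move=> u /h; exact: le_trans (ler_norm _).
Qed.

End Asymptotics.

(** * Twists by large primes *)

Section PrimeLowerBound.
Context {R : realType}.
Variables (a : nat -> R[i]) (N : nat) (sg : R).
Implicit Types (chi : nat -> R[i]) (s : seq nat) (t eps : R).

Definition char_term chi p : R[i] := a p * (p%:R `^ (- sg))%:C * chi p.

Definition large_primes s := uniq s /\
  forall p, p \in s -> [/\ prime p, (p <= N)%N & (N < 2 * p)%N].

Lemma logn_large_prime p n : prime p -> (0 < n <= N)%N -> (N < 2 * p)%N ->
  n != p -> logn p n = 0%N.
Proof.
move=> pp /andP[n0 nN] Np np; rewrite lognE pp n0 /=; case: ifP => // /dvdnP[k nk].
move: np n0 nN; rewrite nk; case: k {nk} => [|[|k]] //; first by rewrite mul1n eqxx.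
move=> _ _ kN; have : (2 * p <= N)%N by apply: leq_trans kN; rewrite leq_mul2r orbT.
by rewrite leqNgt Np.
Qed.

Lemma char_term_twist p q (w : R[i]) chi : prime p -> (0 < q <= N)%N -> (N < 2 * p)%N ->
  char_term (mulchar (prime_char p w) chi) q =
  if q == p then w * char_term chi p else char_term chi q.
Proof.
move=> pp qN Np; rewrite /char_term /mulchar /prime_char.
case: eqVneq => [->|qp]; first by rewrite logn_prime// eqxx expr1; ring.
by rewrite (logn_large_prime pp qN Np qp) expr0 mul1r.
Qed.

Lemma char_sum_twist p (w : R[i]) chi : prime p -> (p <= N)%N -> (N < 2 * p)%N ->
  char_sum a N sg (mulchar (prime_char p w) chi) =
  char_sum a N sg chi - char_term chi p + w * char_term chi p.
Proof.
move=> pp pN Np; have p0 := prime_gt0 pp.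
have pI : p \in index_iota 1 N.+1 by rewrite mem_index_iota p0 ltnS.
have e psi : char_sum a N sg psi = char_term psi p +
    \sum_(1 <= n < N.+1 | n != p) char_term psi n.
  by rewrite /char_sum (bigD1_seq p) ?iota_uniq.
rewrite !e char_term_twist ?p0// eqxx.
have -> : \sum_(1 <= n < N.+1 | n != p) char_term (mulchar (prime_char p w) chi) n =
    \sum_(1 <= n < N.+1 | n != p) char_term chi n.
  rewrite big_nat_cond [RHS]big_nat_cond; apply: eq_bigr => n /andP[nN np].
  by rewrite char_term_twist// (negPf np).
ring.
Qed.

Variables (L : nat) (zeta : R[i]).
Hypothesis (L_gt2 : (2 < L)%N) (prim_zeta : L.-primitive_root zeta).

(** The mean of [log_reg] over independent phases at the primes of [s], the other terms being
    frozen. It remains a function of chi, so that it can also be averaged along vertical lines. *)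
Definition twisted_log_reg eps s chi : R :=
  iter_avg L zeta [seq char_term chi p | p <- s] (log_reg eps)
    (char_sum a N sg chi - \sum_(p <- s) char_term chi p).

(** Turns the outermost phase average into an average over genuine characters, to which the
    invariance of means applies. *)
Lemma twisted_log_reg_cons eps p s chi : large_primes (p :: s) ->
  twisted_log_reg eps (p :: s) chi =
  L%:R^-1 * \sum_(0 <= j < L) twisted_log_reg eps s (mulchar (prime_char p (zeta ^+ j)) chi).
Proof.
move=> [/= /andP[ps us] hs]; have [pp pN Np] := hs p (mem_head _ _).
have hs' q : q \in s -> [/\ (0 < q <= N)%N & q != p].
  move=> qs; have [qp qN _] := hs q (mem_behead (s := p :: s) qs).
  by rewrite prime_gt0// qN; split => //; apply: contraNneq ps => <-.
rewrite /twisted_log_reg /= /ravg; congr (_ * _); apply: eq_bigr => j _.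
have -> : [seq char_term (mulchar (prime_char p (zeta ^+ j)) chi) q | q <- s] =
    [seq char_term chi q | q <- s].
  apply/eq_in_map => q /hs'[qN qp].
  by rewrite char_term_twist// (negPf qp).
have -> : \sum_(q <- s) char_term (mulchar (prime_char p (zeta ^+ j)) chi) q =
    \sum_(q <- s) char_term chi q.
  rewrite big_seq [RHS]big_seq; apply: eq_bigr => q /hs'[qN qp].
  by rewrite char_term_twist// (negPf qp).
rewrite char_sum_twist// big_cons; congr (iter_avg _ _ _ _ _); ring.
Qed.

(* The mean of [log_reg] does not change under the twists by [prime_char], so it
   is also the mean of the average over all of them. *)
Lemma twisted_log_reg_mean eps s chi : 0 < eps -> large_primes s -> unimodular_char chi ->
  locally_integrable_sym (fun t => twisted_log_reg eps s (mulchar chi (vertical_char t))) /\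
  has_mean (fun t => twisted_log_reg eps s (mulchar chi (vertical_char t)))
    (jessen_reg a N sg eps).
Proof.
move=> e0; elim: s chi => [|p s IH] chi hs uchi.
  have e : (fun t => twisted_log_reg eps [::] (mulchar chi (vertical_char t))) =
      (fun t => log_reg eps (char_sum a N sg (mulchar chi (vertical_char t)))).
    by apply/funext => t; rewrite /twisted_log_reg /= big_nil subr0.
  by rewrite e; split; [exact: integrable_log_reg | exact: jessen_regP].
have hs' : large_primes s.
  case: hs => /= /andP[_ us] h; split => // q qs.
  by apply: h; rewrite inE qs orbT.
have uw j : unimodular_char (mulchar (prime_char p (zeta ^+ j)) chi).
  apply: unimodular_mulchar => //; apply: unimodular_prime_char.
  exact: (cabs_zetaX L_gt2 prim_zeta).
have IHj j := IH _ hs' (uw j).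
have e : (fun t => twisted_log_reg eps (p :: s) (mulchar chi (vertical_char t))) =
  (fun t => L%:R^-1 * \sum_(0 <= j < L) twisted_log_reg eps s
      (mulchar (mulchar (prime_char p (zeta ^+ j)) chi) (vertical_char t))).
  apply/funext => t; rewrite twisted_log_reg_cons//; congr (_ * _).
  by apply: eq_bigr => j _; rewrite mulcharA.
have li : locally_integrable_sym (fun t => \sum_(0 <= j < L) twisted_log_reg eps s
      (mulchar (mulchar (prime_char p (zeta ^+ j)) chi) (vertical_char t))).
  by apply: locally_integrable_sym_sum => j; exact: (IHj j).1.
rewrite e; split.
  exact: locally_integrable_symZ.
have -> : jessen_reg a N sg eps = L%:R^-1 * \sum_(0 <= j < L) jessen_reg a N sg eps.
  rewrite sumr_const_nat subn0 -[jessen_reg _ _ _ _ *+ L]mulr_natl mulrA mulVf ?mul1r//.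
  by rewrite pnatr_eq0; case: L L_gt2.
apply: has_meanZ => //.
by apply: has_mean_sum => j; [exact: (IHj j).1 | move=> _; exact: (IHj j).2].
Qed.

End PrimeLowerBound.

(** * Lower bound from comparable prime terms *)

Section JessenLowerBound.
Context {R : realType}.
Variables (a : nat -> R[i]) (N : nat).
Implicit Types (s : seq nat) (sg d eps : R).

(** L is free, as the right-hand side does not involve it, and is used up to remove [avg_err]. The
    resulting bound does not depend on eps and so survives the limit eps -> 0. *)
Lemma jessen_reg_lower sg s (k r : nat) d eps : 0 < eps -> large_primes N s ->
  0 < d -> (0 < r)%N -> (forall p, p \in s -> d <= cabs (a p) * p%:R `^ (- sg)) ->
  (k * r < size s)%N ->
  ln d - 2^-1 * ln 2 + (1 - (7 / 8) ^+ k) * (2^-1 * ln r%:R) <= jessen_reg a N sg eps.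
Proof.
move=> e0 hs d0 r0 sd ks.
have term chi p : unimodular_char chi -> p \in s ->
    cabs (char_term a sg chi p) = cabs (a p) * p%:R `^ (- sg).
  move=> [c1 _] ps; rewrite /char_term cabs_term// c1//.
  by have [/prime_gt0] := hs.2 p ps.
pose T := \sum_(p <- s) cabs (a p) * p%:R `^ (- sg).
pose C := abs_sum a N sg + T + T.
have T0 : 0 <= T by apply: sumr_ge0 => p _; rewrite mulr_ge0 ?cabs_ge0 ?powR_ge0.
have S0 : 0 <= abs_sum a N sg.
  by apply: sumr_ge0 => n _; rewrite mulr_ge0 ?cabs_ge0 ?powR_ge0.
have C0 : 0 <= C by rewrite !addr_ge0.
have u1 := @unimodular_trivial_char R.
apply/ler_addgt0Pr => eta eta0.
pose D := ln (eps / (2 * C ^+ 2 + eps)).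
pose L := (3 + Num.truncn (`|D| / eta))%N.
have L_gt2 : (2 < L)%N by rewrite /L -addn1 leq_add2l.
have L0 : 0 < L%:R :> R by rewrite ltr0n.
have DL : `|D| / eta <= L%:R.
  apply: ltW; apply: lt_le_trans (truncnS_gt _) _.
  by rewrite ler_nat /L addSn ltnS leq_addl.
have errb : - eta <= avg_err L eps C.
  rewrite /avg_err -/D.
  have : - `|D| <= D by rewrite lerNl -normrN ler_norm.
  have h2 : `|D| <= L%:R * eta by rewrite -ler_pdivrMr.
  move=> h; rewrite mulrC ler_pdivlMr ?mulr_gt0//.
  have := mulr_gt0 L0 eta0; lra.
have [zeta pz] := prim_root_exists (ltnW (ltnW L_gt2)) (R := R).
have [li hm] := twisted_log_reg_mean a sg L_gt2 pz e0 hs u1.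
have ic := @locally_integrable_sym_cst R (ln d - 2^-1 * ln 2 +
  (1 - (7 / 8) ^+ k) * (2^-1 * ln r%:R) + avg_err L eps C).
have := has_mean_le ic li _ (@has_mean_cst R _) hm.
have pt t : ln d - 2^-1 * ln 2 + (1 - (7 / 8) ^+ k) * (2^-1 * ln r%:R) + avg_err L eps C <=
    twisted_log_reg a N sg L zeta eps s (mulchar (trivial_char (R := R)) (vertical_char t)).
  have ut := unimodular_mulchar u1 (unimodular_vertical_char t).
  apply: (iter_avg_log_reg_lower L_gt2 pz e0 C0 d0 r0).
  - by move=> c /mapP[p ps ->]; rewrite term//; exact: sd.
  - by rewrite size_map.
  - have sumE : \sum_(c <- [seq char_term a sg (mulchar (trivial_char (R := R)) (vertical_char t)) p | p <- s])
       cabs c = T.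
      by rewrite big_map /T big_seq [RHS]big_seq; apply: eq_bigr => p ps; rewrite term.
    rewrite sumE /C lerD2r; apply: le_trans (cabsB _ _) _; apply: lerD.
      exact: char_sum_le.
    by apply: le_trans (cabs_sum _ _ _) _; rewrite -sumE big_map.
move=> /(_ pt); move: (jessen_reg a N sg eps) => j; lra.
Qed.

Lemma jessen_lower sg s (k r : nat) d : a 1%N = 1 -> (0 < N)%N -> large_primes N s ->
  0 < d -> (0 < r)%N -> (forall p, p \in s -> d <= cabs (a p) * p%:R `^ (- sg)) ->
  (k * r < size s)%N ->
  ln d - 2^-1 * ln 2 + (1 - (7 / 8) ^+ k) * (2^-1 * ln r%:R) <= jessen (dirichlet_sum a N) sg.
Proof.
move=> a1 N0 hs d0 r0 sd ks; apply/ler_addgt0Pr => eta eta0.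
have [_ _ H] := jessenP a1 N0 sg; have [e0 [e00 he]] := H eta eta0.
have := he e0; rewrite e00 lexx => /(_ isT)/ler_normlP[_].
have := jessen_reg_lower e00 hs d0 r0 sd ks.
move: (jessen_reg a N sg e0) (jessen _ sg) => u v; lra.
Qed.

End JessenLowerBound.

(** * The right derivative of a convex function and its Stieltjes measure *)

Section RightDerivative.
Context {R : realType}.
Implicit Types (g : R -> R) (x y z h : R).

Variables (g : R -> R) (c : R).
Hypotheses (g_convex : convex_on_line g).
Hypothesis g_slope : forall x y, x <= y -> - c * (y - x) <= g y - g x <= 0.

Local Notation D := (right_derivative g).

Let quot x h : R := h^-1 * (g (x + h) - g x).

Let quot_homo x : {in Interval (BRight (0 : R)) (BLeft 1) &, {homo quot x : h k / h <= k}}.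
Proof.
move=> h k; rewrite !in_itv/= => /andP[h0 _] /andP[k0 _].
rewrite le_eqVlt => /orP[/eqP -> //|hk].
have xh : x < x + h by rewrite ltrDl.
have hk' : x + h < x + k by rewrite ltrD2l.
have := convex_slopes g_convex xh hk'.
rewrite /quot ler_pdivrMl// mulrCA ler_pdivlMl// => H.
have -> : h * (g (x + k) - g x) = h * (g (x + k) - g (x + h)) + h * (g (x + h) - g x) by ring.
have -> : k * (g (x + h) - g x) = (g (x + h) - g x) * (x + k - (x + h)) + h * (g (x + h) - g x).
  by ring.
rewrite lerD2r; apply: (le_trans H).
by have -> : (g (x + k) - g (x + h)) * (x + h - x) = h * (g (x + k) - g (x + h)) by ring.
Qed.

(** By convexity the quotients are nondecreasing in h, and they are bounded below by - c; their
    limit at 0 is their infimum. *)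
Lemma cvg_right_derivative x : quot x h @[h --> 0^'+] --> D x.
Proof.
have lb : has_lbound [set quot x h | h in [set` Interval (BRight (0 : R)) (BLeft 1)]].
  exists (- c) => _ [h /= + <-]; rewrite in_itv/= => /andP[h0 _].
  have xh : x <= x + h by rewrite lerDl ltW.
  rewrite /quot ler_pdivlMl//; have /andP[+ _] := g_slope xh.
  by have -> : - c * (x + h - x) = h * - c by ring.
have itv : (BRight (0 : R) < BLeft 1)%O by rewrite bnd_simp.
have h := nondecreasing_at_right_cvgr itv (@quot_homo x) lb.
have -> : D x = inf [set quot x h | h in [set` Interval (BRight (0 : R)) (BLeft 1)]].
  by apply: cvg_lim => //; exact: Rhausdorff.
exact: h.
Qed.

Lemma right_derivative_le_slope x y : x < y -> D x * (y - x) <= g y - g x.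
Proof.
move=> xy; rewrite -ler_pdivlMr ?subr_gt0//.
apply: (cvgr_to_le (@cvg_right_derivative x)); near=> h.
have h0 : 0 < h by [].
have hy : h < y - x by near: h; apply: nbhs_right_lt; rewrite subr_gt0.
have xh : x < x + h by rewrite ltrDl.
have xhy : x + h < y by lra.
have := convex_slopes g_convex xh xhy => H.
rewrite /quot ler_pdivlMr ?subr_gt0// -mulrA ler_pdivrMl//; lra.
Unshelve. all: by end_near. Qed.

Lemma slope_le_right_derivative x y : x < y -> g y - g x <= D y * (y - x).
Proof.
move=> xy; rewrite -ler_pdivrMr ?subr_gt0//.
apply: (cvgr_to_ge (@cvg_right_derivative y)); near=> h.
have h0 : 0 < h by [].
have yh : y < y + h by rewrite ltrDl.
have := convex_slopes g_convex xy yh => H.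
rewrite /quot ler_pdivrMr ?subr_gt0// -mulrA ler_pdivlMl//; lra.
Unshelve. all: by end_near. Qed.

Lemma right_derivative_homo : {homo D : x y / x <= y}.
Proof.
move=> x y; rewrite le_eqVlt => /orP[/eqP -> //|xy].
have h1 := right_derivative_le_slope xy; have h2 := slope_le_right_derivative xy.
by have := le_trans h1 h2; rewrite ler_pM2r ?subr_gt0.
Qed.

Lemma right_derivative_bounds x : - c <= D x <= 0.
Proof.
have x1 : x < x + 1 by rewrite ltrDl.
have x2 : x - 1 < x by rewrite gtrBl.
have /andP[h1 h2] := g_slope (ltW x1); have /andP[h3 h4] := g_slope (ltW x2).
have := right_derivative_le_slope x1; have := slope_le_right_derivative x2.
by move: (D x) => d *; apply/andP; split; lra.
Qed.

Let c_ge0 : 0 <= c.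
Proof.
by have /andP[h1 h2] := right_derivative_bounds 0; have := le_trans h1 h2; rewrite oppr_le0.
Qed.

Let g_continuous x : g y @[y --> x] --> g x.
Proof.
apply/cvgrPdist_le => e e0; near=> y.
have d : `|x - y| <= e / (c + 1).
  by near: y; apply: cvgr_dist_le => //; rewrite divr_gt0// ltr_wpDl.
move: d; rewrite ler_pdivlMr ?ltr_wpDl// => d.
have [xy|yx] := leP x y.
  have /andP[h1 h2] := g_slope xy.
  have xy' : `|x - y| = y - x by rewrite distrC ger0_norm// subr_ge0.
  by rewrite xy' in d; rewrite ler_norml; apply/andP; split; nra.
have /andP[h1 h2] := g_slope (ltW yx).
have xy' : `|x - y| = x - y by rewrite ger0_norm// subr_ge0 ltW.
by rewrite xy' in d; rewrite ler_norml; apply/andP; split; nra.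
Unshelve. all: by end_near. Qed.

(** For fixed h, D y is at most the slope of g from y to x + h, which is continuous in y; a small h
    makes that slope at y = x close to D x. *)
Lemma right_derivative_right_continuous x : D y @[y --> x^'+] --> D x.
Proof.
apply/cvgrPdist_le => e e0.
have [h [h0 hq]] : exists h, 0 < h /\ quot x h <= D x + e / 2.
  have e2 : 0 < e / 2 by rewrite divr_gt0.
  have /cvgrPdist_le/(_ _ e2) H := @cvg_right_derivative x.
  near ((0 : R)^'+) => h; exists h; split => //.
  have : `|D x - quot x h| <= e / 2 by near: h.
  by move=> /ler_normlP[]; lra.
have cq : (g (x + h) - g y) / (x + h - y) @[y --> x^'+] --> (g (x + h) - g x) / (x + h - x).
  apply: cvg_within_filter; apply: cvgM.
    by apply: cvgB; [exact: cvg_cst | exact: g_continuous].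
  apply: cvgV; first by rewrite addrAC subrr add0r gt_eqF.
  by apply: cvgB; [exact: cvg_cst | exact: cvg_id].
have e2 : 0 < e / 2 by rewrite divr_gt0.
near=> y.
have xy : x < y by [].
have yh : y < x + h by near: y; apply: nbhs_right_lt; rewrite ltrDl.
have h1 : D x <= D y by apply: right_derivative_homo; exact: ltW.
have h2 : D y <= (g (x + h) - g y) / (x + h - y).
  by rewrite ler_pdivlMr ?subr_gt0//; exact: right_derivative_le_slope.
have h3 : `|(g (x + h) - g x) / (x + h - x) - (g (x + h) - g y) / (x + h - y)| <= e / 2.
  by near: y; move/cvgrPdist_le : cq; apply.
have q : quot x h = (g (x + h) - g x) / (x + h - x).
  by rewrite /quot mulrC addrAC subrr add0r.
rewrite -q in h3; move/ler_normlP : h3 => [h3 h4].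
by rewrite ler_norml; apply/andP; split; lra.
Unshelve. all: by end_near. Qed.

Lemma right_derivative_pinfty : (forall x, 0 <= g x) -> D x @[x --> +oo] --> 0.
Proof.
move=> g0; apply/cvgrPdist_le => e e0.
(* A slope below - e at x0 would force g x0 <= g 0 - e x0 < 0. *)
pose x0 := g 0 / e + 1.
have x00 : 0 < x0 by rewrite ltr_wpDl// divr_ge0// ltW.
have hD : - e <= D x0.
  have := slope_le_right_derivative x00; have := g0 x0; rewrite subr0.
  have : x0 * e = g 0 + e by rewrite /x0 mulrDl divfK ?gt_eqF// mul1r.
  move: (D x0) => d; nra.
near=> x; have xx0 : x0 <= x by near: x; apply: nbhs_pinfty_ge; exact: num_real.
have := right_derivative_homo xx0; have /andP[_ d0] := right_derivative_bounds x.
move=> dd; rewrite sub0r normrN ler0_norm//; lra.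
Unshelve. all: by end_near. Qed.

Lemma right_derivative_ninfty (K s0 : R) : (forall x, x <= s0 -> `|g x + c * x| <= K) ->
  D x @[x --> -oo] --> - c.
Proof.
move=> gK; apply/cvgrPdist_le => e e0.
have K0 : 0 <= K by exact: le_trans (normr_ge0 _) (gK s0 (lexx _)).
(* Over [x0, s0] the function g + c x changes by at most 2 K, hence by less than e times the
   length. *)
pose x0 := s0 - (2 * K / e + 1).
have q0 : 0 <= 2 * K / e by rewrite divr_ge0 ?mulr_ge0// ltW.
have x0s : x0 < s0 by rewrite /x0; lra.
have hD : D x0 <= - c + e.
  have := right_derivative_le_slope x0s.
  have /ler_normlP[a1 a2] := gK s0 (lexx _).
  have /ler_normlP[a3 a4] := gK x0 (ltW x0s).
  have : (s0 - x0) * e = 2 * K + e.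
    by rewrite /x0 subKr mulrDl divfK ?gt_eqF// mul1r.
  have : 0 < s0 - x0 by rewrite subr_gt0.
  move: (D x0) => d; nra.
near=> x; have xx0 : x <= x0 by near: x; apply: nbhs_ninfty_le; exact: num_real.
have := right_derivative_homo xx0; have /andP[d0 _] := right_derivative_bounds x.
move=> dd; rewrite ler_norml; apply/andP; split; lra.
Unshelve. all: by end_near. Qed.

Lemma second_derivative_itv x y : x <= y ->
  second_derivative g `]x, y]%classic = (D y - D x)%:E.
Proof.
move=> xy.
(* [stieltjes] is the zero measure unless its argument underlies a [cumulative]; monotonicity and
   right-continuity of D exclude that case. *)
have ex : exists F : cumulative R R, F = D :> (R -> R).
  pose F : cumulative R R := HB.pack (right_derivative g)
    (isCumulative.Build R _ R D right_derivative_homo right_derivative_right_continuous).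
  by exists F.
rewrite /second_derivative /stieltjes; case: pselect => // F_.
case: (cid F_) => F FE /=; rewrite -FE.
rewrite /lebesgue_stieltjes_measure /measure_extension measurable_mu_extE/=; last exact: is_ocitv.
by rewrite wlength_itv_bnd.
Qed.

Lemma second_derivative_setT (K s0 : R) : (forall x, 0 <= g x) ->
  (forall x, x <= s0 -> `|g x + c * x| <= K) ->
  second_derivative g setT = c%:E.
Proof.
move=> g0 gK.
rewrite -(bigcup_itvT false false).
pose I n : set (measurableTypeR R) := `]- (n%:R), n%:R]%classic.
have h1 : (second_derivative g \o I) n @[n --> \oo] --> c%:E.
  have -> : second_derivative g \o I = (fun n => (D n%:R - D (- n%:R))%:E).
    by apply/funext => n; rewrite /= second_derivative_itv// ge0_cp.
  apply: cvg_EFin; first by near=> n.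
  rewrite (_ : c = 0 - - c); last by ring.
  apply: cvgB.
    exact: (cvg_comp _ _ (@cvgr_idn R) (right_derivative_pinfty g0)).
  have hn : (- n%:R : R) @[n --> \oo] --> -oo by apply/cvgNrNy; exact: cvgr_idn.
  exact: (cvg_comp _ _ hn (right_derivative_ninfty gK)).
have h2 : (second_derivative g \o I) n @[n --> \oo] --> second_derivative g (\bigcup_n I n).
  apply: nondecreasing_cvg_mu; rewrite /I//; first exact: bigcup_measurable.
  by move=> *; apply/subsetPset/subset_itv; rewrite leBSide/= ?lerN2 ler_nat.
exact: cvg_unique h2 h1.
Unshelve. all: by end_near. Qed.

End RightDerivative.

(** * Weak convergence to a Dirac mass, and locally uniform convergence *)

Section WeakConvergence.
Context {R : realType}.
Implicit Types (alpha x y delta eta : R).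

(** Since the total mass is 1, mass near alpha bounds the mass elsewhere, and lower bounds on
    neighbourhoods of alpha suffice. *)
Lemma weak_cvg_dirac (mu : nat -> {measure set (measurableTypeR R) -> \bar R}) alpha :
  (\forall N \near \oo, mu N [set: R] = 1%E) ->
  (forall delta eta, 0 < delta -> 0 < eta -> \forall N \near \oo,
    ((1 - eta)%:E <= mu N `](alpha - delta)%R, (alpha + delta)%R]%classic)%E) ->
  weak_cvg_probability mu (\d_(alpha : measurableTypeR R)).
Proof.
move=> mu1 mu_near; split => //; first exact: diracT.
move=> f cf [B0 [_ fB0]].
pose B := `|B0| + 1.
have B1 : 1 <= B by rewrite /B lerDr.
have fB x : `|f x| <= B.
  by apply: fB0 => //; rewrite /B; have := ler_norm B0; lra.
have mf : measurable_fun [set: measurableTypeR R] f by exact: continuous_measurable_fun.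
have mef : measurable_fun [set: measurableTypeR R] (EFin \o f) by exact/measurable_EFinP.
rewrite integral_dirac// diracT mul1e.
have intf N (g : measurableTypeR R -> R) K : mu N [set: R] = 1%E ->
    measurable_fun [set: measurableTypeR R] g ->
    (forall x, `|g x| <= K) -> (mu N).-integrable [set: measurableTypeR R] (EFin \o g).
  move=> m1 mg gK; apply/integrableP; split; first exact/measurable_EFinP.
  apply: (@le_lt_trans _ _ (\int[mu N]_(x in [set: measurableTypeR R]) (cst K%:E) x)%E).
    apply: ge0_le_integral => //.
    - by apply/measurable_EFinP; apply: measurableT_comp => //; exact: normr_measurable.
    - by move=> x _; rewrite /= lee_fin.
  rewrite integral_cst// -[X in (_ * X)%E]/(mu N [set: R]) m1 mule1 ltry//.
have finf : \forall N \near \oo, (\int[mu N]_x (f x)%:E)%E \is a fin_num.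
  near=> N; apply: integrable_fin_num => //.
  by apply: (intf N f B) => //; near: N.
apply: cvg_EFin => //.
apply/cvgrPdist_le => e e0.
have e2 : 0 < e / 2 by rewrite divr_gt0.
have [delta delta0 fd] : exists2 delta, 0 < delta &
    forall x, `|alpha - x| <= delta -> `|f x - f alpha| <= e / 2.
  have /cvgrPdist_le /(_ _ e2) /nbhs_ballP[d /= d0 hd] := cf alpha.
  exists (d / 2); first by rewrite divr_gt0.
  move=> x xd; rewrite distrC; apply: hd; rewrite -ball_normE /=.
  by apply: (le_lt_trans xd); rewrite ltr_pdivrMr// ltr_pMr// ltr1n.
pose I : set (measurableTypeR R) := `](alpha - delta)%R, (alpha + delta)%R]%classic.
have mI : measurable I by exact: measurable_itv.
have eta0 : 0 < e / (4 * B) by rewrite divr_gt0// mulr_gt0//; lra.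
near=> N.
have m1 : mu N [set: R] = 1%E by near: N.
have mI1 : ((1 - e / (4 * B))%:E <= mu N I)%E by near: N; exact: mu_near.
have ff : (mu N).-integrable [set: measurableTypeR R] (EFin \o f) by exact: (intf N f B).
have fc : (mu N).-integrable [set: measurableTypeR R] (EFin \o (fun=> f alpha)).
  by apply: (intf N _ `|f alpha|) => //; exact: measurable_cst.
pose g x := f x - f alpha.
have mg : measurable_fun [set: measurableTypeR R] g.
  by apply: measurable_funB => //; exact: measurable_cst.
have fg : (mu N).-integrable [set: measurableTypeR R] (EFin \o g).
  apply: (intf N _ (2 * B)) => // x; rewrite /g; apply: le_trans (ler_normB _ _) _.
  by have := fB x; have := fB alpha; lra.
have intE : (\int[mu N]_x (g x)%:E)%E = (\int[mu N]_x (f x)%:E - (f alpha)%:E)%E.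
  rewrite /g; under eq_integral do rewrite EFinB.
  rewrite (integralB measurableT ff fc); congr (_ - _)%E.
  rewrite /= integral_cst// -[X in (_ * X)%E]/(mu N [set: R]) m1 mule1//.
have mIc : (mu N (~` I) <= (e / (4 * B))%:E)%E.
  have : mu N setT = (mu N I + mu N (~` I))%E.
    by rewrite -measureU//; [rewrite setUv | exact: measurableC | rewrite setICr].
  have fI : mu N I \is a fin_num.
    rewrite ge0_fin_numE//; apply: le_lt_trans (ltry 1).
    by rewrite -[1%:E]/1%E -m1; apply: le_measure; rewrite ?inE.
  rewrite -[mu N setT]/(mu N [set: R]) m1 => mE.
  have -> : mu N (~` I) = (1 - mu N I)%E by rewrite mE addeAC subee// add0e.
  move: mI1; rewrite -(fineK fI) -EFinB !lee_fin; lra.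
have gb : (\int[mu N]_x `|g x|%:E <= e%:E)%E.
  (* |f - f alpha| is at most e / 2 on I and 2 B outside, where the mass is at most e / (4 B). *)
  apply: (@le_trans _ _ (\int[mu N]_x ((e / 2)%:E + (2 * B)%:E * (\1_(~` I) x)%:E))%E).
    apply: ge0_le_integral => //.
    - by apply/measurable_EFinP; apply: measurableT_comp => //; exact: normr_measurable.
    - apply: emeasurable_funD; first exact: measurable_cst.
      apply: emeasurable_funM; first exact: measurable_cst.
      by apply/measurable_EFinP; apply: measurable_indic; exact: measurableC.
    move=> x _; rewrite -EFinM -EFinD lee_fin indicE.
    have [xI|xI] := boolP (x \in ~` I).
      rewrite mulr1; have : `|g x| <= 2 * B.
        rewrite /g; apply: le_trans (ler_normB _ _) _.
        by have := fB x; have := fB alpha; lra.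
      lra.
    rewrite mulr0 addr0; apply: fd.
    move: xI; rewrite notin_setE /= => /contrapT; rewrite /I /= in_itv/= => /andP[x1 x2].
    by rewrite ler_norml; apply/andP; split; lra.
  rewrite ge0_integralD//; last 3 first.
  - by move=> x _; rewrite lee_fin; lra.
  - by move=> x _; rewrite -EFinM lee_fin mulr_ge0//; lra.
  - apply: emeasurable_funM; first exact: measurable_cst.
    by apply/measurable_EFinP; apply: measurable_indic; exact: measurableC.
  rewrite integral_cst// -[X in (_ * X + _)%E]/(mu N [set: R]) m1 mule1.
  rewrite ge0_integralZl//; last 2 first.
  - by apply/measurable_EFinP; apply: measurable_indic; exact: measurableC.
  - by rewrite lee_fin; lra.
  rewrite integral_indic//; last exact: measurableC.
  rewrite setIT.
  have Bp : (0 <= (2 * B)%:E)%E by rewrite lee_fin; lra.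
  apply: le_trans (leeD (lexx _) (lee_wpmul2l Bp mIc)) _.
  rewrite -EFinM -EFinD lee_fin.
  have -> : 2 * B * (e / (4 * B)) = e / 2 by field; rewrite gt_eqF//; lra.
  lra.
have fr : (\int[mu N]_x (f x)%:E)%E \is a fin_num by exact: integrable_fin_num.
rewrite distrC -lee_fin; apply: (le_trans _ gb).
have -> : (`|fine (\int[mu N]_x (f x)%:E) - f alpha|%:E = `|\int[mu N]_x (g x)%:E|)%E.
  by rewrite intE -{2}(fineK fr) -EFinB abse_EFin.
by apply: (le_abse_integral (mu N) measurableT); exact/measurable_EFinP.
Unshelve. all: by end_near. Qed.

Lemma near_forall_lt (P : nat -> nat -> Prop) n :
  (forall i, \forall N \near \oo, P i N) ->
  \forall N \near \oo, forall i, (i < n)%N -> P i N.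
Proof.
move=> HP; elim: n => [|n IH]; first by near=> N.
near=> N => i; rewrite ltnS leq_eqVlt => /orP[/eqP ->|].
  by near: N; exact: HP.
by move: i; near: N.
Unshelve. all: by end_near. Qed.

(** Monotonicity traps f N x between its values at two neighbouring grid points, and the 1-Lipschitz
    limit varies little between them; finitely many pointwise limits are then enough. *)
Lemma monotone_cvg_compact (f : nat -> R -> R) (l : R -> R) :
  (\forall N \near \oo, forall x y, x <= y -> f N y <= f N x) ->
  (forall x y, x <= y -> l y <= l x <= l y + (y - x)) ->
  (forall x, f N x @[N --> \oo] --> l x) ->
  {family compact, f @ \oo --> l}.
Proof.
move=> fmono lmono flim; apply/fam_cvgP => A /compact_bounded[B0 [_ AB0]].
pose B := `|B0| + 1.
have AB x : A x -> `|x| <= B.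
  by move=> Ax; apply: AB0 => //; rewrite /B; have := ler_norm B0; lra.
have B1 : 1 <= B by rewrite /B lerDr.
move=> P /uniform_nbhs[E [+ EP]]; rewrite -entourage_ballE => -[e /= e0 eE].
pose h := e / 4; have h0 : 0 < h by rewrite divr_gt0.
pose n := (Num.truncn (2 * B / h)).+1.
pose pt i := - B + i%:R * h.
have fpt : \forall N \near \oo, forall i, (i < n.+1)%N -> `|l (pt i) - f N (pt i)| <= h.
  apply: near_forall_lt => i.
  by move/cvgrPdist_le : (flim (pt i)); exact.
near=> N; apply: EP => /= x Ax; apply: eE; rewrite /= -ball_normE /=.
have /ler_normlP[xB1 xB2] := AB _ Ax.
have fm : forall x y, x <= y -> f N y <= f N x by near: N.
have fp : forall i, (i < n.+1)%N -> `|l (pt i) - f N (pt i)| <= h by near: N.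
have xB0 : 0 <= (x + B) / h by rewrite divr_ge0 ?(ltW h0)//; lra.
pose i := Num.truncn ((x + B) / h).
have i1 : i%:R * h <= x + B by rewrite -ler_pdivlMr// /i truncn_le.
have i2 : x + B < i.+1%:R * h by rewrite -ltr_pdivrMr//; exact: truncnS_gt.
have iN : (i < n)%N.
  rewrite -(ltr_nat R) -(ltr_pM2r h0); apply: (le_lt_trans i1).
  have : 2 * B < n%:R * h by rewrite -ltr_pdivrMr//; exact: truncnS_gt.
  lra.
have /ler_normlP[p1 p2] := fp i (ltnW iN).
have /ler_normlP[q1 q2] := fp i.+1 iN.
have px : pt i <= x by rewrite /pt; lra.
have xq : x <= pt i.+1 by rewrite /pt; lra.
have /andP[_ l1] := lmono _ _ px; have /andP[_ l2] := lmono _ _ xq.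
have := fm _ _ px; have := fm _ _ xq.
have d1 : x - pt i <= h by move: i2; rewrite /pt -natr1; lra.
have d2 : pt i.+1 - x <= h by move: i1; rewrite /pt -natr1; lra.
have he : 4 * h = e by rewrite /h; field.
by move=> f1 f2; rewrite ltr_norml; apply/andP; split; lra.
Unshelve. all: by end_near. Qed.

End WeakConvergence.

(** * The normalized Jessen measure and the lower bound by the prime energy *)

Section JessenMeasure.
Context {R : realType}.
Variables (a : nat -> R[i]) (N : nat).
Hypotheses (a1 : a 1%N = 1) (N_gt0 : (0 < N)%N).

Local Notation J := (jessen (dirichlet_sum a N)).
Local Notation M := (max_index a N).
Local Notation D := (right_derivative J).

Lemma jessen_slope (x y : R) : x <= y -> - ln M%:R * (y - x) <= J y - J x <= 0.
Proof.
move=> xy; rewrite jessen_slope_ge//=.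
by rewrite subr_le0; exact: jessen_nonincreasing.
Qed.

Lemma normalized_jessen_measure_setT : (1 < M)%N ->
  normalized_jessen_measure a N [set: R] = 1%E.
Proof.
move=> M1; have lM : 0 < ln M%:R :> R by rewrite ln_gt0// ltr1n.
have [K [s0 h]] := jessen_ninfty a1 N_gt0.
have -> : normalized_jessen_measure a N [set: R] =
    (((ln M%:R)^-1)%:E * second_derivative J [set: measurableTypeR R])%E by [].
rewrite (second_derivative_setT (jessen_convex a1 N_gt0) jessen_slope (jessen_ge0 a1 N_gt0) h).
by rewrite -EFinM mulVf// gt_eqF.
Qed.

Lemma normalized_jessen_measure_itv (x y : R) : x <= y ->
  normalized_jessen_measure a N `]x, y]%classic = ((ln M%:R)^-1 * (D y - D x))%:E.
Proof.
move=> xy.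
have -> : normalized_jessen_measure a N `]x, y]%classic =
    (((ln M%:R)^-1)%:E * second_derivative J `]x, y]%classic)%E by [].
by rewrite (second_derivative_itv (jessen_convex a1 N_gt0) jessen_slope xy).
Qed.

Lemma jessen_measure_ge (x x' y' y : R) : x < x' -> x' <= y' -> y' < y ->
  (J x - J x') / (x' - x) - (J y' - J y) / (y - y') <= D y - D x.
Proof.
move=> xx xy yy.
have h1 := right_derivative_le_slope (jessen_convex a1 N_gt0) jessen_slope xx.
have h2 := slope_le_right_derivative (jessen_convex a1 N_gt0) jessen_slope yy.
rewrite -ler_pdivlMr ?subr_gt0// in h1.
rewrite -ler_pdivrMr ?subr_gt0// in h2.
move: (J x) (J x') (J y') (J y) (D x) (D y) h1 h2 => jx jx' jy' jy dx dy h1 h2.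
have -> : (jx - jx') / (x' - x) = - ((jx' - jx) / (x' - x)) by rewrite -mulNr opprB.
have -> : (jy' - jy) / (y - y') = - ((jy - jy') / (y - y')) by rewrite -mulNr opprB.
lra.
Qed.

(** All m terms lie in [c / K, K c], so the energy is at most m (K c)^2. The block bound with d = c
    / K and r of order m / k recovers (1/2) ln m up to the factor 1 - (7/8)^k and constants in K and
    k; the remaining loss is estimated through m <= N. *)
Lemma jessen_lower_energy (sg K : R) (s : seq nat) (k : nat) : large_primes N s ->
  1 <= K -> (0 < k)%N -> (k < size s)%N ->
  (forall p q, p \in s -> q \in s ->
    K^-1 <= (cabs (a p) * p%:R `^ (- sg)) / (cabs (a q) * q%:R `^ (- sg)) <= K) ->
  2^-1 * ln (\sum_(p <- s) cabs (a p) ^+ 2 * p%:R `^ (- (2 * sg)))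
    - (2 * ln K + 2^-1 * ln 2 + 2^-1 * ln (2 * k)%:R) - (7 / 8) ^+ k / 2 * ln N%:R
  <= J sg.
Proof.
move=> hs K1 k0 ks comp.
have K0 : 0 < K by lra.
pose x p : R := cabs (a p) * p%:R `^ (- sg).
have xge p : 0 <= x p by rewrite mulr_ge0 ?cabs_ge0 ?powR_ge0.
have x0 p : p \in s -> 0 < x p.
  move=> ps; rewrite lt_def xge andbT; apply/eqP => xp0.
  have /andP[+ _] := comp p p ps ps; rewrite -/(x p) xp0 mul0r.
  by rewrite leNgt invr_gt0 K0.
have [q qs] : exists q, q \in s by case: s ks {hs comp x0} => // q s _; exists q; rewrite mem_head.
pose c := x q; have c0 : 0 < c by exact: x0.
have xc p : p \in s -> c / K <= x p <= K * c.
  move=> ps; have /andP[h1 h2] := comp p q ps qs.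
  rewrite -/(x p) -/(x q) -/c in h1 h2.
  by rewrite mulrC -ler_pdivlMr// h1 -ler_pdivrMr.
have p0 p : p \in s -> (0 < p)%N by move=> /hs.2[/prime_gt0].
pose m := size s.
have m0 : (0 < m)%N by exact: leq_ltn_trans ks.
pose E := \sum_(p <- s) cabs (a p) ^+ 2 * p%:R `^ (- (2 * sg)).
have Ele : E <= m%:R * (K * c) ^+ 2.
  rewrite /E /m -sum1_size natr_sum mulr_suml big_seq [leRHS]big_seq.
  apply: ler_sum => p ps; rewrite mul1r powR_double ?p0// -exprMn.
  have /andP[_ h] := xc p ps; apply: lerXn2r; rewrite ?nnegrE//; first exact: xge.
  by rewrite mulr_ge0 ?ltW.
have E0 : 0 < E.
  rewrite /E (perm_big _ (perm_to_rem qs)) big_cons ltr_pwDl//.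
    by rewrite powR_double ?p0// -exprMn exprn_gt0.
  by apply: sumr_ge0 => p _; rewrite mulr_ge0 ?sqr_ge0 ?powR_ge0.
have mN : (m <= N)%N.
  rewrite -(size_iota 1 N); apply: uniq_leq_size; first exact: hs.1.
  by move=> p ps; rewrite mem_iota add1n ltnS p0//=; have [_ + _] := hs.2 p ps.
(* Dividing m - 1 gives k r < m, which leaves the spare term, and still m <= 2 k r. *)
pose r := (m.-1 %/ k)%N.
have r0 : (0 < r)%N by rewrite divn_gt0// -ltnS prednK.
have kr : (k * r < m)%N.
  by rewrite -[ltnRHS](prednK m0) ltnS mulnC leq_divM.
have mr : (m <= 2 * k * r)%N.
  have : (m.-1 < (r.+1) * k)%N by rewrite /r -ltn_divLR.
  rewrite prednK// => h; apply: (leq_trans h).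
  by rewrite -mulnA mulnCA [(r.+1 * k)%N]mulnC leq_pmul2l// mul2n -addnn -addn1 leq_add2l.
have := jessen_lower a1 N_gt0 hs (divr_gt0 c0 K0) r0
  (fun p ps => proj1 (andP (xc p ps))) kr.
have lc : ln (c / K) = ln c - ln K by rewrite ln_div.
have lE : ln E <= ln m%:R + 2 * (ln K + ln c).
  have : ln E <= ln (m%:R * (K * c) ^+ 2).
    rewrite ler_ln ?posrE//; apply: mulr_gt0; first by rewrite ltr0n.
    by rewrite exprn_gt0// mulr_gt0.
  have Kc : 0 < K * c by rewrite mulr_gt0.
  have -> : ln (m%:R * (K * c) ^+ 2) = ln m%:R + ln ((K * c) ^+ 2).
    by rewrite lnM// posrE ?ltr0n// exprn_gt0.
  by rewrite ln_sqr// lnM.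
have lm : ln m%:R <= ln (2 * k)%:R + ln r%:R :> R.
  rewrite -lnM ?posrE ?ltr0n ?muln_gt0// -natrM ler_ln ?posrE ?ltr0n ?ler_nat//.
  by rewrite !muln_gt0 k0 r0.
have lmN : ln m%:R <= ln N%:R :> R by rewrite ler_ln ?posrE ?ltr0n ?ler_nat.
have l2k : 0 <= ln (2 * k)%:R :> R by rewrite ln_ge0// ler1n muln_gt0.
have t0 : 0 <= (7 / 8) ^+ k :> R by rewrite exprn_ge0.
have t1 : (7 / 8) ^+ k <= 1 :> R by rewrite exprn_ile1//; lra.
rewrite lc -/E; move: (J sg) (ln E) (ln m%:R) (ln r%:R) (ln (2 * k)%:R) (ln N%:R)
  lE lm lmN l2k => j e lm lr lk lN lE hm hN hk h.
move: ((7 / 8) ^+ k) t0 t1 h => th t0 t1 h.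
have h1 : (1 - th) * lm <= (1 - th) * (lk + lr) by rewrite ler_wpM2l// subr_ge0.
have h2 : th * lm <= th * lN by rewrite ler_wpM2l.
have h3 : 0 <= th * lk by rewrite mulr_ge0.
lra.
Qed.

End JessenMeasure.

(** * Passage to the limit in N *)

Section Concentration.
Context {R : realType}.
Variables (a : nat -> R[i]) (alpha : R).
Hypothesis a1 : a 1%N = 1.

Local Notation J N := (jessen (dirichlet_sum a N)).
Local Notation M N := (max_index a N).

Lemma ln_nat_ge (X : R) : \forall N \near \oo, X <= ln (N%:R : R).
Proof.
have := @cvgr_idn R => /cvgryPge /(_ (expR X)) H; near=> N.
have h : expR X <= N%:R by near: N.
by rewrite -[X]expRK ler_ln ?posrE ?expR_gt0//; exact: lt_le_trans (expR_gt0 _) h.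
Unshelve. all: by end_near. Qed.

(** The limit is normalized by ln N and the measure by ln M. Only a lower bound for the mass near
    alpha is required, and ln M <= ln N goes in the right direction for it. *)
Lemma concentration_weak_cvg :
  (forall sg : R, J N sg / ln N%:R @[N --> \oo] --> Num.max (alpha - sg) 0) ->
  M N @[N --> \oo] --> \oo ->
  weak_cvg_probability (normalized_jessen_measure a) (\d_(alpha : measurableTypeR R)).
Proof.
move=> Jlim /cvgnyPge Minf; apply: weak_cvg_dirac.
  near=> N; apply: normalized_jessen_measure_setT => //.
    by near: N; exact: nbhs_infty_gt.
  by near: N; exact: Minf.
move=> delta eta d0 eta0.
pose x := alpha - delta; pose x' := alpha - delta / 2.
pose y' := alpha + delta / 2; pose y := alpha + delta.
(* For x < x' < alpha < y' < y the limit function has chord slope -1 on the left pair and 0 on the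
   right pair. *)
have lims : (J N x / ln N%:R - J N x' / ln N%:R) / (x' - x)
    - (J N y' / ln N%:R - J N y / ln N%:R) / (y - y') @[N --> \oo] --> (1 : R).
  have lim1 : (Num.max (alpha - x) 0 - Num.max (alpha - x') 0) / (x' - x) -
      (Num.max (alpha - y') 0 - Num.max (alpha - y) 0) / (y - y') = 1.
    rewrite [Num.max (alpha - x) _]max_l; last by rewrite /x; lra.
    rewrite [Num.max (alpha - x') _]max_l; last by rewrite /x'; lra.
    rewrite [Num.max (alpha - y') _]max_r; last by rewrite /y'; lra.
    rewrite [Num.max (alpha - y) _]max_r; last by rewrite /y; lra.
    have -> : alpha - x - (alpha - x') = x' - x by ring.
    by rewrite subrr mul0r subr0 divff// gt_eqF// /x /x'; lra.
  rewrite -[X in _ --> X]lim1.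
  by apply: cvgB; apply: cvgM; first [exact: cvgB (Jlim _) (Jlim _) | exact: cvg_cst].
near=> N.
have N0 : (0 < N)%N by near: N; exact: nbhs_infty_gt.
have M1 : (1 < M N)%N by near: N; exact: Minf.
have lM : 0 < ln (M N)%:R :> R by rewrite ln_gt0// ltr1n.
have [/andP[M0 MN] _] := max_indexP a1 N0.
have lMN : ln (M N)%:R <= ln N%:R :> R by rewrite ler_ln ?posrE ?ltr0n ?ler_nat.
rewrite normalized_jessen_measure_itv//; last by rewrite lerD2l; lra.
rewrite lee_fin -/x -/y.
have xx : x < x' by rewrite /x /x'; lra.
have xy : x' <= y' by rewrite /x' /y'; lra.
have yy : y' < y by rewrite /y /y'; lra.
have := jessen_measure_ge a1 N0 xx xy yy.
have : 1 - Num.min eta 1 <= (J N x / ln N%:R - J N x' / ln N%:R) / (x' - x)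
    - (J N y' / ln N%:R - J N y / ln N%:R) / (y - y').
  near: N; apply: (cvgr_ge _ lims).
  by rewrite gtrBl lt_min eta0 ltr01.
move: (J N x) (J N x') (J N y') (J N y) (right_derivative _ x) (right_derivative _ y).
move=> jx jx' jy' jy dx dy.
have lN : 0 < ln N%:R :> R by exact: lt_le_trans lMN.
have -> : (jx / ln N%:R - jx' / ln N%:R) / (x' - x) - (jy' / ln N%:R - jy / ln N%:R) / (y - y') =
   ((jx - jx') / (x' - x) - (jy' - jy) / (y - y')) / ln N%:R by ring.
rewrite ler_pdivlMr// => h1 h2.
(* Truncating eta at 1 keeps this factor nonnegative, so that ln M <= ln N may be multiplied by
   it. *)
have m0 : 0 <= 1 - Num.min eta 1 by rewrite subr_ge0 ge_min lexx orbT.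
have me : Num.min eta 1 <= eta by rewrite ge_min lexx.
rewrite ler_pdivlMl//.
have h3 : (1 - Num.min eta 1) * ln (M N)%:R <= (1 - Num.min eta 1) * ln N%:R.
  by rewrite ler_wpM2l.
have h4 : (1 - eta) * ln (M N)%:R <= (1 - Num.min eta 1) * ln (M N)%:R.
  by rewrite ler_wpM2r ?(ltW lM)// lerD2l lerN2.
rewrite mulrC; apply: (le_trans h4); apply: (le_trans h3); exact: le_trans h1 h2.
Unshelve. all: by end_near. Qed.

Variable Q : nat -> {fset nat}.
Hypotheses (Q_primes : forall N p : nat, p \in Q N ->
    [/\ prime p, N%:R / 2 < p%:R :> R & (p <= N)%N])
  (Q_card : #|` Q N|%fset @[N --> \oo] --> \oo)
  (energy_cvg : forall sigma : R,
    (2 * ln N%:R)^-1 * ln (energy a N sigma) @[N --> \oo]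
      --> Num.max (alpha - sigma) 0)
  (Q_comparable : forall b c : R, b <= c -> c < alpha ->
    exists K : R, 1 <= K /\
      \forall N \near \oo, forall sigma : R, b <= sigma <= c ->
        forall p q : nat, p \in Q N -> q \in Q N ->
          K^-1 <= (cabs (a p) * p%:R `^ (- sigma)) /
                  (cabs (a q) * q%:R `^ (- sigma)) <= K)
  (Q_energy_cvg : forall sigma : R, sigma < alpha ->
    (2 * ln N%:R)^-1 * ln (energy_on a (Q N) sigma) @[N --> \oo] --> alpha - sigma).

Lemma Q_large_primes N : large_primes N (Q N).
Proof.
split; first exact: fset_uniq.
move=> p /Q_primes[pp Np pN]; split => //.
by rewrite -(ltr_nat R) natrM -ltr_pdivrMl// mulrC.
Qed.

Lemma Q_card_ge n : \forall N \near \oo, (n <= size (Q N : seq nat))%N.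
Proof. by move/cvgnyPge : Q_card; exact. Qed.

Lemma max_index_cvg : M N @[N --> \oo] --> \oo.
Proof.
apply/cvgnyPge => A.
have am1 : alpha - 1 < alpha by rewrite gtrBl.
have [K [K1 HK]] := Q_comparable (lexx _) am1.
near=> N.
have cN : (1 <= size (Q N : seq nat))%N by near: N; exact: Q_card_ge.
have [p pQ] : exists p, p \in Q N.
  by apply/fset0Pn; rewrite -cardfs_gt0.
have hK : forall sigma : R, alpha - 1 <= sigma <= alpha - 1 ->
        forall p q : nat, p \in Q N -> q \in Q N ->
          K^-1 <= (cabs (a p) * p%:R `^ (- sigma)) /
                  (cabs (a q) * q%:R `^ (- sigma)) <= K by near: N.
have ap : a p != 0.
  (* If a p were 0, the quotient would be 0 / 0 = 0, below K^-1. *)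
  have /andP[+ _] := hK (alpha - 1) (introT andP (conj (lexx _) (lexx _))) p p pQ pQ.
  apply: contraTneq => ->; rewrite cabs0 !mul0r leNgt invr_gt0.
  by rewrite negbK; lra.
have [pp pN Np] := (Q_large_primes N).2 p pQ.
have pM : (p <= M N)%N by apply: max_index_le => //; rewrite prime_gt0.
have AN : (2 * A <= N)%N by near: N; exact: nbhs_infty_ge.
apply: leq_trans pM; rewrite -(leq_pmul2l (isT : (0 < 2)%N)).
exact: leq_trans AN (ltnW Np).
Unshelve. all: by end_near. Qed.

(** The energy bound is the upper half. For the lower half, nonnegativity suffices when sg >= alpha;
    for sg < alpha the loss splits into three parts of size eta / 3. *)
Lemma jessen_pointwise_cvg sg : J N sg / ln N%:R @[N --> \oo] --> Num.max (alpha - sg) 0.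
Proof.
apply/cvgrPdist_le => eta eta0.
have e3 : 0 < eta / 3 by rewrite divr_gt0.
have up : \forall N \near \oo, J N sg / ln N%:R <= Num.max (alpha - sg) 0 + eta.
  near=> N.
  have N0 : (0 < N)%N by near: N; exact: nbhs_infty_gt.
  have lN : 1 <= ln N%:R :> R by near: N; exact: ln_nat_ge.
  have : `|Num.max (alpha - sg) 0 - (2 * ln N%:R)^-1 * ln (energy a N sg)| <= eta.
    by near: N; move/cvgrPdist_le : (@energy_cvg sg); exact.
  move=> /ler_normlP[h _].
  have := jessen_le_energy sg a1 N0; move: (J N sg) => j hj.
  have : j / ln N%:R <= (2 * ln N%:R)^-1 * ln (energy a N sg).
    by rewrite ler_pdivrMr ?(lt_le_trans ltr01)// invfM mulrAC mulfVK ?gt_eqF ?(lt_le_trans ltr01)//.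
  move: h; move: (Num.max (alpha - sg) 0) => m.
  move: (j / ln _) (_ * ln (energy a N sg)) => u v. lra.
have low : \forall N \near \oo, Num.max (alpha - sg) 0 - eta <= J N sg / ln N%:R.
  have [sa|sa] := leP alpha sg.
    rewrite max_r ?subr_le0//; near=> N.
    have N0 : (0 < N)%N by near: N; exact: nbhs_infty_gt.
    have lN : 1 <= ln N%:R :> R by near: N; exact: ln_nat_ge.
    apply: (@le_trans _ _ 0); first lra.
    by rewrite divr_ge0 ?jessen_ge0//; lra.
  rewrite max_l ?subr_ge0 ?(ltW sa)//.
  have [K [K1 HK]] := Q_comparable (lexx sg) sa.
  (* k is fixed before N, so the constant C below is absorbed by ln N. *)
  have [k [k0 kth]] : exists k, (0 < k)%N /\ (7 / 8) ^+ k / 2 <= eta / 3.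
    have : (7 / 8) ^+ n @[n --> \oo] --> (0 : R) by apply: cvg_expr; rewrite ger0_norm; lra.
    move=> /cvgrPdist_le /(_ _ e3) [] n _ /(_ n.+1 (leqnSn n)) /=.
    rewrite sub0r normrN ger0_norm ?exprn_ge0// => h; exists n.+1; split => //.
    have : 0 <= (7 / 8) ^+ n.+1 :> R by rewrite exprn_ge0.
    by lra.
  pose C : R := 2 * ln K + 2^-1 * ln 2 + 2^-1 * ln (2 * k)%:R.
  near=> N.
  have N0 : (0 < N)%N by near: N; exact: nbhs_infty_gt.
  have lN : 1 <= ln N%:R :> R by near: N; exact: ln_nat_ge.
  have lC : C / (eta / 3) <= ln N%:R by near: N; exact: ln_nat_ge.
  have ks : (k < size (Q N : seq nat))%N by near: N; exact: Q_card_ge.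
  have hK : forall sigma : R, sg <= sigma <= sg ->
        forall p q : nat, p \in Q N -> q \in Q N ->
          K^-1 <= (cabs (a p) * p%:R `^ (- sigma)) /
                  (cabs (a q) * q%:R `^ (- sigma)) <= K by near: N.
  have hB : `|alpha - sg - (2 * ln N%:R)^-1 * ln (energy_on a (Q N) sg)| <= eta / 3.
    by near: N; move/cvgrPdist_le : (@Q_energy_cvg sg sa); exact.
  have l0 : 0 < ln N%:R :> R by lra.
  have := jessen_lower_energy a1 N0 (Q_large_primes N) K1 k0 ks
    (hK sg (introT andP (conj (lexx _) (lexx _)))).
  rewrite -/C -/(energy_on a (Q N) sg).
  move: hB; move: (J N sg) (ln (energy_on a (Q N) sg)) => j e /ler_normlP[_ hB] hj.
  rewrite ler_pdivlMr//.
  have h1 : (alpha - sg - (2 * ln N%:R)^-1 * e) * ln N%:R <= eta / 3 * ln N%:R.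
    by rewrite ler_wpM2r// ltW.
  have h2 : (2 * ln N%:R)^-1 * e * ln N%:R = 2^-1 * e by field; rewrite gt_eqF.
  have h3 : C <= ln N%:R * (eta / 3) by rewrite -ler_pdivrMr.
  have h4 : (7 / 8) ^+ k / 2 * ln N%:R <= eta / 3 * ln N%:R by rewrite ler_wpM2r// ltW.
  move: h3 hj h1 h2 h4; rewrite -/C; have [c ->] : exists c, C = c by exists C.
  move: ((7 / 8) ^+ k) (ln N%:R) => th l; lra.
near=> N.
have h1 : J N sg / ln N%:R <= Num.max (alpha - sg) 0 + eta by near: N.
have h2 : Num.max (alpha - sg) 0 - eta <= J N sg / ln N%:R by near: N.
move: (J N sg / ln N%:R) (Num.max (alpha - sg) 0) h1 h2 => u v h1 h2.
by rewrite ler_norml; apply/andP; split; lra.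
Unshelve. all: by end_near. Qed.

Lemma jessen_compact_cvg :
  {family compact, (fun (N : nat) (sigma : R) => J N sigma / ln N%:R) @ \oo
    --> (fun sigma : R => Num.max (alpha - sigma) 0)}.
Proof.
apply: monotone_cvg_compact.
- near=> N => x y xy.
  have N0 : (0 < N)%N by near: N; exact: nbhs_infty_gt.
  have l0 : 0 <= (ln N%:R)^-1 :> R by rewrite invr_ge0 ln_ge0// ler1n.
  have := jessen_nonincreasing a1 N0 xy.
  by move: (J N x) (J N y) => u v uv; rewrite ler_wpM2r.
- move=> x y xy.
  have ub u : alpha - u <= Num.max (alpha - u) 0 by rewrite le_max lexx.
  have ub0 u : 0 <= Num.max (alpha - u) 0 by rewrite le_max lexx orbT.
  have := (ub x, ub y, ub0 x, ub0 y) => -[[[]]].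
  by rewrite !ge_max; move: (Num.max _ _) (Num.max _ _) => m m' *; apply/and3P; split; lra.
- exact: jessen_pointwise_cvg.
Unshelve. all: by end_near. Qed.

End Concentration.

Local Close Scope complex_scope.

Theorem theorem2p2 (R : realType) (a : nat -> R[i]) (a1 : a 1%N = 1)
  (alpha : R) (Q : nat -> {fset nat})
  (Q_primes : forall N p : nat, p \in Q N ->
    [/\ prime p, N%:R / 2 < p%:R :> R & (p <= N)%N])
  (Q_card : #|` Q N|%fset @[N --> \oo] --> \oo)
  (energy_cvg : forall sigma : R,
    (2 * ln N%:R)^-1 * ln (energy a N sigma) @[N --> \oo]
      --> Num.max (alpha - sigma) 0)
  (Q_comparable : forall b c : R, b <= c -> c < alpha ->
    exists K : R, 1 <= K /\
      \forall N \near \oo, forall sigma : R, b <= sigma <= c ->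
        forall p q : nat, p \in Q N -> q \in Q N ->
          K^-1 <= (cabs (a p) * p%:R `^ (- sigma)) /
                  (cabs (a q) * q%:R `^ (- sigma)) <= K)
  (Q_energy_cvg : {family compactly_in [set sigma : R | sigma < alpha],
    (fun (N : nat) (sigma : R) =>
       (2 * ln N%:R)^-1 * ln (energy_on a (Q N) sigma)) @ \oo
      --> (fun sigma : R => alpha - sigma)}) :
  [/\ {family compact,
        (fun (N : nat) (sigma : R) =>
           jessen (dirichlet_sum a N) sigma / ln N%:R) @ \oo
          --> (fun sigma : R => Num.max (alpha - sigma) 0)},
      weak_cvg_probability (normalized_jessen_measure a)
                           (\d_(alpha : measurableTypeR R)) &
      zero_density_concentration (fun=> a) id alpha].
Proof.
(* Uniform convergence on the compact set {sigma} is convergence at sigma. *)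
have QE (sigma : R) : sigma < alpha ->
    (2 * ln N%:R)^-1 * ln (energy_on a (Q N) sigma) @[N --> \oo] --> alpha - sigma.
  move=> sa; have /fam_cvgP/(_ [set sigma]) := Q_energy_cvg.
  rewrite uniform_set1; apply; split; last exact: compact_set1.
  by move=> _ ->.
have Minf := max_index_cvg Q_primes Q_card Q_comparable.
have W := concentration_weak_cvg a1
  (jessen_pointwise_cvg a1 Q_primes Q_card energy_cvg Q_comparable QE) Minf.
have U := jessen_compact_cvg a1 Q_primes Q_card energy_cvg Q_comparable QE.
by split.
Qed.
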